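(* Let $f$ be a transcendental entire function and let $n$, $m$ and $k$ be positive integers. Suppose that $$\frac{f^{(k)}}{f^n(f^m-1)}$$ is a periodic function with period $c$, and that one of the following conditions is satisfied: (I) $f(z)=e^{P(z)}$, where $P(z)$ is a non-constant entire function; (II) $f(z)$ has a non-zero Picard exceptional value and $\rho_1(f)<+\infty$; (III) $\dfrac{f^{(k+1)}}{f^n(f^m-1)}$ is a periodic function with period $c$. Then $f(z)$ is also a periodic function.
   Context: $f^{(k)}$ denotes the $k$-th derivative of $f$. A meromorphic function $g$ on $\mathbb{C}$ is periodic with period $c$, where $c\in\mathbb{C}\setminus\{0\}$, if $g(z+c)\equiv g(z)$; it is periodic if it is periodic with some non-zero period (the conclusion does not assert that $f$ has period $c$). A (finite) Picard exceptional value of the entire function $f$ is a value $a\in\mathbb{C}$ such that $f(z)\neq a$ for all $z\in\mathbb{C}$. The hyper-order of $f$ is $\rho_1(f)=\limsup_{r\to\infty}\frac{\log^+\log^+ T(r,f)}{\log r}$, where $T(r,f)$ is the Nevanlinna characteristic function of $f$. *)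

(* Defs.v *)
From HB Require Import structures.
From mathcomp Require Import all_boot all_order all_algebra.
From mathcomp Require Import complex.
From mathcomp Require Import all_classical all_reals all_analysis.

Set Implicit Arguments.
Unset Strict Implicit.
Unset Printing Implicit Defensive.

Import Order.TTheory GRing.Theory Num.Theory.
Import numFieldNormedType.Exports.

Local Open Scope classical_set_scope.
Local Open Scope ring_scope.
Local Open Scope complex_scope.

(* R[i] is given the normed module structure of a numFieldType over itself,   *)
(* so that derivable and f^`(k) are complex differentiability and the k-th    *)
(* complex derivative.                                                        *)
HB.instance Definition _ (R : rcfType) := NormedModule.copy R[i] R[i]^o.

Section EntireFunctions.
Variable R : realType.
Implicit Types (f g : R[i] -> R[i]) (c z : R[i]).

Definition entire f : Prop := forall z, derivable f z 1.

Definition transcendental_entire f : Prop :=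
  entire f /\ ~ exists p : {poly R[i]}, forall z, f z = p.[z].

Definition nonconstant f : Prop := ~ exists a, forall z, f z = a.

Definition cexp z : R[i] :=
  (expR (complex.Re z) * cos (complex.Im z)) +i*
  (expR (complex.Re z) * sin (complex.Im z)).

Definition has_period f c : Prop := c != 0 /\ periodic f c.

Definition is_periodic f : Prop := exists c, has_period f c.

(* A meromorphic function is represented by a total function whose values at  *)
(* isolated points (e.g. the junk value x / 0 = 0 at a zero of a denominator) *)
(* are irrelevant.  Accordingly the identity g (z + c) = g z of meromorphic   *)
(* functions is asserted on a punctured neighbourhood of every point.         *)
Definition meromorphic_has_period g c : Prop :=
  c != 0 /\ forall z, \forall w \near z^', g (w + c) = g w.

Definition picard_exceptional f (a : R[i]) : Prop := forall z, f z != a.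

Definition lnplus (x : R) : R := Num.max 0 (ln x).

Definition proximity f (r : R) : R :=
  (2 * pi)^-1 * \int[lebesgue_measure]_(t in `[0, 2 * pi])
    lnplus (Normc.normc (f ((r * cos t) +i* (r * sin t)))).

(* The condition determines n, so xget returns the order of the pole of f at  *)
(* z, or the default 0 if f has no pole there.                                *)
Definition pole_order f z : nat :=
  xget 0%N [set n | (0 < n)%N /\
    exists2 l : R[i], l != 0 & (w - z) ^+ n * f w @[w --> z^'] --> l].

Definition pole_count f (t : R) : R :=
  \sum_(z \in [set z : R[i] | Normc.normc z <= t]) ((pole_order f z)%:R : R).

Definition pole_counting f (r : R) : R :=
  \int[lebesgue_measure]_(t in `]0, r]) ((pole_count f t - pole_count f 0) / t)
  + pole_count f 0 * ln r.

Definition nevanlinna_T (r : R) f : R := proximity f r + pole_counting f r.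

Definition hyper_order f : \bar R :=
  limf_esup (fun r : R => (lnplus (lnplus (nevanlinna_T r f)) / ln r)%:E)
    (+oo : set_system R).

End EntireFunctions.

(* Main.v *)
Require Import Defs.
From mathcomp Require Import all_boot all_order all_algebra.
From mathcomp Require Import complex.
From mathcomp Require Import all_classical all_reals all_analysis.
From mathcomp Require Import ring lra zify.

(** In cases (I) and (II) the function has the form [f = a + exp P] with [P]
    entire: when [f] omits [a], a primitive of [f' / (f - a)] is a logarithm of
    [f - a] up to a constant.  Put [x = exp P], [y z = x (z + c)], [Q z = P (z + c)]
    and [G w = (a + w)^n ((a + w)^m - 1)].  The [k]-th derivative of [f] is [h x]
    with [h] a differential polynomial in [P], so the periodicity of the quotient
    reads [h x G(y) = H y G(x)], where [H] is the translate of [h].  This is a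
    vanishing sum of monomials in [x] and [y] with coefficients that are small
    compared with [x] and [y], and such sums are governed by Borel's lemma
    ([borel]): a monomial can only cancel against monomials whose quotient by it
    is itself a quotient of small functions.  Its proof is differential algebra,
    by elimination of one term with the help of the derivative.

    The exponents [(i, j)] for which [x^i y^j] is a quotient of small functions
    form a subgroup of the plane lattice.  If it has rank two, then powers of both
    [x] and [y] are quotients of small functions, and [P] is affine
    ([rational_axes_affine]); [x] is then periodic.  Otherwise any two such
    exponents are dependent, and since [G] is not a monomial the partners of
    the extreme terms [x y^N] and [y x^N] leave two possibilities
    ([exponential_period]): [y] is a constant root of unity times [x], or [N = 2]
    and [x y] is constant.  In both cases [x] is periodic, with a multiple of [c]
    as period.

    The analytic input is the affineness of [P].  A function is called small if it
    is bounded polynomially in terms of bounds for [P] and [Q] on slightly larger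
    discs.  If [exp p] is a quotient [A / B] of small functions with [B 0] nonzero,
    the Taylor coefficients of [p] obey
    [|p_n| r^n <= 4 log (2 M / |B 0|) + 2 |p 0|], where [M] bounds
    [A] and [B] on the circle of radius [r] ([quotient_coef_bound]).  The zeros of
    [B] are circumvented by evaluating at the centre the function [B exp q] for an
    entire [q] whose real part on the circle is that of [p] times a weight
    [(1 + cos) / 2].  Hence bounds for [P] and [Q] improve to logarithmic ones on
    smaller discs, and iterating this inwards over discs of almost equal radius
    gives growth below the square of the radius.

    In case (III) the two periodic quotients show that the [k]-th derivatives of
    [f] and of its translate are proportional, so [f (z + c) = b f z + p z] with a
    polynomial [p].  As [f] is transcendental over the polynomials
    ([algebraic_entire_poly]), the equation for the denominators is an identity of
    polynomials in [f], which forces [p = 0] and [b ^ m = 1]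
    ([affine_symmetry]); then [m c] is a period.

    Complex analysis starts from Goursat's theorem on rectangles ([goursat]).
    Logarithmic coordinates turn it into the independence of circular means from
    the radius, which yields the Cauchy formula and the power series expansion
    of entire functions. *)

Set Implicit Arguments.
Unset Strict Implicit.
Unset Printing Implicit Defensive.
Import Order.TTheory GRing.Theory Num.Theory.
Import numFieldNormedType.Exports.
Local Open Scope classical_set_scope.
Local Open Scope ring_scope.
Local Open Scope complex_scope.
Local Notation N := Normc.normc.

(** * The modulus and complex differentiability *)

Section Modulus.
Variable R : realType.
Local Notation C := R[i].
Implicit Types x y z w : C.

Lemma N_ge0 z : 0 <= N z.
Proof. by case: z => a b; rewrite /= sqrtr_ge0. Qed.

Lemma NE z : `|z| = (N z)%:C. Proof. by []. Qed.

Lemma N_eq0 z : (N z == 0) = (z == 0).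
Proof.
apply/eqP/eqP => [/Normc.eq0_normc//|->]; exact: Normc.normc0.
Qed.

Lemma N_gt0 z : (0 < N z) = (z != 0).
Proof. by rewrite lt_def N_ge0 andbT N_eq0. Qed.

Lemma ND x y : N (x + y) <= N x + N y. Proof. exact: le_normcD. Qed.

Lemma NN x : N (- x) = N x. Proof. exact: normcN. Qed.

Lemma NB x y : N (x - y) <= N x + N y.
Proof. by rewrite -(NN y) ND. Qed.

Lemma distNC x y : N (x - y) = N (y - x).
Proof. by rewrite -NN opprB. Qed.

Lemma NM x y : N (x * y) = N x * N y. Proof. exact: Normc.normcM. Qed.

Lemma NV x : N x^-1 = (N x)^-1. Proof. exact: Normc.normcV. Qed.

Lemma NX x n : N (x ^+ n) = N x ^+ n.
Proof. by elim: n => [|n IH]; rewrite ?Normc.normc1 // !exprS NM IH. Qed.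

Lemma NR (a : R) : N a%:C = `|a|.
Proof. by rewrite /= expr0n addr0 sqrtr_sqr. Qed.

Lemma Ni : N ('i : C) = 1.
Proof. by rewrite /= expr0n expr1n add0r sqrtr1. Qed.

Lemma Re_leN z : `|complex.Re z| <= N z.
Proof.
case: z => a b /=; rewrite -sqrtr_sqr ler_wsqrtr // lerDl; exact: sqr_ge0.
Qed.

Lemma Im_leN z : `|complex.Im z| <= N z.
Proof.
case: z => a b /=; rewrite -sqrtr_sqr ler_wsqrtr // lerDr; exact: sqr_ge0.
Qed.

Lemma N_leReIm z : N z <= `|complex.Re z| + `|complex.Im z|.
Proof.
case: z => a b /=.
rewrite -(ler_pXn2r (ltn0Sn 1)) ?nnegrE ?sqrtr_ge0 ?addr_ge0 //.
rewrite sqr_sqrtr ?addr_ge0 ?sqr_ge0 // sqrrD !real_normK ?num_real //.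
rewrite [X in _ <= X]addrAC lerDl mulrn_wge0 // mulr_ge0 //.
Qed.

Lemma N_sub_ge x y : N x - N y <= N (x - y).
Proof. by rewrite lerBlDr -{1}(subrK y x) ND. Qed.

Lemma ReD x y : complex.Re (x + y) = complex.Re x + complex.Re y.
Proof. by case: x; case: y. Qed.

Lemma N_sum (I : Type) (r : seq I) (P : pred I) (F : I -> C) :
  N (\sum_(i <- r | P i) F i) <= \sum_(i <- r | P i) N (F i).
Proof.
elim/big_ind2 : _ => //; first by rewrite Normc.normc0.
by move=> a b c d h1 h2; apply: (le_trans (ND _ _)); exact: lerD.
Qed.

Lemma nearC z (P : C -> Prop) : (\forall w \near z, P w) <->
  exists2 d : R, 0 < d & forall w, N (w - z) < d -> P w.
Proof.
split.
  move/nbhs_ballP => [e /= e0 he].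
  have e1 : e = (complex.Re e)%:C.
    by case: e e0 {he} => a b; rewrite /= ltcE /= => /andP[/eqP -> _].
  exists (complex.Re e); first by move: e0; rewrite e1 ltcR.
  move=> w hw; apply: he; rewrite -ball_normE /ball_ /= distrC.
  by rewrite NE e1 ltcR.
move=> [d d0 hd]; apply/nbhs_ballP; exists d%:C; first by rewrite /= ltcR.
move=> w; rewrite -ball_normE /ball_ /= distrC NE ltcR; exact: hd.
Qed.

Lemma near_punctC z (P : C -> Prop) : (\forall w \near z^', P w) <->
  exists2 d : R, 0 < d & forall w, w != z -> N (w - z) < d -> P w.
Proof.
split.
  move=> h; have /nearC[d d0 hd] : \forall w \near z, w != z -> P w by exact: h.
  by exists d => // w wz hw; exact: hd.
move=> [d d0 hd]; have : \forall w \near z, w != z -> P w.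
  by apply/nearC; exists d => // w hw wz; exact: hd.
by [].
Qed.

(** Complex differentiability at [z] with derivative [l], stated with the real
    modulus, where linear arithmetic is available: the order of [R[i]] is only
    partial. *)
Definition cder (f : C -> C) z (l : C) := forall e : R, 0 < e ->
  exists2 d : R, 0 < d & forall h, N h < d ->
    N (f (z + h) - f z - l * h) <= e * N h.

Lemma cder_cvg f z l : cder f z l <->
  (fun h => h^-1 *: (f (h + z) - f z)) @ (0 : C)^' --> l.
Proof.
split=> [H|/cvgrPdist_le H].
  apply/cvgrPdist_le => e e0.
  have e1 : e = (complex.Re e)%:C.
    by case: e e0 => a b; rewrite /= ltcE /= => /andP[/eqP -> _].
  have e2 : 0 < complex.Re e by move: e0; rewrite e1 ltcR.
  have [d d0 hd] := H _ e2.
  apply/near_punctC; exists d => // h h0; rewrite subr0 => hh.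
  rewrite NE e1 lecR -(ler_pM2r (x:=N h)) ?N_gt0 // -NM.
  have -> : (l - h^-1 *: (f (h + z) - f z)) * h = - (f (z + h) - f z - l * h).
    rewrite [h + z]addrC [_ *: _]/(h^-1 * _) mulrBl mulrAC mulVf // mul1r; ring.
  by rewrite NN; exact: hd.
move=> e e0; have /near_punctC[d d0 hd] := H e%:C (ltac:(by rewrite ltcR)).
exists d => // h hh; have [->|h0] := eqVneq h 0.
  by rewrite addr0 mulr0 subrr subr0 Normc.normc0 mulr0.
have := hd h h0; rewrite subr0 => /(_ hh); rewrite NE lecR.
rewrite -(ler_pM2r (x:=N h)) ?N_gt0 // -NM.
have -> : (l - h^-1 *: (f (h + z) - f z)) * h = - (f (z + h) - f z - l * h).
  rewrite [h + z]addrC [_ *: _]/(h^-1 * _) mulrBl mulrAC mulVf // mul1r; ring.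
by rewrite NN.
Qed.
End Modulus.

Section ComplexDerivative.
Variable R : realType.
Local Notation C := R[i].
Implicit Types (f g : C -> C) (z l : C).

Lemma cder_is f z l : cder f z l <-> is_derive z 1 f l.
Proof.
have E : (fun h : C => h^-1 *: ((f \o shift z) (h *: (1 : C)) - f z)) =
         (fun h => h^-1 *: (f (h + z) - f z)).
  by apply/funext => h /=; rewrite [h%:A](mulr1).
split=> [/cder_cvg H|[H1 H2]].
  split; first by rewrite /derivable E; apply/cvg_ex; exists l.
  by rewrite /derive E; apply: cvg_lim.
apply/cder_cvg; rewrite -H2 /derive E.
by move: H1; rewrite /derivable E.
Qed.

Lemma derivable_cder f z : derivable f z 1 -> cder f z (f^`()%classic z).
Proof. by move=> H; apply/cder_is; rewrite derive1E; exact: derivableP. Qed.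

Lemma cder_derivable f z l : cder f z l -> derivable f z 1.
Proof. by move=> /cder_is[]. Qed.

Lemma cder_val f z l : cder f z l -> f^`()%classic z = l.
Proof. by move=> /cder_is[_]; rewrite derive1E. Qed.

Lemma cder_eq f z l m : cder f z l -> l = m -> cder f z m.
Proof. by move=> H <-. Qed.

Lemma cder_unique f z l l' : cder f z l -> cder f z l' -> l = l'.
Proof. by move=> /cder_val <- /cder_val <-. Qed.

Lemma cder_cst (a : C) z : cder (fun=> a) z 0.
Proof. by apply/cder_is; exact: is_derive_cst. Qed.

Lemma cder_id z : cder id z 1.
Proof. by apply/cder_is; exact: is_derive_id. Qed.

Lemma cderD f g z l m :
  cder f z l -> cder g z m -> cder (fun w => f w + g w) z (l + m).
Proof. by move=> /cder_is H /cder_is G; apply/cder_is; exact: is_deriveD. Qed.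

Lemma cderM f g z l m :
  cder f z l -> cder g z m -> cder (fun w => f w * g w) z (l * g z + f z * m).
Proof.
move=> /cder_is H /cder_is G; apply/cder_is.
rewrite addrC [l * _]mulrC; exact: is_deriveM.
Qed.

Lemma cderZ f (a : C) z l : cder f z l -> cder (fun w => a * f w) z (a * l).
Proof.
by move=> H; have := cderM (cder_cst a z) H; rewrite mul0r add0r.
Qed.

Lemma cderN f z l : cder f z l -> cder (fun w => - f w) z (- l).
Proof.
move=> /(cderZ (-1)); rewrite mulN1r.
by under [X in cder X]funext do rewrite mulN1r.
Qed.

Lemma cderB f g z l m :
  cder f z l -> cder g z m -> cder (fun w => f w - g w) z (l - m).
Proof. by move=> H /cderN; exact: cderD. Qed.

Lemma cderX n z : cder (fun w => w ^+ n) z (n%:R * z ^+ n.-1).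
Proof.
elim: n => [|n IH].
  rewrite mul0r; under [X in cder X]funext do rewrite expr0.
  exact: cder_cst.
under [X in cder X]funext do rewrite exprS.
apply: (cder_eq (cderM (cder_id z) IH)); case: n {IH} => [|n] /=.
  by rewrite mul0r mulr0 addr0.
by rewrite mul1r mulrCA -exprS -[in RHS]addn1 natrD mulrDl mul1r addrC.
Qed.

Lemma cder_lip f z l : cder f z l -> exists2 d : R, 0 < d & forall h, N h < d ->
  N (f (z + h) - f z) <= (N l + 1) * N h.
Proof.
move=> /(_ 1 ltr01)[d d0 H]; exists d => // h hd.
have -> : f (z + h) - f z = (f (z + h) - f z - l * h) + l * h by ring.
apply: (le_trans (ND _ _)); rewrite NM mulrDl addrC lerD2l; exact: H.
Qed.

Lemma cder_cont f z l : cder f z l -> {for z, continuous f}.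
Proof.
move=> /cder_is[H _]; apply: differentiable_continuous.
by apply/derivable1_diffP.
Qed.

Lemma cder_comp f g z l m :
  cder f (g z) l -> cder g z m -> cder (f \o g) z (l * m).
Proof.
move=> F G e e0; have [d2 d20 G2] := cder_lip G.
have m0 : 0 < N m + 1 by rewrite ltr_wpDl // N_ge0.
have l0 : 0 < N l + 1 by rewrite ltr_wpDl // N_ge0.
have [d d0 F1] := F (e / 2 / (N m + 1)) ltac:(by rewrite !divr_gt0).
have [d1 d10 G1] := G (e / 2 / (N l + 1)) ltac:(by rewrite !divr_gt0).
exists (Num.min d1 (Num.min d2 (d / (N m + 1)))).
  by rewrite !lt_min d10 d20 divr_gt0.
move=> h; rewrite !lt_min => /and3P[h1 h2 h3] /=.
set k := g (z + h) - g z.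
have kN : N k <= (N m + 1) * N h by exact: G2.
have kd : N k < d.
  by apply: (le_lt_trans kN); rewrite mulrC -ltr_pdivlMr.
have -> : f (g (z + h)) - f (g z) - l * m * h =
  (f (g z + k) - f (g z) - l * k) + l * (k - m * h).
  by rewrite /k addrC [g z + _]addrC subrK; ring.
apply: (le_trans (ND _ _)); have -> : e * N h = e / 2 * N h + e / 2 * N h.
  by lra.
apply: lerD.
  apply: (le_trans (F1 _ kd)); rewrite -mulrA ler_pM2l ?divr_gt0 //.
  by rewrite mulrC ler_pdivrMr // mulrC.
rewrite NM; apply: (le_trans (ler_wpM2l (N_ge0 l) (G1 h h1))).
rewrite mulrA ler_wpM2r ?N_ge0 // mulrCA ger_pMr ?divr_gt0 //.
by rewrite ler_pdivrMr // mul1r lerDl.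
Qed.

Lemma cder_near f g z l (d : R) : 0 < d ->
  (forall w, N (w - z) < d -> f w = g w) -> cder f z l -> cder g z l.
Proof.
move=> d0 E H e e0; have [d1 d10 F] := H e e0.
exists (Num.min d d1); first by rewrite lt_min d0.
move=> h; rewrite lt_min => /andP[h1 h2].
rewrite -!E; first exact: F.
  by rewrite subrr Normc.normc0.
by rewrite addrC addKr.
Qed.

Lemma cderV z : z != 0 -> cder (fun w => w^-1) z (- z^-1 ^+ 2).
Proof.
move=> z0 e e0; have nz : 0 < N z by rewrite N_gt0.
exists (Num.min (N z / 2) (e * N z ^+ 3 / 2)).
  by rewrite lt_min !divr_gt0 // mulr_gt0 ?exprn_gt0.
move=> h; rewrite lt_min => /andP[h1 h2].
have zh : N z / 2 <= N (z + h).
  have := N_sub_ge z (- h); rewrite opprK NN; lra.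
have zh0 : z + h != 0 by rewrite -N_gt0 (lt_le_trans _ zh) // divr_gt0.
have -> : (z + h)^-1 - z^-1 - - z^-1 ^+ 2 * h = h ^+ 2 * (z^-1 ^+ 2 * (z + h)^-1).
  by field; rewrite z0 zh0.
rewrite NM NX expr2 -mulrA mulrC ler_wpM2r ?N_ge0 // NM NX !NV.
have : (N (z + h))^-1 <= 2 / N z.
  by rewrite -[2 / _]invrK invf_div lef_pV2 ?posrE ?N_gt0 // divr_gt0.
move=> H; apply: (@le_trans _ _ (N h * ((N z)^-1 ^+ 2 * (2 / N z)))).
  by rewrite ler_wpM2l ?N_ge0 // ler_wpM2l ?exprn_ge0 ?invr_ge0 ?N_ge0.
apply: (@le_trans _ _ ((e * N z ^+ 3 / 2) * ((N z)^-1 ^+ 2 * (2 / N z)))).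
  by rewrite ler_wpM2r ?(ltW h2) // mulr_ge0 ?exprn_ge0 ?divr_ge0 ?invr_ge0 ?N_ge0.
rewrite le_eqVlt; apply/orP; left; apply/eqP; field; by rewrite gt_eqF.
Qed.

Lemma cder_inv f z l : f z != 0 -> cder f z l ->
  cder (fun w => (f w)^-1) z (- (f z)^-1 ^+ 2 * l).
Proof. by move=> f0 H; apply: cder_comp H; exact: cderV. Qed.

(** * The complex exponential *)

Lemma cexpD z w : cexp (z + w) = cexp z * cexp w.
Proof.
case: z => a b; case: w => c d; rewrite /cexp /= expRD cosD sinD.
by apply/eqP; rewrite eq_complex /=; apply/andP; split; apply/eqP; ring.
Qed.

Lemma cexp0 : cexp 0 = 1 :> C.
Proof. by rewrite /cexp /= expR0 cos0 sin0 mulr1 mulr0. Qed.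

Lemma N_cexp z : N (cexp z) = expR (complex.Re z).
Proof.
rewrite /cexp /= !exprMn -mulrDr cos2Dsin2 mulr1 sqrtr_sqr ger0_norm // expR_ge0.
Qed.

Lemma cexp_neq0 z : cexp z != 0.
Proof. by rewrite -N_gt0 N_cexp expR_gt0. Qed.

Lemma cexpN z : cexp (- z) = (cexp z)^-1.
Proof.
by apply: (mulfI (cexp_neq0 z)); rewrite -cexpD subrr cexp0 divff ?cexp_neq0.
Qed.

Lemma cexpX z n : cexp z ^+ n = cexp (n%:R * z).
Proof.
elim: n => [|n IH]; first by rewrite mul0r cexp0.
by rewrite exprS IH -cexpD -[X in X + _]mul1r -mulrDl -natr1 addrC.
Qed.

Lemma cexp_2pi_i : cexp (0 +i* (2 * pi)) = 1 :> C.
Proof. by rewrite /cexp /= expR0 mulr_natl cos2pi sin2pi mulr1 mulr0. Qed.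

Lemma real_first_order (f : R -> R) (l : R) : is_derive (0 : R) (1 : R) f l ->
  forall e : R, 0 < e -> exists2 d : R, 0 < d &
    forall a, `|a| < d -> `|f a - f 0 - l * a| <= e * `|a|.
Proof.
move=> [H1 H2] e e0.
have H : (fun h => h^-1 *: ((f \o shift 0) (h *: (1 : R)) - f 0)) @ (0 : R)^' --> l.
  by rewrite -H2 /derive; exact: H1.
move/cvgrPdist_le : H => /(_ e e0).
move/nbhs_ballP => [d /= d0 hd]; exists d => // a ad.
have [->|a0] := eqVneq a 0; first by rewrite mulr0 subrr subr0 normr0 mulr0.
have := hd a; rewrite /ball /= sub0r normrN => /(_ ad a0).
rewrite -(ler_pM2r (x:=`|a|)) ?normr_gt0 // -normrM addr0 [_ *: 1]mulr1.
have -> : (l - a^-1 *: (f a - f 0)) * a = - (f a - f 0 - l * a).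
  rewrite [_ *: _]/(a^-1 * _) mulrBl mulrAC mulVf // mul1r; ring.
by rewrite normrN.
Qed.

Lemma cexp_first_order (e : R) : 0 < e -> exists2 d : R, 0 < d &
  forall h : C, N h < d -> N (cexp h - 1 - h) <= e * N h.
Proof.
move=> e0; have [e1 [e10 e11 e19]] : exists e1 : R, [/\ 0 < e1, e1 <= 1 & 9 * e1 <= e].
  exists (Num.min (e / 9) 1); rewrite lt_min divr_gt0 //= ge_min lexx orbT.
  by rewrite mulrC -ler_pdivlMr // ge_min lexx.
have [d1 d10 E] := real_first_order (is_derive_expR 0) e10.
have [d2 d20 S] := real_first_order (is_derive_sin 0) e10.
have [d3 d30 K] := real_first_order (is_derive_cos 0) e10.
exists (Num.min e1 (Num.min d1 (Num.min d2 d3))).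
  by rewrite !lt_min e10 d10 d20.
case=> a b; set n : R := N (a +i* b).
rewrite !lt_min => /and4P[n0 n1 n2 n3].
have ha : `|a| <= n by exact: (Re_leN (a +i* b)).
have hb : `|b| <= n by exact: (Im_leN (a +i* b)).
have := E a (le_lt_trans ha n1); have := S b (le_lt_trans hb n2).
have := K b (le_lt_trans hb n3).
rewrite expR0 sin0 cos0 oppr0 mul0r mul1r !subr0 addr0 mul1r.
set u := expR a; set v := cos b; set w := sin b => hv hw hu.
have e1a : e1 * `|a| <= e1 * n by rewrite ler_wpM2l // ltW.
have e1b : e1 * `|b| <= e1 * n by rewrite ler_wpM2l // ltW.
have n00 : 0 <= n := N_ge0 _.
have hu1 : `|u - 1| <= 2 * n.
  have -> : u - 1 = (u - 1 - a) + a by ring.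
  apply: (le_trans (ler_normD _ _)).
  have : e1 * n <= n by exact: ler_piMl.
  by lra.
have u0 : 0 <= u by exact: expR_ge0.
have u3 : u <= 3.
  have := ler_norm (u - 1); lra.
have -> : cexp (a +i* b) - 1 - (a +i* b) = (u * v - 1 - a) +i* (u * w - b).
  by apply/eqP; rewrite eq_complex /= oppr0 addr0 !eqxx.
apply: (le_trans (N_leReIm _)) => /=.
have -> : u * v - 1 - a = (u - 1 - a) + u * (v - 1) by ring.
have -> : u * w - b = u * (w - b) + (u - 1) * b by ring.
have h1 : `|u * (v - 1)| <= 3 * (e1 * n).
  by rewrite normrM (ger0_norm u0) ler_pM // (le_trans hv).
have h2 : `|u * (w - b)| <= 3 * (e1 * n).
  by rewrite normrM (ger0_norm u0) ler_pM // (le_trans hw).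
have h3 : `|(u - 1) * b| <= 2 * (e1 * n).
  rewrite normrM mulrA [2 * e1]mulrC.
  apply: (@le_trans _ _ (2 * n * e1)); last by lra.
  by rewrite ler_pM //; lra.
have h4 : 9 * e1 * n <= e * n by rewrite ler_wpM2r.
have := ler_normD (u - 1 - a) (u * (v - 1)).
have := ler_normD (u * (w - b)) ((u - 1) * b).
lra.
Qed.

Lemma cder_cexp z : cder (@cexp R) z (cexp z).
Proof.
move=> e e0; have z0 : 0 < N (cexp z) by rewrite N_gt0 cexp_neq0.
have [d d0 H] := cexp_first_order (divr_gt0 e0 z0).
exists d => // h /H H1; rewrite cexpD -{2}[cexp z]mulr1 -mulrBr -mulrBr NM.
by apply: (le_trans (ler_wpM2l (ltW z0) H1)); rewrite mulrA (mulrC _ (e / _)) divfK // gt_eqF.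
Qed.

(** Polar form: [acos] gives the argument up to sign, and the sign is read off
    from the imaginary part. *)
Lemma cexp_surj z : z != 0 -> exists w, cexp w = z.
Proof.
move=> z0; have n0 : 0 < N z by rewrite N_gt0.
have [u [v [-> uv]]] : exists u v, z = (N z * u) +i* (N z * v) /\ u ^+ 2 + v ^+ 2 = 1.
  case: z z0 n0 => a b _ n0; set n := N _ in n0 *.
  exists (a / n), (b / n); split.
    by rewrite !mulrA ![n * _]mulrC !mulfK // gt_eqF.
  rewrite !expr_div_n -mulrDl.
  have -> : a ^+ 2 + b ^+ 2 = n ^+ 2.
    by rewrite /n /= sqr_sqrtr // addr_ge0 ?sqr_ge0.
  by rewrite divff // expf_neq0 // gt_eqF.
have u1 : -1 <= u <= 1.
  rewrite -ler_norml -(@ler_pXn2r _ 2) ?nnegrE // expr1n real_normK ?num_real //.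
  by rewrite -uv lerDl sqr_ge0.
have hs : sin (acos u) ^+ 2 = v ^+ 2.
  have := cos2Dsin2 (acos u); rewrite acosK // -uv => /addrI; exact.
have [t [-> ->]] : exists t, u = cos t /\ v = sin t.
  move/eqP : hs; rewrite eqf_sqr => /orP[] /eqP hs.
    by exists (acos u); rewrite acosK.
  by exists (- acos u); rewrite cosN sinN acosK // hs opprK.
by exists (ln (N z) +i* t); rewrite /cexp /= lnK.
Qed.
End ComplexDerivative.

Arguments Normc.normc : simpl never.

Section ContinuousOperations.
Variables (R : realType) (T : topologicalType).
Implicit Types (f g : T -> R[i]) (x : T).

Lemma cont_atD f g x : {for x, continuous f} -> {for x, continuous g} ->
  {for x, continuous (fun x => f x + g x)}.
Proof. exact: continuousD. Qed.

Lemma cont_atB f g x : {for x, continuous f} -> {for x, continuous g} ->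
  {for x, continuous (fun x => f x - g x)}.
Proof. exact: continuousB. Qed.

Lemma cont_atM f g x : {for x, continuous f} -> {for x, continuous g} ->
  {for x, continuous (fun x => f x * g x)}.
Proof. exact: continuousM. Qed.
End ContinuousOperations.

Section Goursat.
Variable R : realType.
Local Notation C := R[i].
Local Notation mu := (@lebesgue_measure R).
Implicit Types (a b c d m : R) (u v : R -> R) (g h : R -> C) (F G : C -> C) (z : C).

(** * Integrals along segments and Goursat's theorem *)

Definition Rint a b u : R := \int[mu]_(t in `[a, b]) u t.

Lemma Rint_integrable a b u : continuous u -> mu.-integrable `[a, b] (EFin \o u).
Proof.
move=> cu; apply: continuous_compact_integrable; first exact: segment_compact.
by apply: continuous_subspaceT => x; exact: cu.
Qed.

Lemma RintD a b u v : continuous u -> continuous v ->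
  Rint a b (fun t => u t + v t) = Rint a b u + Rint a b v.
Proof. by move=> cu cv; rewrite /Rint RintegralD //; exact: Rint_integrable. Qed.

Lemma RintZ a b k u : continuous u ->
  Rint a b (fun t => k * u t) = k * Rint a b u.
Proof. by move=> cu; rewrite /Rint RintegralZl //; exact: Rint_integrable. Qed.

Lemma Rint_cst a b k : a <= b -> Rint a b (fun=> k) = k * (b - a).
Proof.
move=> ab; rewrite /Rint Rintegral_cst //=; congr (_ * _).
rewrite lebesgue_measure_itv /= lte_fin; case: ltP => // ba.
by apply/eqP; rewrite eq_sym subr_eq0 eq_le ba.
Qed.

Lemma Rint_cat a m b u : continuous u -> a <= m -> m <= b ->
  Rint a b u = Rint a m u + Rint m b u.
Proof.
move=> cu am mb; rewrite /Rint.
have := @Rintegral_itvB _ u (BLeft a) (BRight b) m.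
rewrite !bnd_simp => /(_ (Rint_integrable a b cu) am mb) H.
rewrite -(@Rintegral_itv_obnd_cbnd _ m) -?H; first by rewrite addrC subrK.
apply: integrableS (Rint_integrable m b cu) => //.
by apply: subset_itvr; rewrite bnd_simp.
Qed.

Lemma Rint_bound a b u k : continuous u -> a <= b ->
  (forall t, a <= t <= b -> `|u t| <= k) -> `|Rint a b u| <= k * (b - a).
Proof.
move=> cu ab H; rewrite -Rint_cst //.
apply: (@le_trans _ _ (Rint a b (fun t => `|u t|))).
  by apply: le_normr_Rintegral => //; apply: Rint_integrable.
apply: le_Rintegral => //.
- by apply: Rint_integrable => x; apply: continuous_comp; [exact: cu|exact: norm_continuous].
- by apply: Rint_integrable => x; exact: cst_continuous.
Qed.

Lemma continuous_epsdelta F z : (forall e : R, 0 < e ->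
    exists2 d : R, 0 < d & forall w, N (w - z) < d -> N (F w - F z) <= e) ->
  {for z, continuous F}.
Proof.
move=> H A /nearC[e e0 he]; have [|d d0 hd] := H (e / 2); first by rewrite divr_gt0.
apply/nearC; exists d => // w /hd K; apply: he; lra.
Qed.

Lemma continuous_Re : continuous (@complex.Re R : C -> R).
Proof.
move=> z A /nbhs_ballP[e /= e0 he]; apply/nearC; exists e => // w hw.
apply: he; rewrite /ball /=; apply: le_lt_trans hw; rewrite distNC; apply: le_trans (Re_leN _).
by case: z; case: w.
Qed.

Lemma continuous_Im : continuous (@complex.Im R : C -> R).
Proof.
move=> z A /nbhs_ballP[e /= e0 he]; apply/nearC; exists e => // w hw.
apply: he; rewrite /ball /=; apply: le_lt_trans hw; rewrite distNC; apply: le_trans (Im_leN _).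
by case: z; case: w.
Qed.

Lemma cont_Re g : continuous g -> continuous (fun t => complex.Re (g t)).
Proof. by move=> cg t; apply: continuous_comp; [exact: cg|exact: continuous_Re]. Qed.

Lemma cont_Im g : continuous g -> continuous (fun t => complex.Im (g t)).
Proof. by move=> cg t; apply: continuous_comp; [exact: cg|exact: continuous_Im]. Qed.

Definition cint a b g : C :=
  Rint a b (fun t => complex.Re (g t)) +i* Rint a b (fun t => complex.Im (g t)).

Lemma cintD a b g h : continuous g -> continuous h ->
  cint a b (fun t => g t + h t) = cint a b g + cint a b h.
Proof.
move=> cg ch; apply/eqP; rewrite eq_complex /=; apply/andP; split; apply/eqP.
  rewrite -RintD; [|exact: cont_Re..].
  by congr (Rint a b _); apply/funext => t; case: (g t); case: (h t).
rewrite -RintD; [|exact: cont_Im..].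
by congr (Rint a b _); apply/funext => t; case: (g t); case: (h t).
Qed.

Lemma continuous_scal (k : R) u : continuous u -> continuous (fun t => k * u t).
Proof. by move=> cu t; apply: cvgM; [exact: cvg_cst|exact: cu]. Qed.

Lemma cintZ a b (k : C) g : continuous g ->
  cint a b (fun t => k * g t) = k * cint a b g.
Proof.
move=> cg; case: k => p q.
have cr := cont_Re cg; have ci := cont_Im cg.
apply/eqP; rewrite eq_complex /=; apply/andP; split; apply/eqP.
  rewrite -mulNr -!RintZ // -RintD; [|exact: continuous_scal..].
  by congr (Rint a b _); apply/funext => t; case: (g t) => x y /=; rewrite mulNr.
rewrite -!RintZ // -RintD; [|exact: continuous_scal..].
by congr (Rint a b _); apply/funext => t; case: (g t) => x y /=.
Qed.

Lemma cintB a b g h : continuous g -> continuous h ->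
  cint a b (fun t => g t - h t) = cint a b g - cint a b h.
Proof.
move=> cg ch; have cN : continuous (fun t => -1 * h t).
  by move=> t; apply: cvgM; [exact: cvg_cst|exact: ch].
rewrite -[- cint a b h]mulN1r -(cintZ a b (-1) ch) -(cintD a b cg cN).
by congr (cint a b _); apply/funext => t; rewrite mulN1r.
Qed.

Lemma cint_cst a b (k : C) : a <= b -> cint a b (fun=> k) = k * (b - a)%:C.
Proof.
move=> ab; rewrite /cint !Rint_cst //; case: k => p q.
by apply/eqP; rewrite eq_complex /= !mulr0 subr0 add0r !eqxx.
Qed.

Lemma cint_cat a m b g : continuous g -> a <= m -> m <= b ->
  cint a b g = cint a m g + cint m b g.
Proof.
move=> cg am mb; rewrite /cint (Rint_cat (cont_Re cg) am mb).
by rewrite (Rint_cat (cont_Im cg) am mb).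
Qed.

Lemma cint_bound a b g k : continuous g -> a <= b ->
  (forall t, a <= t <= b -> N (g t) <= k) -> N (cint a b g) <= 2 * k * (b - a).
Proof.
move=> cg ab H; apply: (le_trans (N_leReIm _)).
rewrite mulrAC mulr2n mulrDl mul1r mulrDl ![(b - a) * k]mulrC; apply: lerD.
  apply: Rint_bound => //; first exact: cont_Re.
  by move=> t /H; apply: le_trans; exact: Re_leN.
apply: Rint_bound => //; first exact: cont_Im.
by move=> t /H; apply: le_trans; exact: Im_leN.
Qed.

Lemma continuous_hseg c : continuous (fun s : R => s +i* c).
Proof.
move=> s; apply/cvgrPdist_lt => e e0.
have e1 : e = (complex.Re e)%:C.
  by case: e e0 => x y; rewrite /= ltcE /= => /andP[/eqP -> _].
have e2 : 0 < complex.Re e by move: e0; rewrite e1 ltcR.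
near=> w; rewrite NE e1 ltcR.
rewrite (_ : s +i* c - w +i* c = (s - w)%:C); last first.
  by apply/eqP; rewrite eq_complex /= subrr !eqxx.
rewrite NR; near: w; apply: cvgr_dist_lt => //; exact: cvg_id.
Unshelve. all: by end_near. Qed.

Lemma continuous_vseg a : continuous (fun t : R => a +i* t).
Proof.
move=> t; have -> : (fun t : R => a +i* t) = (fun t => a%:C + 'i * (t +i* 0)).
  apply/funext => x; apply/eqP; rewrite eq_complex /=.
  by apply/andP; split; apply/eqP; ring.
apply: cvgD; first exact: cvg_cst.
by apply: cvgM; [exact: cvg_cst|exact: continuous_hseg].
Qed.

Lemma cont_h F c : continuous F -> continuous (fun s : R => F (s +i* c)).
Proof.
by move=> cF s; apply: continuous_comp; [exact: continuous_hseg|exact: cF].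
Qed.

Lemma cont_v F a : continuous F -> continuous (fun t : R => F (a +i* t)).
Proof.
by move=> cF s; apply: continuous_comp; [exact: continuous_vseg|exact: cF].
Qed.

Lemma cont_sub (g h : R -> C) :
  continuous g -> continuous h -> continuous (fun t => g t - h t).
Proof. by move=> cg ch t; apply: cvgB; [exact: cg|exact: ch]. Qed.

Lemma cont_affine (p q : C) : continuous (fun z => p + q * z).
Proof.
by move=> z; apply: cder_cont (cderD (cder_cst p z) (cderZ q (cder_id z))).
Qed.

(** The contour integral over the boundary of a rectangle; opposite sides are
    paired so that an affine integrand becomes constant on each pair. *)
Definition rectint F a b c d : C :=
  cint a b (fun s => F (s +i* c) - F (s +i* d)) +
  'i * cint c d (fun t => F (b +i* t) - F (a +i* t)).

Arguments cint : simpl never.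
Arguments rectint : simpl never.

Lemma rectint_hcat F a m b c d : continuous F -> a <= m -> m <= b ->
  rectint F a b c d = rectint F a m c d + rectint F m b c d.
Proof.
move=> cF am mb; rewrite /rectint (@cint_cat a m b) //; last first.
  by apply: cont_sub; exact: cont_h.
rewrite addrACA -mulrDr -cintD; try by apply: cont_sub; exact: cont_v.
congr (_ + _ * cint c d _); apply/funext => t; ring.
Qed.

Lemma rectint_vcat F a b c m d : continuous F -> c <= m -> m <= d ->
  rectint F a b c d = rectint F a b c m + rectint F a b m d.
Proof.
move=> cF cm md; rewrite /rectint (@cint_cat c m d) //; last first.
  by apply: cont_sub; exact: cont_v.
rewrite addrACA -mulrDr -cintD; try by apply: cont_sub; exact: cont_h.
congr (cint a b _ + _); apply/funext => t; ring.
Qed.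

Lemma rectintB F G a b c d : continuous F -> continuous G ->
  rectint (fun z => F z - G z) a b c d = rectint F a b c d - rectint G a b c d.
Proof.
move=> cF cG; rewrite /rectint opprD addrACA -mulrBr.
rewrite -!cintB; try by apply: cont_sub; (exact: cont_h || exact: cont_v).
congr (cint a b _ + _ * cint c d _); apply/funext => t; ring.
Qed.

Lemma rectint_affine (p q : C) a b c d : a <= b -> c <= d ->
  rectint (fun z => p + q * z) a b c d = 0.
Proof.
move=> ab cd; rewrite /rectint.
have -> : (fun s : R => p + q * (s +i* c) - (p + q * (s +i* d))) =
    (fun=> q * 'i * (c - d)%:C).
  apply/funext => s; rewrite opprD addrACA subrr add0r -mulrBr -mulrA.
  by congr (_ * _); apply/eqP; rewrite eq_complex /=; apply/andP; split; apply/eqP; ring.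
have -> : (fun t : R => p + q * (b +i* t) - (p + q * (a +i* t))) =
    (fun=> q * (b - a)%:C).
  apply/funext => s; rewrite opprD addrACA subrr add0r -mulrBr.
  by congr (_ * _); apply/eqP; rewrite eq_complex /=; apply/andP; split; apply/eqP; ring.
rewrite !cint_cst // -(opprB d c) rmorphN /=; ring.
Qed.

Lemma rectint_bound F a b c d k : continuous F -> a <= b -> c <= d ->
  (forall s t, a <= s <= b -> c <= t <= d -> N (F (s +i* t)) <= k) ->
  N (rectint F a b c d) <= 4 * k * ((b - a) + (d - c)).
Proof.
move=> cF ab cd H; apply: (le_trans (ND _ _)); rewrite NM Ni mul1r mulrDr.
have -> : 4 * k = 2 * (k + k) by ring.
apply: lerD.
  apply: cint_bound => //; first by apply: cont_sub; exact: cont_h.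
  move=> s sab; apply: (le_trans (NB _ _)); apply: lerD; apply: H => //;
  by rewrite ?lexx ?cd.
apply: cint_bound => //; first by apply: cont_sub; exact: cont_v.
move=> s sab; apply: (le_trans (NB _ _)); apply: lerD; apply: H => //;
by rewrite ?lexx ?ab.
Qed.

Lemma half_pow_small (x e : R) : 0 <= x -> 0 < e -> exists n, x / 2 ^+ n < e.
Proof.
move=> x0 e0; have xe : 0 <= x / e by rewrite divr_ge0 // ltW.
exists (Num.bound (x / e)).
rewrite ltr_pdivrMr ?exprn_gt0 // mulrC -ltr_pdivrMr //.
apply: (lt_le_trans (archi_boundP xe)).
by rewrite -natrX ler_nat ltnW // ltn_expl.
Qed.

(** Nested intervals: every right end bounds all left ends, so the supremum of
    the left ends lies in each interval. *)
Lemma nested_point (x : nat -> R) (w : R) : 0 <= w ->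
  (forall n, x n <= x n.+1 /\ x n.+1 + w / 2 ^+ n.+1 <= x n + w / 2 ^+ n) ->
  exists p, forall n, x n <= p <= x n + w / 2 ^+ n.
Proof.
move=> w0 H.
have inc n k : x n <= x (n + k)%N.
  elim: k => [|k IH]; first by rewrite addn0.
  by rewrite addnS (le_trans IH) //; case: (H (n + k)%N).
have dec n k : x (n + k)%N + w / 2 ^+ (n + k) <= x n + w / 2 ^+ n.
  elim: k => [|k IH]; first by rewrite addn0.
  by rewrite addnS; apply: le_trans IH; case: (H (n + k)%N).
have pos n : 0 <= w / 2 ^+ n by rewrite divr_ge0 // exprn_ge0.
have ub (n k : nat) : x k <= x n + w / 2 ^+ n.
  have h1 := inc k n; have h2 := dec n k; have h3 := pos (n + k)%N.
  rewrite addnC in h1; lra.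
exists (sup (range x)) => n; apply/andP; split.
  apply: ub_le_sup; last by exists n.
  by exists (x 0%N + w / 2 ^+ 0) => _ [k _ <-]; exact: ub.
apply: ge_sup; first by exists (x 0%N), 0%N.
by move=> _ [k _ <-]; exact: ub.
Qed.

(** Quartering: if the contour integral exceeded [e * size^2], the same would
    hold for nested quarters shrinking to a point, where differentiability
    makes the integrand affine up to [o(size)]. *)
Theorem goursat F a b c d : continuous F -> a <= b -> c <= d ->
  (forall s t, a <= s <= b -> c <= t <= d -> exists l, cder F (s +i* t) l) ->
  rectint F a b c d = 0.
Proof.
move=> cF ab cd dF; apply/eqP/negPn/negP => I0.
set w := b - a; set h := d - c.
have w0 : 0 <= w by rewrite subr_ge0.
have h0 : 0 <= h by rewrite subr_ge0.
set q := fun (n : nat) (p : R * R) =>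
  rectint F p.1 (p.1 + w / 2 ^+ n) p.2 (p.2 + h / 2 ^+ n).
have [e e0 He] : exists2 e : R, 0 < e & e * (w + h) ^+ 2 < N (rectint F a b c d).
  have n0 : 0 < N (rectint F a b c d) by rewrite N_gt0.
  have s0 : 0 <= (w + h) ^+ 2 by exact: sqr_ge0.
  have s1 : 0 < (w + h) ^+ 2 + 1 by rewrite ltr_wpDl.
  exists (N (rectint F a b c d) / ((w + h) ^+ 2 + 1)); first by rewrite divr_gt0.
  by rewrite mulrAC ltr_pdivrMr // mulrDr mulr1 ltrDl.
set bad := fun n p => e * ((w + h) / 2 ^+ n) ^+ 2 < N (q n p).
have step n p : exists p', bad n p ->
    [/\ bad n.+1 p',
      p.1 <= p'.1 /\ p'.1 + w / 2 ^+ n.+1 <= p.1 + w / 2 ^+ n &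
      p.2 <= p'.2 /\ p'.2 + h / 2 ^+ n.+1 <= p.2 + h / 2 ^+ n].
  apply: contrapT => /forallNP K.
  have bp : bad n p by apply: contrapT => nb; apply: (K p) => /nb.
  have {}K p' : p.1 <= p'.1 /\ p'.1 + w / 2 ^+ n.+1 <= p.1 + w / 2 ^+ n ->
      p.2 <= p'.2 /\ p'.2 + h / 2 ^+ n.+1 <= p.2 + h / 2 ^+ n ->
      N (q n.+1 p') <= e * ((w + h) / 2 ^+ n.+1) ^+ 2.
    move=> h1 h2; rewrite leNgt; apply/negP => h3.
    by apply: (K p') => _; split.
  set w' := w / 2 ^+ n.+1; set h' := h / 2 ^+ n.+1.
  have ew : w / 2 ^+ n = w' + w'.
    by rewrite /w' exprS; field; rewrite expf_neq0.
  have eh : h / 2 ^+ n = h' + h'.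
    by rewrite /h' exprS; field; rewrite expf_neq0.
  have es : (w + h) / 2 ^+ n = (w' + h') + (w' + h').
    by rewrite mulrDl ew eh; ring.
  have w'0 : 0 <= w' by rewrite divr_ge0 // exprn_ge0.
  have h'0 : 0 <= h' by rewrite divr_ge0 // exprn_ge0.
  have es' : (w + h) / 2 ^+ n.+1 = w' + h' by rewrite mulrDl.
  rewrite es' ew eh in K.
  case: p bp K => x y.
  have xL : x <= x /\ x + w' <= x + w' + w' by split; rewrite ?lerDl.
  have xR : x <= x + w' /\ x + w' + w' <= x + w' + w' by split; rewrite ?lerDl.
  have yL : y <= y /\ y + h' <= y + h' + h' by split; rewrite ?lerDl.
  have yR : y <= y + h' /\ y + h' + h' <= y + h' + h' by split; rewrite ?lerDl.
  rewrite /bad /q es ew eh /=.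
  have x1 : x <= x + w' by rewrite lerDl.
  have x2 : x + w' <= x + (w' + w') by rewrite addrA lerDl.
  have y1 : y <= y + h' by rewrite lerDl.
  have y2 : y + h' <= y + (h' + h') by rewrite addrA lerDl.
  rewrite (rectint_hcat _ _ cF x1 x2).
  rewrite (rectint_vcat x (x + w') cF y1 y2).
  rewrite (rectint_vcat (x + w') (x + (w' + w')) cF y1 y2).
  rewrite [x + (w' + w')]addrA [y + (h' + h')]addrA.
  move=> bp K.
  have /= K1 := K (x, y) xL yL; have /= K2 := K (x + w', y) xR yL.
  have /= K3 := K (x, y + h') xL yR; have /= K4 := K (x + w', y + h') xR yR.
  rewrite -/w' -/h' in K1 K2 K3 K4.
  set s := w' + h' in bp K1 K2 K3 K4.
  have e4 : e * (s + s) ^+ 2 = 4 * (e * s ^+ 2) by ring.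
  move: bp; rewrite e4; apply/negP; rewrite -leNgt.
  apply: (le_trans (ND _ _)).
  have := ND (rectint F x (x + w') y (y + h')) (rectint F x (x + w') (y + h') (y + h' + h')).
  have := ND (rectint F (x + w') (x + w' + w') y (y + h'))
             (rectint F (x + w') (x + w' + w') (y + h') (y + h' + h')).
  by lra.
have [f Hf] := choice (fun np : nat * (R * R) => step np.1 np.2).
pose x := fix x n := if n is m.+1 then f (m, x m) else (a, c).
have B n : bad n (x n).
  elim: n => [|n IH]; last by have [] := Hf (n, x n) IH.
  rewrite /bad /q /= expr0 !divr1 /w /h.
  by rewrite [a + _]addrC subrK [c + _]addrC subrK.
have S n := Hf (n, x n) (B n).
have [p Hp] := @nested_point (fun n => (x n).1) w w0 (fun n => let: And3 _ u _ := S n in u).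
have [r Hr] := @nested_point (fun n => (x n).2) h h0 (fun n => let: And3 _ _ u := S n in u).
have [||l Hl] := dF p r.
- by have := Hp 0%N; rewrite /= expr0 divr1 /w [a + _]addrC subrK.
- by have := Hr 0%N; rewrite /= expr0 divr1 /h [c + _]addrC subrK.
have [dl dl0 Hd] := Hl (e / 8) ltac:(by rewrite divr_gt0).
have [n Hn] := half_pow_small (addr_ge0 w0 h0) dl0.
have := B n; rewrite /bad /q.
set s := (w + h) / 2 ^+ n in Hn *.
have s0 : 0 <= s by rewrite divr_ge0 ?exprn_ge0 // addr_ge0.
apply/negP; rewrite -leNgt.
set w' := w / 2 ^+ n; set h' := h / 2 ^+ n.
have w'0 : 0 <= w' by rewrite divr_ge0 // exprn_ge0.
have h'0 : 0 <= h' by rewrite divr_ge0 // exprn_ge0.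
have es : s = w' + h' by rewrite /s mulrDl.
set z0 := p +i* r in Hd.
set A := fun z : C => (F z0 - l * z0) + l * z.
have cA : continuous A.
  exact: cont_affine.
have -> : rectint F (x n).1 ((x n).1 + w') (x n).2 ((x n).2 + h') =
  rectint (fun z => F z - A z) (x n).1 ((x n).1 + w') (x n).2 ((x n).2 + h').
  by rewrite rectintB // rectint_affine ?subr0 //; lra.
have Hpn := Hp n; have Hrn := Hr n; rewrite -/w' in Hpn; rewrite -/h' in Hrn.
have HB : N (rectint (fun z => F z - A z) (x n).1 ((x n).1 + w') (x n).2 ((x n).2 + h'))
   <= 4 * (e / 8 * s) * (((x n).1 + w' - (x n).1) + ((x n).2 + h' - (x n).2)).
  apply: rectint_bound; [|by lra|by lra|].
    by move=> z; exact: (cont_atB (@cF z) (@cA z)).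
  move=> u v Hu Hv.
  have hN : N (u +i* v - z0) <= s.
    apply: (le_trans (N_leReIm _)); rewrite es; apply: lerD => /=.
      by rewrite ler_norml; lra.
    by rewrite ler_norml; lra.
  have := Hd (u +i* v - z0) (le_lt_trans hN Hn).
  rewrite [z0 + _]addrC subrK.
  have -> : F (u +i* v) - F z0 - l * (u +i* v - z0) = F (u +i* v) - A (u +i* v).
    by rewrite /A; ring.
  move=> H; apply: (le_trans H); rewrite ler_wpM2l // divr_ge0 // ltW //.
apply: (le_trans HB).
have -> : 4 * (e / 8 * s) * (((x n).1 + w' - (x n).1) + ((x n).2 + h' - (x n).2)) =
  e * s ^+ 2 / 2 by rewrite es; field.
have : 0 <= e * s ^+ 2 by rewrite mulr_ge0 ?sqr_ge0 // ltW.
by lra.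
Qed.
End Goursat.

Section CauchyFormula.
Variable R : realType.
Local Notation C := R[i].
Implicit Types (f F G : C -> C) (g h : R -> C) (r s t : R) (z w : C).

(** * The Cauchy formula *)

Definition pt r t : C := r%:C * cexp (0 +i* t).

Lemma N_pt r t : N (pt r t) = `|r|.
Proof. by rewrite /pt NM NR N_cexp expR0 mulr1. Qed.

Lemma pt_neq r t z : N z < r -> pt r t != z.
Proof.
move=> zr; apply: contraTneq zr => <-; rewrite N_pt -leNgt; exact: ler_norm.
Qed.

Lemma pt_expR s t : pt (expR s) t = cexp (s +i* t).
Proof.
rewrite (_ : s +i* t = s%:C + 0 +i* t); last first.
  by apply/eqP; rewrite eq_complex /= addr0 add0r !eqxx.
by rewrite cexpD; congr (_ * _); rewrite /cexp /= cos0 sin0 mulr1 mulr0.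
Qed.

Definition avg g : C := (2 * pi)^-1%:C * cint 0 (2 * pi) g.

Definition mean r F : C := avg (fun t => F (pt r t)).

Lemma twopi_gt0 : 0 < 2 * pi :> R.
Proof. by rewrite mulr_gt0 ?pi_gt0. Qed.

Lemma avgD g h : continuous g -> continuous h ->
  avg (fun t => g t + h t) = avg g + avg h.
Proof. by move=> cg ch; rewrite /avg cintD // mulrDr. Qed.

Lemma avgB g h : continuous g -> continuous h ->
  avg (fun t => g t - h t) = avg g - avg h.
Proof. by move=> cg ch; rewrite /avg cintB // mulrBr. Qed.

Lemma avgZ (k : C) g : continuous g -> avg (fun t => k * g t) = k * avg g.
Proof. by move=> cg; rewrite /avg cintZ // mulrCA. Qed.

Lemma avg_cst (k : C) : avg (fun=> k) = k.
Proof.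
rewrite /avg cint_cst ?(ltW twopi_gt0) // subr0 mulrCA -rmorphM /=.
by rewrite mulVf ?mulr1 // gt_eqF // twopi_gt0.
Qed.

Lemma avg_bound g (k : R) : continuous g ->
  (forall t, 0 <= t <= 2 * pi -> N (g t) <= k) -> N (avg g) <= 2 * k.
Proof.
move=> cg H; rewrite /avg NM NR gtr0_norm ?invr_gt0 ?twopi_gt0 //.
rewrite ler_pdivrMl ?twopi_gt0 // [X in _ <= X]mulrC.
by have := cint_bound cg (ltW twopi_gt0) H; rewrite subr0.
Qed.

Lemma cont_pt r : continuous (pt r).
Proof.
move=> t; apply: cvgM; first exact: cvg_cst.
apply: (@continuous_comp _ _ _ (fun t : R => 0 +i* t) (@cexp R)).
  exact: continuous_vseg.
exact: cder_cont (cder_cexp _).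
Qed.

Lemma cont_circle F r : (forall z, N z = r -> {for z, continuous F}) -> 0 <= r ->
  continuous (fun t => F (pt r t)).
Proof.
move=> H r0 t; apply: continuous_comp; first exact: cont_pt.
by apply: H; rewrite N_pt ger0_norm.
Qed.

(** Logarithmic coordinates turn the annulus into a rectangle whose horizontal
    sides have the same image.  The real part is clamped to a range slightly
    larger than the rectangle, which makes the integrand continuous on the
    whole plane without changing it near the rectangle. *)
Lemma mean_const F (p1 r1 r2 p2 : R) : 0 <= p1 -> p1 < r1 -> r1 <= r2 ->
  r2 < p2 -> (forall z, p1 < N z < p2 -> exists l, cder F z l) ->
  mean r1 F = mean r2 F.
Proof.
move=> p0 p1r r12 rp2 dF.
have r10 : 0 < r1 by exact: le_lt_trans p1r.
have r20 : 0 < r2 by exact: lt_le_trans r12.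
have p20 : 0 < p2 by exact: lt_trans rp2.
set q1 := (p1 + r1) / 2; set q2 := (r2 + p2) / 2.
have q10 : 0 < q1 by rewrite /q1; lra.
have q20 : 0 < q2 by rewrite /q2; lra.
set l1 := ln q1; set l2 := ln q2; set a := ln r1; set b := ln r2.
have l1a : l1 < a by rewrite ltr_ln ?posrE // /q1; lra.
have bl2 : b < l2 by rewrite ltr_ln ?posrE // /q2; lra.
have ab : a <= b by rewrite ler_ln ?posrE.
have la : l1 <= a <= l2 by lra.
have lb : l1 <= b <= l2 by lra.
set cl := fun w : C => (Num.max l1 (Num.min l2 (complex.Re w))) +i* complex.Im w.
have ccl : continuous cl.
  move=> w; have -> : cl = (fun w => (Num.max l1 (Num.min l2 (complex.Re w))) +i* 0
      + (0 +i* complex.Im w)).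
    by apply/funext => u; apply/eqP; rewrite eq_complex /= addr0 add0r !eqxx.
  apply: cont_atD.
    apply: (@continuous_comp _ _ _
      (fun w => Num.max l1 (Num.min l2 (complex.Re w))) (fun s : R => s +i* 0)).
      apply: (@continuous_comp _ _ _ (@complex.Re R) (fun x => Num.max l1 (Num.min l2 x))).
        exact: continuous_Re.
      apply: (@continuous_max _ _ (cst l1) (fun x => Num.min l2 x)).
        exact: cst_continuous.
      apply: (@continuous_min _ _ (cst l2) id); first exact: cst_continuous.
      exact: cvg_id.
    exact: continuous_hseg.
  apply: (@continuous_comp _ _ _ (@complex.Im R) (fun s : R => 0 +i* s)).
    exact: continuous_Im.
  exact: continuous_vseg.
have Ncl w : p1 < N (cexp (cl w)) < p2.
  rewrite N_cexp /=; apply/andP; split.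
    apply: (@lt_le_trans _ _ q1); first by rewrite /q1; lra.
    by rewrite -(lnK q10) ler_expR le_max lexx.
  apply: (@le_lt_trans _ _ q2); last by rewrite /q2; lra.
  rewrite -(lnK q20) ler_expR ge_max ge_min lexx /= andbT.
  rewrite /l1 ler_ln ?posrE // /q1 /q2; lra.
set G := F \o @cexp R \o cl.
have cG : continuous G.
  move=> w; apply: (@continuous_comp _ _ _ cl (F \o @cexp R)); first exact: ccl.
  have [l Hl] := dF _ (Ncl w).
  exact: cder_cont (cder_comp Hl (cder_cexp _)).
have clE s t : l1 <= s <= l2 -> cl (s +i* t) = s +i* t.
  by move=> /andP[h1 h2]; rewrite /cl /=; congr (_ +i* _); rewrite min_r // max_r.
have dG s t : a <= s <= b -> 0 <= t <= 2 * pi -> exists l, cder G (s +i* t) l.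
  move=> /andP[h1 h2] _.
  have [l Hl] := dF _ (Ncl (s +i* t)).
  have := cder_comp Hl (cder_cexp _); rewrite clE; last by lra.
  move=> K; exists (l * cexp (s +i* t)).
  apply: (@cder_near _ (F \o @cexp R) G _ _ (Num.min (s - l1) (l2 - s))) K.
    by rewrite lt_min; lra.
  move=> w; rewrite lt_min => /andP[k1 k2].
  have := Re_leN (w - (s +i* t)); case: w k1 k2 => u v /= k1 k2 k3.
  rewrite /G /=; congr (F (cexp _)); rewrite clE //.
  have := ler_norm (u - s); have := ler_norm (s - u); rewrite distrC; lra.
have := goursat cG ab (ltW twopi_gt0) dG.
rewrite /rectint.
have -> : (fun s : R => G (s +i* 0) - G (s +i* (2 * pi))) = (fun=> 0).
  apply/funext => s; apply/eqP; rewrite subr_eq0; apply/eqP.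
  rewrite /G /=; congr F; rewrite /cl /=.
  have -> : forall x : R, x +i* (2 * pi) = x +i* 0 + 0 +i* (2 * pi).
    by move=> x; apply/eqP; rewrite eq_complex /= addr0 add0r !eqxx.
  by rewrite cexpD cexp_2pi_i mulr1.
rewrite cint_cst // mul0r add0r => /eqP; rewrite mulf_eq0.
rewrite -N_eq0 Ni oner_eq0 /= cintB; try exact: cont_v.
rewrite subr_eq0 => /eqP H; rewrite /mean /avg; congr (_ * _).
have E r : 0 < r -> l1 <= ln r <= l2 ->
    (fun t => F (pt r t)) = (fun t => G (ln r +i* t)).
  move=> h1 h2; apply/funext => t; rewrite /G /=.
  by rewrite (clE _ _ h2) -pt_expR (lnK h1).
rewrite (E r1 r10 la) (E r2 r20 lb); exact: (esym H).
Qed.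

Lemma mean_cont F r0 : continuous F -> forall e : R, 0 < e -> exists2 d : R, 0 < d &
  forall r, `|r - r0| < d -> N (mean r F - mean r0 F) <= e.
Proof.
move=> cF e e0.
have cF2 : continuous (fun p : R * R => F (pt p.1 p.2)).
  move=> p; apply: (@continuous_comp _ _ _ (fun p : R * R => pt p.1 p.2) F); last exact: cF.
  apply: cvgM.
    apply: (@continuous_comp _ _ _ (fun p : R * R => p.1) (fun s : R => s%:C)).
      exact: cvg_fst.
    exact: continuous_hseg.
  apply: (@continuous_comp _ _ _ (fun p : R * R => p.2) (fun t : R => cexp (0 +i* t))).
    exact: cvg_snd.
  apply: (@continuous_comp _ _ _ (fun t : R => 0 +i* t) (@cexp R)).
    exact: continuous_vseg.
  exact: cder_cont (cder_cexp _).
have e40 : 0 < e / 4 by rewrite divr_gt0.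
have := @segment_compact R 0 (2 * pi).
move=> /compact_near_coveringP /(_ _ (nbhs r0) (fun r t => N (F (pt r t) - F (pt r0 t)) <= e / 2)).
have H t : `[0, 2 * pi]%classic t ->
    \forall t' \near t & r \near r0, N (F (pt r t') - F (pt r0 t')) <= e / 2.
  move=> _.
  have /nearC[d d0 Hd] : \forall w \near F (pt r0 t), N (w - F (pt r0 t)) < e / 4.
    by apply/nearC; exists (e / 4).
  have /= K := cF2 (r0, t).
  have {}K : \forall p \near (r0, t), N (F (pt p.1 p.2) - F (pt r0 t)) < e / 4.
    by apply: (K (fun w => N (w - F (pt r0 t)) < e / 4)); apply/nearC; exists (e / 4).
  have [[U V] /= [nU nV] UV] := K.
  exists (V, U) => //= -[t' r] /= [Vt Ur].
  have h1 := UV (r, t') (conj Ur Vt); have h2 := UV (r0, t') (conj (nbhs_singleton nU) Vt).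
  rewrite /= in h1 h2.
  have -> : F (pt r t') - F (pt r0 t') =
    (F (pt r t') - F (pt r0 t)) - (F (pt r0 t') - F (pt r0 t)) by ring.
  by apply: (le_trans (NB _ _)); lra.
move=> /(_ _ H) /nbhs_ballP[d /= d0 Hd].
exists d => // r rd; have := Hd r; rewrite /ball /= distrC => /(_ rd) K.
have cc r' : continuous (fun t => F (pt r' t)).
  by move=> t; apply: continuous_comp; [exact: cont_pt|exact: cF].
rewrite /mean -avgB //; have -> : e = 2 * (e / 2) by field.
by apply: avg_bound; [exact: cont_sub|move=> t ht; apply: K; rewrite /= in_itv].
Qed.

Lemma mean0 F : mean 0 F = F 0.
Proof.
rewrite /mean (_ : (fun t => F (pt 0 t)) = (fun=> F 0)) ?avg_cst //.
by apply/funext => t; rewrite /pt mul0r.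
Qed.

Lemma N_small_eq0 z : (forall e : R, 0 < e -> N z <= e) -> z = 0.
Proof.
move=> H; apply/eqP; rewrite -N_eq0 eq_le N_ge0 andbT.
by apply/ler_addgt0Pr => e /H; rewrite add0r.
Qed.

(** Entireness, sealed so that unification does not unfold it into a statement
    about limits. *)
Variant holo f : Prop := Holo of entire f.

Lemma entire_cder f z : holo f -> cder f z (f^`()%classic z).
Proof. by case=> ef; exact: derivable_cder. Qed.

Lemma cder_entire f : (forall z, exists l, cder f z l) -> holo f.
Proof. by move=> H; split=> z; have [l Hl] := H z; exact: cder_derivable Hl. Qed.

Lemma entire_cont f : holo f -> continuous f.
Proof. by move=> ef z; exact: cder_cont (entire_cder z ef). Qed.

(** The difference quotient is merely continuous at [z0]; the circle through
    [z0] is crossed by continuity of the mean in the radius. *)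
Lemma mean_quotient f z0 r : holo f -> N z0 < r ->
  mean r (fun z => z * ((f z - f z0) / (z - z0))) = 0.
Proof.
move=> ef z0r.
set F := fun z => z * (if z == z0 then f^`()%classic z0 else (f z - f z0) / (z - z0)).
have r0 : 0 < r by apply: le_lt_trans z0r; exact: N_ge0.
have -> : mean r (fun z => z * ((f z - f z0) / (z - z0))) = mean r F.
  rewrite /mean; congr avg; apply/funext => t.
  by rewrite /F (negPf (pt_neq t z0r)).
have dF z : z != z0 -> exists l, cder F z l.
  move=> zz; have nz : 0 < N (z - z0) by rewrite N_gt0 subr_eq0.
  have D : cder (fun z => z - z0) z (1 - 0) by apply: cderB (cder_cst _ _); exact: cder_id.
  have D2 := cderB (entire_cder z ef) (cder_cst (f z0) z).
  have D3 := @cder_inv _ (fun w => w - z0) z _ ltac:(by rewrite subr_eq0) D.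
  have D4 := cderM (cder_id z) (cderM D2 D3).
  eexists; apply: (cder_near nz _ D4) => w wz.
  rewrite /F ifN //; apply: contraTneq wz => ->; rewrite distNC -leNgt //.
have cF : continuous F.
  move=> z; have [->|zz] := eqVneq z z0; last first.
    by have [l Hl] := dF z zz; exact: cder_cont Hl.
  apply: cont_atM; first by apply: cder_cont; exact: cder_id.
  apply: continuous_epsdelta => e e0; rewrite eqxx.
  have [d d0 Hd] := entire_cder z0 ef e0.
  exists d => // w hw; case: (eqVneq w z0) => wz.
    by rewrite subrr Normc.normc0 ltW.
  have nw : 0 < N (w - z0) by rewrite N_gt0 subr_eq0.
  have := Hd _ hw; rewrite [z0 + _]addrC subrK.
  by move=> K; rewrite -(ler_pM2r nw) -NM mulrBl divfK ?subr_eq0.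
have lim_eq r1 : 0 <= r1 -> (forall e : R, 0 < e -> exists2 r', `|r' - r1| < e & mean r' F = 0) ->
    mean r1 F = 0.
  move=> r10 H; apply: N_small_eq0 => e e0.
  have [d d0 Hd] := mean_cont r1 cF e0.
  have [r' h1 h2] := H d d0; have := Hd r' h1.
  by rewrite h2 sub0r NN.
have F0 : F 0 = 0 by rewrite /F mul0r.
have inner r1 : 0 < r1 < N z0 -> mean r1 F = 0.
  move=> /andP[h1 h2]; apply: N_small_eq0 => e e0.
  have [d d0 Hd] := mean_cont 0 cF e0.
  set r' := Num.min (d / 2) r1.
  have r'0 : 0 < r' by rewrite lt_min h1 divr_gt0.
  rewrite -(@mean_const F 0 r' r1 (N z0)) //; last first.
  - move=> z /andP[_ hz]; apply: dF; apply: contraTneq hz => ->.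
    by rewrite -leNgt.
  - by rewrite ge_min lexx orbT.
  have := Hd r'; rewrite subr0 mean0 F0 subr0; apply.
  rewrite gtr0_norm // gt_min; apply/orP; left; lra.
have on : mean (N z0) F = 0.
  have [->|z00] := eqVneq z0 0; first by rewrite Normc.normc0 mean0 F0.
  have n0 : 0 < N z0 by rewrite N_gt0.
  apply: lim_eq; first exact: N_ge0.
  move=> e e0; exists (N z0 - Num.min (e / 2) (N z0 / 2)).
    rewrite addrAC subrr add0r normrN ger0_norm.
      by rewrite gt_min; apply/orP; left; lra.
    by rewrite le_min; apply/andP; split; lra.
  apply: inner; apply/andP; split; last first.
    rewrite ltrBlDr ltrDl lt_min; apply/andP; split; lra.
  rewrite subr_gt0 gt_min; apply/orP; right; lra.
apply: N_small_eq0 => e e0.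
have [d d0 Hd] := mean_cont (N z0) cF e0.
set r' := Num.min (N z0 + d / 2) r.
have r'0 : N z0 < r' by rewrite lt_min z0r andbT; lra.
rewrite -(@mean_const F (N z0) r' r (r + 1)) //.
- have := Hd r'; rewrite on subr0; apply.
  rewrite gtr0_norm ?subr_gt0 // ltrBlDr gt_min; apply/orP; left; lra.
- exact: N_ge0.
- by rewrite ge_min lexx orbT.
- by rewrite ltrDl.
- move=> z /andP[hz _]; apply: dF; apply: contraTneq hz => ->.
  by rewrite -leNgt.
Qed.

Lemma cder_kernel z z0 : z - z0 != 0 -> cder (fun w => w / (w - z0)) z
  (1 * (z - z0)^-1 + z * (- (z - z0)^-1 ^+ 2 * (1 - 0))).
Proof.
move=> zz; apply: (cderM (cder_id z)).
by apply: (@cder_inv _ (fun w => w - z0)) => //; apply: (cderB (cder_id z)); exact: cder_cst.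
Qed.

Lemma cont_circle_kernel z0 r : N z0 < r ->
  continuous (fun t => pt r t / (pt r t - z0)).
Proof.
move=> z0r; have r0 : 0 <= r by apply: le_trans (ltW z0r); exact: N_ge0.
apply: (@cont_circle (fun z => z / (z - z0))) => // z Hz.
have zz : z - z0 != 0 by rewrite subr_eq0; apply: contraTneq z0r => <-; rewrite Hz ltxx.
exact: cder_cont (cder_kernel zz).
Qed.

(** The mean does not depend on the radius, and the kernel tends to [1] on
    large circles. *)
Lemma mean_kernel z0 r : N z0 < r -> mean r (fun z => z / (z - z0)) = 1.
Proof.
move=> z0r; have r0 : 0 < r by apply: le_lt_trans z0r; exact: N_ge0.
apply/eqP; rewrite -subr_eq0; apply/eqP; apply: N_small_eq0 => e e0.
set r' := Num.max r (N z0 + 2 * N z0 / e).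
have rr' : r <= r' by rewrite le_max lexx.
have z0r' : N z0 < r' by exact: lt_le_trans rr'.
rewrite (@mean_const _ (N z0) r r' (r' + 1)) ?N_ge0 //; first last.
- move=> z /andP[hz _]; have zz : z - z0 != 0.
    by rewrite subr_eq0; apply: contraTneq hz => ->; rewrite -leNgt.
  by eexists; exact: (cder_kernel zz).
- by rewrite ltrDl.
rewrite -(avg_cst 1) -avgB; [|exact: cont_circle_kernel|exact: cst_continuous].
have -> : e = 2 * (e / 2) by field.
apply: avg_bound.
  apply: cont_sub; [exact: cont_circle_kernel|exact: cst_continuous].
move=> t _; have pz : pt r' t - z0 != 0 by rewrite subr_eq0 pt_neq.
have -> : pt r' t / (pt r' t - z0) - 1 = z0 / (pt r' t - z0) by field.
rewrite NM NV ler_pdivrMr ?N_gt0 //.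
have h : r' - N z0 <= N (pt r' t - z0).
  by have := N_sub_ge (pt r' t) z0; rewrite N_pt ger0_norm // ltW // (lt_le_trans r0).
have h2 : 2 * N z0 / e <= r' - N z0 by rewrite lerBrDl le_max lexx orbT.
have h3 : 2 * N z0 / e <= N (pt r' t - z0) by lra.
by move: h3; rewrite ler_pdivrMr // => h3; lra.
Qed.

(** [mean_quotient] with [f z0] split off, since the kernel has mean [1]. *)
Theorem cauchy_formula f z0 r : holo f -> N z0 < r ->
  f z0 = mean r (fun z => f z * (z / (z - z0))).
Proof.
move=> ef z0r; have := mean_quotient ef z0r.
have r0 : 0 <= r by apply: le_trans (ltW z0r); exact: N_ge0.
have cK := cont_circle_kernel z0r.
have cf : continuous (fun t => f (pt r t)).
  by apply: cont_circle => // z _; exact: entire_cont.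
rewrite /mean.
have -> : (fun t => pt r t * ((f (pt r t) - f z0) / (pt r t - z0))) =
   (fun t => f (pt r t) * (pt r t / (pt r t - z0)) - f z0 * (pt r t / (pt r t - z0))).
  by apply/funext => t; ring.
have cZ : continuous (fun t => f z0 * (pt r t / (pt r t - z0))).
  by move=> t; apply: cvgM; [exact: cvg_cst|exact: cK].
have cM : continuous (fun t => f (pt r t) * (pt r t / (pt r t - z0))).
  by move=> t; apply: cvgM; [exact: cf|exact: cK].
rewrite avgB // avgZ //.
rewrite -[avg (fun t => pt r t / _)]/(mean r (fun z => z / (z - z0))) mean_kernel // mulr1.
by move/eqP; rewrite subr_eq0 => /eqP.
Qed.

(** * Power series expansions of entire functions *)

(** The radius [1] is arbitrary: the mean of [f z / z ^ n] is the same on all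
    circles, by [mean_const]. *)

Definition coef f n : C := mean 1 (fun z => f z * z^-1 ^+ n).

Lemma cder_fXn f n z : holo f -> z != 0 -> exists l, cder (fun z => f z * z^-1 ^+ n) z l.
Proof.
move=> ef z0; eexists; apply: cderM; first exact: entire_cder.
exact: (cder_comp (cderX _ _) (cderV z0)).
Qed.

Lemma coefE f n r : holo f -> 0 < r -> coef f n = mean r (fun z => f z * z^-1 ^+ n).
Proof.
move=> ef r0.
have D z (p2 : R) : 0 < N z < p2 -> exists l, cder (fun z => f z * z^-1 ^+ n) z l.
  by move=> /andP[]; rewrite N_gt0 => z0 _; exact: cder_fXn.
have [r1|r1] := leP 1 r.
  by apply: (@mean_const _ 0 1 r (r + 1)) => //; rewrite ?ltrDl // => z; exact: D.
by symmetry; apply: (@mean_const _ 0 r 1 2) => //; rewrite ?(ltW r1) ?ltr1n // => z; exact: D.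
Qed.

Lemma cont_fXn f n r : holo f -> 0 < r ->
  continuous (fun t => f (pt r t) * (pt r t)^-1 ^+ n).
Proof.
move=> ef r0; apply: (@cont_circle (fun z => f z * z^-1 ^+ n)); last exact: ltW.
move=> z Hz; have z0 : z != 0 by rewrite -N_gt0 Hz.
by have [l Hl] := cder_fXn n ef z0; exact: cder_cont Hl.
Qed.

Lemma coef_bound f n r (M : R) : holo f -> 0 < r ->
  (forall z, N z = r -> N (f z) <= M) -> N (coef f n) * r ^+ n <= 2 * M.
Proof.
move=> ef r0 H; rewrite (coefE n ef r0) -ler_pdivlMr ?exprn_gt0 // -mulrA.
apply: avg_bound; first exact: cont_fXn.
move=> t _; rewrite NM NX NV N_pt gtr0_norm // exprVn ler_wpM2r //.
  by rewrite invr_ge0 exprn_ge0 // ltW.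
by apply: H; rewrite N_pt gtr0_norm.
Qed.

Definition ps (a : nat -> C) n z := \sum_(j < n) a j * z ^+ j.

(** Each geometric step [w / (w - z) = 1 + (z / w) (w / (w - z))] under the
    mean splits off one Taylor term.  The factor [2] comes from estimating real
    and imaginary parts separately. *)
Lemma expansion_bound f n r z (M : R) : holo f -> N z < r ->
  (forall w, N w = r -> N (f w) <= M) ->
  N (f z - ps (coef f) n z) <= 2 * M * (N z / r) ^+ n * (r / (r - N z)).
Proof.
move=> ef zr H; have r0 : 0 < r by apply: le_lt_trans zr; exact: N_ge0.
set T := fun n => mean r (fun w => (f w * w^-1 ^+ n) * (w / (w - z))).
have cT k : continuous (fun t => (f (pt r t) * (pt r t)^-1 ^+ k) * (pt r t / (pt r t - z))).
  by move=> t; apply: cvgM; [exact: cont_fXn|exact: cont_circle_kernel].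
have TS k : T k = coef f k + z * T k.+1.
  rewrite (coefE k ef r0) /T /mean -avgZ // -avgD //; last 2 first.
  - exact: cont_fXn.
  - by move=> t; apply: cvgM; [exact: cvg_cst|exact: cT].
  congr avg; apply/funext => t; set w := pt r t; rewrite exprSr.
  have w0 : w != 0 by rewrite pt_neq // Normc.normc0.
  have wz : w - z != 0 by rewrite subr_eq0 pt_neq.
  by field; rewrite w0 wz.
have -> : f z - ps (coef f) n z = z ^+ n * T n.
  elim: n => [|n IH].
    rewrite /ps big_ord0 subr0 mul1r (cauchy_formula ef zr) /T /mean; congr avg.
    by apply/funext => t; rewrite expr0 mulr1.
  by rewrite /ps big_ord_recr /= opprD addrA IH (TS n) exprSr; ring.
rewrite NM NX expr_div_n.
have -> : 2 * M * (N z ^+ n / r ^+ n) * (r / (r - N z)) =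
  N z ^+ n * (2 * (M / r ^+ n * (r / (r - N z)))) by ring.
rewrite ler_wpM2l ?exprn_ge0 ?N_ge0 //; apply: avg_bound => // t _.
have M0 : 0 <= M by apply: le_trans (H (pt r 0) _); rewrite ?N_ge0 // N_pt gtr0_norm.
rewrite !NM NX !NV N_pt gtr0_norm // exprVn.
apply: ler_pM; rewrite ?mulr_ge0 ?invr_ge0 ?exprn_ge0 ?N_ge0 ?(ltW r0) //.
  by rewrite ler_pM2r ?invr_gt0 ?exprn_gt0 // H // N_pt gtr0_norm.
rewrite -NM -[_ * cexp _]/(pt r t) N_pt (gtr0_norm r0) ler_pM2l //.
rewrite lef_pV2 ?posrE ?N_gt0 ?subr_gt0 // ?subr_eq0 ?pt_neq //.
by have := N_sub_ge (pt r t) z; rewrite N_pt gtr0_norm.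
Qed.
End CauchyFormula.

Section PowerSeries.
Variable R : realType.
Local Notation C := R[i].
Implicit Types (f g p q : C -> C) (a b : nat -> C) (r : R) (z w h : C).

Definition decay a := forall r, 0 < r -> exists M : R, forall n, N (a n) * r ^+ n <= M.

Definition is_ps a f := forall z (e : R), 0 < e ->
  exists n0, forall n, (n0 <= n)%N -> N (f z - ps a n z) <= e.

Lemma continuous_bounded f r : continuous f ->
  exists M : R, forall z, N z <= r -> N (f z) <= M.
Proof.
move=> cf.
have K : compact ((`[- r, r] : set R) `*` (`[- r, r] : set R)).
  by apply: compact_setX; exact: segment_compact.
move/compact_near_coveringP : K => K.
have {}K := K _ (@pinfty_nbhs R) (fun M (p : R * R) => N (f (p.1 +i* p.2)) <= M) _.
have /K[M [Mr HM]] : forall p : R * R, (`[- r, r] `*` `[- r, r])%classic p ->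
    \forall p' \near p & M \near +oo, N (f (p'.1 +i* p'.2)) <= M.
  move=> p _.
  have cF : {for p, continuous (fun p : R * R => f (p.1 +i* p.2))}.
    apply: continuous_comp; last exact: cf.
    have -> : (fun p : R * R => p.1 +i* p.2) = (fun p : R * R => p.1 +i* 0 + 0 +i* p.2).
      by apply/funext => x; apply/eqP; rewrite eq_complex /= addr0 add0r !eqxx.
    apply: cont_atD.
      by apply: (@continuous_comp _ _ _ (fun p : R * R => p.1) (fun s : R => s +i* 0));
        [exact: cvg_fst|exact: continuous_hseg].
    by apply: (@continuous_comp _ _ _ (fun p : R * R => p.2) (fun s : R => 0 +i* s));
      [exact: cvg_snd|exact: continuous_vseg].
  have U : \forall p' \near p, N (f (p'.1 +i* p'.2) - f (p.1 +i* p.2)) < 1.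
    by apply: (cF (fun w => N (w - f (p.1 +i* p.2)) < 1)); apply/nearC; exists 1.
  exists ([set p' | N (f (p'.1 +i* p'.2) - f (p.1 +i* p.2)) < 1],
          [set M | N (f (p.1 +i* p.2)) + 1 < M]).
    split => //=; exists (N (f (p.1 +i* p.2)) + 1); split => //; exact: num_real.
  move=> [p' M] /= [h1 h2]; rewrite -(subrK (f (p.1 +i* p.2)) (f _)).
  apply: (le_trans (ND _ _)); lra.
exists (M + 1) => z zr; have := HM (M + 1); rewrite ltrDl ltr01 => /(_ isT).
case: z zr => x y zr; move=> /(_ (x, y)); apply; split => /=.
  by rewrite in_itv /= -ler_norml (le_trans _ zr) // (Re_leN (x +i* y)).
by rewrite in_itv /= -ler_norml (le_trans _ zr) // (Im_leN (x +i* y)).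
Qed.

Lemma geometric_small (K e : R) : 0 <= K -> 0 < e ->
  exists n0, forall n, (n0 <= n)%N -> K / 2 ^+ n <= e.
Proof.
move=> K0 e0; have [n0 H] := half_pow_small K0 e0.
exists n0 => n hn; apply: (le_trans _ (ltW H)); rewrite ler_wpM2l //.
by rewrite lef_pV2 ?posrE ?exprn_gt0 // ler_weXn2l // ler1n.
Qed.

Lemma entire_decay f : holo f -> decay (coef f).
Proof.
move=> ef r r0; have [M HM] := continuous_bounded r (entire_cont ef).
by exists (2 * M) => n; apply: coef_bound => // z zr; apply: HM; rewrite zr.
Qed.

Lemma entire_is_ps f : holo f -> is_ps (coef f) f.
Proof.
move=> ef z e e0; set r := 2 * N z + 1.
have z0 := N_ge0 z; have r0 : 0 < r by rewrite /r; lra.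
have zr : N z < r by rewrite /r; lra.
have [M HM] := continuous_bounded r (entire_cont ef).
have M0 : 0 <= M by apply: le_trans (N_ge0 _) (HM z (ltW zr)).
have [n0 H] := @geometric_small (2 * M * 2) e ltac:(by lra) e0.
exists n0 => n /H; apply: le_trans.
apply: (le_trans (expansion_bound n ef zr (fun w hw => HM w ltac:(by rewrite hw)))).
rewrite mulrAC; apply: ler_pM; rewrite ?exprn_ge0 ?divr_ge0 ?(ltW r0) //.
- by rewrite mulr_ge0 ?divr_ge0 ?subr_ge0 ?(ltW r0) ?(ltW zr) //; lra.
- by rewrite ler_wpM2l ?ler_pdivrMr ?subr_gt0 //; [lra|rewrite /r; lra].
- rewrite -exprVn lerXn2r ?nnegrE ?invr_ge0 ?divr_ge0 ?(ltW r0) //.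
  by rewrite ler_pdivrMr // /r; lra.
Qed.

Lemma real_limit (u : nat -> R) (K : R) : 0 <= K ->
  (forall n, `|u n.+1 - u n| <= K / 2 ^+ n.+1) ->
  exists l, forall n, `|u n - l| <= K / 2 ^+ n.
Proof.
move=> K0 H.
have E n : K / 2 ^+ n = 2 * (K / 2 ^+ n.+1).
  by rewrite exprS; field; rewrite expf_neq0.
have K20 : 0 <= 2 * K by rewrite mulr_ge0.
have [|l Hl] := @nested_point _ (fun n => u n - K / 2 ^+ n) (2 * K) K20.
  move=> n; have := H n; rewrite ler_norml -!mulrA (E n); lra.
exists l => n; have := Hl n; rewrite ler_norml -mulrA; lra.
Qed.

Lemma psS a n z : ps a n.+1 z = ps a n z + a n * z ^+ n.
Proof. by rewrite /ps big_ord_recr. Qed.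

Lemma decay_term a z : decay a -> exists2 K : R, 0 <= K &
  forall n, N (a n * z ^+ n) <= K / 2 ^+ n.
Proof.
move=> da; have z0 := N_ge0 z.
have r0 : 0 < 2 * N z + 1 by lra.
have [M HM] := da _ r0; exists M.
  by apply: le_trans (HM 0%N); rewrite mulr1 N_ge0.
move=> n; rewrite NM NX ler_pdivlMr ?exprn_gt0 // -mulrA -exprMn.
apply: le_trans (HM n); rewrite ler_wpM2l ?N_ge0 //.
by rewrite lerXn2r ?nnegrE; lra.
Qed.

Lemma ps_exists a : decay a -> exists f, is_ps a f.
Proof.
move=> da.
have H z : exists l, forall e : R, 0 < e ->
    exists n0, forall n, (n0 <= n)%N -> N (l - ps a n z) <= e.
  have [K K0 HK] := decay_term z da.
  have K20 : 0 <= 2 * K by lra.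
  have E n : K / 2 ^+ n = 2 * K / 2 ^+ n.+1.
    by rewrite exprS; field; rewrite expf_neq0.
  have [|x Hx] := @real_limit (fun n => complex.Re (ps a n z)) (2 * K) K20.
    move=> n; rewrite -E; apply: le_trans (HK n); apply: le_trans (Re_leN _).
    by rewrite psS ReD addrAC subrr add0r.
  have [|y Hy] := @real_limit (fun n => complex.Im (ps a n z)) (2 * K) K20.
    move=> n; rewrite -E; apply: le_trans (HK n); apply: le_trans (Im_leN _).
    have ImD : forall x y : C, complex.Im (x + y) = complex.Im x + complex.Im y.
      by case=> ? ? [].
    by rewrite psS ImD addrAC subrr add0r.
  exists (x +i* y) => e e0.
  have [n0 Hn] := @geometric_small (4 * K) e ltac:(by lra) e0.
  exists n0 => n /Hn; apply: le_trans; rewrite distNC.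
  apply: (le_trans (N_leReIm _)).
  have := Hx n; have := Hy n; case: (ps a n z) => u v /=.
  by rewrite -!mulrA; lra.
have [f Hf] := choice H.
by exists f => z e e0; exact: Hf.
Qed.

Definition dcoef a n : C := n.+1%:R * a n.+1.

Lemma N_natr n : N (n%:R : C) = n%:R.
Proof.
have -> : (n%:R : C) = (n%:R : R)%:C by rewrite rmorph_nat.
by rewrite NR ger0_norm // ler0n.
Qed.

Lemma decay_dcoef a : decay a -> decay (dcoef a).
Proof.
move=> da r r0; have r20 : 0 < 2 * r by rewrite mulr_gt0.
have [M HM] := da _ r20; exists (M / (2 * r)) => n.
rewrite ler_pdivlMr //; apply: le_trans (HM n.+1).
rewrite /dcoef NM N_natr [_ * N _]mulrC -!mulrA ler_wpM2l ?N_ge0 //.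
rewrite exprSr mulrA ler_pM2r // exprMn ler_pM2r ?exprn_gt0 //.
by rewrite -natrX ler_nat ltn_expl.
Qed.

Lemma decay_shift a k : decay a -> decay (fun n => a (k + n)%N).
Proof.
move=> da r r0; have [M HM] := da _ r0; exists (M / r ^+ k) => n.
by rewrite ler_pdivlMr ?exprn_gt0 // -mulrA -exprD addnC.
Qed.

Lemma taylor2_monomial z h (rho : R) n : 1 <= rho -> N z <= rho -> N (z + h) <= rho ->
  N ((z + h) ^+ n - z ^+ n - n%:R * z ^+ n.-1 * h) <= n%:R ^+ 2 * rho ^+ n * N h ^+ 2.
Proof.
move=> r1 zr zhr; have r0 : 0 <= rho by lra.
elim: n => [|n IH].
  by rewrite !expr0 subrr mul0r mul0r subr0 Normc.normc0 expr0n /= !mul0r.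
have -> : (z + h) ^+ n.+1 - z ^+ n.+1 - n.+1%:R * z ^+ n.+1.-1 * h =
    (z + h) * ((z + h) ^+ n - z ^+ n - n%:R * z ^+ n.-1 * h) +
    n%:R * z ^+ n.-1 * h ^+ 2.
  case: n {IH} => [|n] /=; first by rewrite !expr0 !expr1; ring.
  by rewrite -!natr1 !exprS; ring.
apply: (le_trans (ND _ _)).
have h2 : 0 <= N h ^+ 2 by rewrite exprn_ge0 ?N_ge0.
apply: (@le_trans _ _ (rho * (n%:R ^+ 2 * rho ^+ n * N h ^+ 2) +
   n%:R * rho ^+ n.+1 * N h ^+ 2)).
  apply: lerD; first by rewrite NM ler_pM ?N_ge0.
  rewrite !NM !NX N_natr ler_wpM2r // ler_wpM2l //.
  apply: (@le_trans _ _ (rho ^+ n.-1)).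
    by rewrite lerXn2r ?nnegrE ?N_ge0.
  by rewrite ler_weXn2l // (leq_trans (leq_pred n)).
have -> : rho * (n%:R ^+ 2 * rho ^+ n * N h ^+ 2) + n%:R * rho ^+ n.+1 * N h ^+ 2 =
  (n%:R ^+ 2 + n%:R) * (rho ^+ n.+1 * N h ^+ 2) by rewrite (exprS rho); ring.
rewrite -[X in _ <= X]mulrA ler_wpM2r ?mulr_ge0 ?exprn_ge0 ?N_ge0 //.
have : 0 <= n%:R :> R by rewrite ler0n.
rewrite -natr1; nra.
Qed.

Lemma sum_geometric_half (M : R) n : 0 <= M -> \sum_(j < n) M / 2 ^+ j <= 2 * M.
Proof.
move=> M0; suff -> : \sum_(j < n) M / 2 ^+ j = 2 * M - 2 * M / 2 ^+ n.
  by rewrite lerBlDr lerDl divr_ge0 ?exprn_ge0 //; lra.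
elim: n => [|n IH]; first by rewrite big_ord0 expr0 divr1 subrr.
by rewrite big_ord_recr /= IH exprS; field; rewrite expf_neq0.
Qed.

(** Termwise differentiation: the second order remainder of the [n]-th
    monomial is at most [n ^ 2 * rho ^ n * N h ^ 2], which the decay of [a] at the
    radius [8 * rho] makes summable. *)
Lemma ps_cder a f g : decay a -> is_ps a f -> is_ps (dcoef a) g ->
  forall z, cder f z (g z).
Proof.
move=> da Hf Hg z; have z0 := N_ge0 z.
set rho := N z + 1; have r1 : 1 <= rho by rewrite /rho; lra.
have r80 : 0 < 8 * rho by lra.
have [M HM] := da _ r80.
have M0 : 0 <= M by apply: le_trans (HM 0%N); rewrite mulr1 N_ge0.
have main h : N h <= 1 -> N (f (z + h) - f z - g z * h) <= 2 * M * N h ^+ 2.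
  move=> h1; have h0 := N_ge0 h.
  have zh : N (z + h) <= rho by apply: (le_trans (ND _ _)); rewrite /rho; lra.
  have fin n : N (ps a n.+1 (z + h) - ps a n.+1 z - ps (dcoef a) n z * h) <=
      2 * M * N h ^+ 2.
    have -> : ps a n.+1 (z + h) - ps a n.+1 z - ps (dcoef a) n z * h =
       \sum_(j < n.+1) a j * ((z + h) ^+ j - z ^+ j - j%:R * z ^+ j.-1 * h).
      rewrite /ps [in RHS]big_ord_recl /= !expr0 subrr mul0r mul0r subr0 mulr0 add0r.
      rewrite -sumrB big_ord_recl /= !expr0 subrr add0r mulr_suml -sumrB.
      by apply: eq_bigr => j _; rewrite /dcoef /bump /= add1n /=; ring.
    apply: (le_trans (N_sum _ _ _)).
    apply: (@le_trans _ _ (\sum_(j < n.+1) M / 2 ^+ j * N h ^+ 2)); last first.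
      by rewrite -mulr_suml ler_wpM2r ?exprn_ge0 // sum_geometric_half.
    apply: ler_sum => j _; rewrite NM.
    have := @taylor2_monomial z h rho j r1 ltac:(by rewrite /rho; lra) zh => T.
    apply: (le_trans (ler_wpM2l (N_ge0 _) T)).
    rewrite [X in X <= _]mulrA ler_wpM2r ?exprn_ge0 // ler_pdivlMr ?exprn_gt0 //.
    apply: le_trans (HM j); rewrite -mulrA ler_wpM2l ?N_ge0 // -mulrA -exprMn.
    apply: (@le_trans _ _ ((2 ^+ 2 * 1) ^+ j * (rho * 2) ^+ j)).
      rewrite ler_wpM2r ?exprn_ge0 //; first lra.
      rewrite mulr1 exprAC lerXn2r ?nnegrE ?ler0n ?exprn_ge0 //.
      by rewrite -natrX ler_nat ltnW // ltn_expl.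
    by rewrite -exprMn le_eqVlt; apply/orP; left; apply/eqP; congr (_ ^+ j); ring.
  apply/ler_addgt0Pr => e e0; have e30 : 0 < e / 3 by rewrite divr_gt0.
  have [n1 H1] := Hf (z + h) _ e30; have [n2 H2] := Hf z _ e30.
  have [n3 H3] := Hg z _ e30.
  set n := (n1 + n2 + n3)%N.
  have {}H1 := H1 n.+1 ltac:(by rewrite ltnW // ltnS /n -addnA leq_addr).
  have {}H2 := H2 n.+1 ltac:(by rewrite ltnW // ltnS /n addnAC leq_addl).
  have {}H3 := H3 n ltac:(by rewrite /n leq_addl).
  have -> : f (z + h) - f z - g z * h =
    (f (z + h) - ps a n.+1 (z + h)) - (f z - ps a n.+1 z) - (g z - ps (dcoef a) n z) * h
    + (ps a n.+1 (z + h) - ps a n.+1 z - ps (dcoef a) n z * h) by ring.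
  apply: (le_trans (ND _ _)); rewrite addrC; apply: lerD; first exact: fin.
  apply: (le_trans (NB _ _)); have -> : e = e / 3 + e / 3 + e / 3 by field.
  apply: lerD; first by apply: (le_trans (NB _ _)); exact: lerD.
  by rewrite NM -[e / 3]mulr1 ler_pM ?N_ge0.
move=> e e0; exists (Num.min 1 (e / (2 * M + 1))).
  by rewrite lt_min ltr01 divr_gt0 //; lra.
move=> h; rewrite lt_min => /andP[/ltW h1 h2].
apply: (le_trans (main h h1)); rewrite expr2 mulrA ler_wpM2r ?N_ge0 //.
move: h2; rewrite ltr_pdivlMr; last by lra.
by have := N_ge0 h; nra.
Qed.

Lemma ps_entire a f : decay a -> is_ps a f -> holo f.
Proof.
move=> da Hf; have [g Hg] := ps_exists (decay_dcoef da).
by apply: cder_entire => z; exists (g z); exact: ps_cder da Hf Hg z.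
Qed.

(** This is where a single complex derivative yields all the others. *)
Theorem entire_derive f : holo f -> holo (f^`()%classic).
Proof.
move=> ef; have da := entire_decay ef.
have [g Hg] := ps_exists (decay_dcoef da).
have -> : f^`()%classic = g.
  by apply/funext => z; apply: cder_val; exact: ps_cder da (entire_is_ps ef) Hg z.
exact: ps_entire (decay_dcoef da) Hg.
Qed.

Theorem entire_primitive f : holo f -> exists2 F, holo F & forall z, cder F z (f z).
Proof.
move=> ef; have da := entire_decay ef.
pose b n := if n is m.+1 then coef f m / m.+1%:R else 0.
have db : decay b.
  move=> r r0; have [M HM] := da _ r0; exists (M * r) => -[|n].
    rewrite /= Normc.normc0 mul0r mulr_ge0 ?(ltW r0) //.
    by apply: le_trans (HM 0%N); rewrite mulr1 N_ge0.
  rewrite exprSr mulrA ler_pM2r //; apply: le_trans (HM n).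
  rewrite ler_pM2r ?exprn_gt0 // /= NM NV N_natr ler_pdivrMr ?ltr0Sn //.
  by rewrite ler_peMr ?N_ge0 // ler1n.
have E : dcoef b = coef f.
  by apply/funext => n; rewrite /dcoef /b mulrC divfK // pnatr_eq0.
have [F HF] := ps_exists db.
exists F; first exact: ps_entire db HF.
by move=> z; apply: (ps_cder db HF); rewrite E; exact: entire_is_ps.
Qed.

Lemma ps_at0 a f : is_ps a f -> f 0 = a 0%N.
Proof.
move=> Hf; apply/eqP; rewrite -subr_eq0; apply/eqP; apply: N_small_eq0 => e e0.
have [n H] := Hf 0 _ e0; have := H n.+1 (leqnSn n).
rewrite /ps big_ord_recl /= expr0 mulr1 big1 ?addr0 // => j _.
by rewrite expr0n mulr0.
Qed.

(** The shifted coefficients still decay, so the remainder is again entire.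
    For [n = 1] this divides out a zero at the origin. *)
Lemma entire_tail f n : holo f -> exists q, [/\ holo q,
  forall z, f z = ps (coef f) n z + z ^+ n * q z & q 0 = coef f n].
Proof.
move=> ef; have db := decay_shift n (entire_decay ef).
have [q Hq] := ps_exists db; exists q; split; first exact: ps_entire db Hq.
  move=> z; apply/eqP; rewrite -subr_eq0; apply/eqP; apply: N_small_eq0 => e e0.
  have e20 : 0 < e / 2 by rewrite divr_gt0.
  have zn : 0 < N z ^+ n + 1 by rewrite ltr_wpDl // exprn_ge0 ?N_ge0.
  have [n1 H1] := entire_is_ps ef z e20.
  have [n2 H2] := Hq z (e / 2 / (N z ^+ n + 1)) ltac:(by rewrite divr_gt0).
  set k := (n1 + n2)%N.
  have {}H1 := H1 (n + k)%N ltac:(by rewrite /k addnCA leq_addr).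
  have {}H2 := H2 k ltac:(by rewrite /k leq_addl).
  have E : ps (coef f) (n + k) z = ps (coef f) n z + z ^+ n * ps (fun j => coef f (n + j)%N) k z.
    rewrite /ps big_split_ord /=; congr (_ + _); rewrite mulr_sumr.
    by apply: eq_bigr => j _; rewrite exprD mulrCA.
  have -> : f z - (ps (coef f) n z + z ^+ n * q z) =
     (f z - ps (coef f) (n + k) z) - z ^+ n * (q z - ps (fun j => coef f (n + j)%N) k z).
    by rewrite E; ring.
  apply: (le_trans (NB _ _)); have -> : e = e / 2 + e / 2 by field.
  apply: lerD => //; rewrite NM NX.
  move: H2; rewrite ler_pdivlMr // mulrC; apply: le_trans.
  by rewrite ler_wpM2r ?N_ge0 // lerDl.
by rewrite (ps_at0 Hq) addn0.
Qed.
End PowerSeries.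

Section EntireFunctions.
Variable R : realType.
Local Notation C := R[i].
Implicit Types (f g p q u v B : C -> C) (r : R) (z w h : C).

(** * The ring of entire functions *)

Lemma entire_cst (a : C) : holo (fun=> a).
Proof. by apply: cder_entire => z; exists 0; exact: cder_cst. Qed.

Lemma entire_id : holo (@id C).
Proof. by apply: cder_entire => z; exists 1; exact: cder_id. Qed.

Lemma entireD f g : holo f -> holo g -> holo (fun z => f z + g z).
Proof.
move=> ef eg; apply: cder_entire => z; eexists.
exact: cderD (entire_cder z ef) (entire_cder z eg).
Qed.

Lemma entireM f g : holo f -> holo g -> holo (fun z => f z * g z).
Proof.
move=> ef eg; apply: cder_entire => z; eexists.
exact: cderM (entire_cder z ef) (entire_cder z eg).
Qed.

Lemma entireZ (a : C) f : holo f -> holo (fun z => a * f z).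
Proof. by move=> ef; apply: entireM => //; exact: entire_cst. Qed.

Lemma entireN f : holo f -> holo (fun z => - f z).
Proof.
move=> ef; apply: cder_entire => z; eexists.
exact: cderN (entire_cder z ef).
Qed.

Lemma entireB f g : holo f -> holo g -> holo (fun z => f z - g z).
Proof. by move=> ef eg; apply: entireD => //; exact: entireN. Qed.

Lemma entire_comp f g : holo f -> holo g -> holo (fun z => f (g z)).
Proof.
move=> ef eg; apply: cder_entire => z; eexists.
exact: cder_comp (entire_cder (g z) ef) (entire_cder z eg).
Qed.

Lemma entireX f n : holo f -> holo (fun z => f z ^+ n).
Proof.
move=> ef; elim: n => [|n IH].
  by under [X in holo X]funext do rewrite expr0; exact: entire_cst.
by under [X in holo X]funext do rewrite exprS; exact: entireM.
Qed.

Lemma entire_sum (I : Type) (s : seq I) (F : I -> C -> C) :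
  (forall i, holo (F i)) -> holo (fun z => \sum_(i <- s) F i z).
Proof.
move=> H; elim: s => [|i s IH].
  by under [X in holo X]funext do rewrite big_nil; exact: entire_cst.
by under [X in holo X]funext do rewrite big_cons; exact: entireD.
Qed.

Lemma entire_translate f (a : C) : holo f -> holo (fun z => f (z + a)).
Proof.
by move=> ef; apply: entire_comp => //; apply: entireD; [exact: entire_id|exact: entire_cst].
Qed.

Lemma entire_cexp f : holo f -> holo (fun z => cexp (f z)).
Proof.
have ec : holo (@cexp R) by apply: cder_entire => z; exists (cexp z); exact: cder_cexp.
by move=> ef; exact: (entire_comp ec ef).
Qed.

Lemma cder_translate f (a : C) z l : cder f (z + a) l -> cder (fun w => f (w + a)) z l.
Proof.
move=> H; have T : cder (fun w => w + a) z (1 + 0).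
  by apply: cderD; [exact: cder_id|exact: cder_cst].
by have := @cder_comp _ f (fun w => w + a) z _ _ H T; rewrite addr0 mulr1.
Qed.

(** The Taylor coefficients cannot all vanish; the first nonzero one gives the
    order and the value of the cofactor at the origin. *)
Lemma order_at0 f : holo f -> (exists z, f z != 0) ->
  exists n g, [/\ holo g, g 0 != 0 & forall z, f z = z ^+ n * g z].
Proof.
move=> ef [z0 fz0].
have [n Hn] : exists n, coef f n != 0.
  apply: contrapT => /forallNP K; move/eqP : fz0; apply; apply: N_small_eq0 => e e0.
  have [n H] := entire_is_ps ef z0 e0; have := H n (leqnn n).
  rewrite /ps big1 ?subr0 // => j _.
  by have /negP/negPn/eqP -> := K j; rewrite mul0r.
have [n0 Hn0 Hmin] := @ex_minnP (fun n => coef f n != 0) (ex_intro _ n Hn).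
have [q [eq Hq q0]] := entire_tail n0 ef.
exists n0, q; split => //; first by rewrite q0.
move=> z; rewrite Hq /ps big1 ?add0r // => j _.
have [->|/Hmin] := eqVneq (coef f j) 0; first by rewrite mul0r.
by rewrite leqNgt ltn_ord.
Qed.

Lemma continuous_neq0_near f z : continuous f -> f z != 0 ->
  exists2 d : R, 0 < d & forall w, N (w - z) < d -> f w != 0.
Proof.
move=> cf fz; have n0 : 0 < N (f z) by rewrite N_gt0.
have : \forall w \near z, N (f w - f z) < N (f z).
  by apply: (cf z (fun w => N (w - f z) < N (f z))); apply/nearC; exists (N (f z)).
move=> /nearC[d d0 Hd]; exists d => // w /Hd; apply: contraTneq => ->.
by rewrite sub0r NN ltxx.
Qed.

Lemma punct_point z (d : R) : 0 < d -> exists2 w, w != z & N (w - z) < d.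
Proof.
move=> d0; exists (z + (d / 2)%:C).
  rewrite -subr_eq0 addrAC subrr add0r -N_gt0 NR normr_gt0; lra.
by rewrite addrAC subrr add0r NR gtr0_norm; lra.
Qed.

(** Near a zero of finite order there are points where [f] does not vanish. *)
Lemma entire_near_eq0 f z0 (d : R) : holo f -> 0 < d ->
  (forall w, w != z0 -> N (w - z0) < d -> f w = 0) -> forall z, f z = 0.
Proof.
move=> ef d0 H z; apply: contrapT => /eqP fz.
have eg := entire_translate z0 ef.
have [n [g [eg' g0 Hg]]] : exists n g, [/\ holo g, g 0 != 0 &
    forall z, f (z + z0) = z ^+ n * g z].
  by apply: (order_at0 eg); exists (z - z0); rewrite subrK.
have [d1 d10 H1] := continuous_neq0_near (entire_cont eg') g0.
have [w w0 wd] := @punct_point 0 (Num.min d d1) ltac:(by rewrite lt_min d0).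
move: wd; rewrite lt_min => /andP[wd /H1]; apply/negP; rewrite negbK.
have : f (w + z0) = 0.
  have w1 : w + z0 != z0 by rewrite -subr_eq0 addrK.
  have w2 : N (w + z0 - z0) < d by rewrite addrK -[w]subr0.
  exact: H w1 w2.
by rewrite Hg => /eqP; rewrite mulf_eq0 expf_eq0 (negPf w0) andbF.
Qed.

Lemma entire_mul_eq0 f g : holo f -> holo g -> (forall z, f z * g z = 0) ->
  (exists z, f z != 0) -> forall z, g z = 0.
Proof.
move=> ef eg H [z0 fz0].
have [d d0 Hd] := continuous_neq0_near (entire_cont ef) fz0.
apply: (entire_near_eq0 (z0 := z0) eg d0) => w _ /Hd fw.
by have /eqP := H w; rewrite mulf_eq0 (negPf fw) => /eqP.
Qed.

Lemma not_zero_ex f : ~ (forall z, f z = 0) -> exists z, f z != 0.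
Proof. by move=> /existsNP[z /eqP H]; exists z. Qed.

Lemma entire_mul_neq0 f g : holo f -> holo g ->
  (exists z, f z != 0) -> (exists z, g z != 0) -> exists z, f z * g z != 0.
Proof.
move=> ef eg f0 [z gz]; apply: not_zero_ex => H.
by move: gz; rewrite (entire_mul_eq0 ef eg H f0) eqxx.
Qed.

Lemma entire_mul_cancel f g p : holo f -> holo g -> holo p ->
  (exists z, f z != 0) -> (forall z, f z * g z = f z * p z) -> g =1 p.
Proof.
move=> ef eg ep f0 H z; apply/eqP; rewrite -subr_eq0; apply/eqP; move: z.
apply: (entire_mul_eq0 (f := f)) => //; first exact: entireB.
by move=> z; rewrite mulrBr H subrr.
Qed.

Lemma entire_Xn_neq0 n : exists z : C, z ^+ n != 0.
Proof. by exists 1; rewrite expr1n oner_eq0. Qed.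

Lemma derive1_Xn_mul n g z : holo g ->
  cder (fun w => w ^+ n * g w) z (n%:R * z ^+ n.-1 * g z + z ^+ n * g^`()%classic z).
Proof. by move=> eg; exact: cderM (cderX n z) (entire_cder z eg). Qed.

(** The combination [u - a v] vanishing at one point has vanishing Wronskian
    with [v] as well; a finite order of vanishing at that point is impossible,
    since differentiation lowers it by exactly one. *)
Lemma wronskian_eq0 u v : holo u -> holo v -> (exists z, v z != 0) ->
  (forall z, u^`()%classic z * v z = u z * v^`()%classic z) ->
  exists a : C, forall z, u z = a * v z.
Proof.
move=> eu ev [z0 vz0] W; exists (u z0 / v z0).
set a := u z0 / v z0.
pose g z := u (z + z0) - a * v (z + z0); pose v1 z := v (z + z0).
have eg : holo g.
  by apply: entireB; [|apply: entireZ]; exact: entire_translate.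
have ev1 : holo v1 by exact: entire_translate.
have v10 : v1 0 != 0 by rewrite /v1 add0r.
suff g0 : forall z, g z = 0.
  by move=> z; have := g0 (z - z0); rewrite /g subrK => /eqP; rewrite subr_eq0 => /eqP.
apply: contrapT => /not_zero_ex /(order_at0 eg)[n [k [ek k0 Hk]]].
have dg z : cder g z (u^`()%classic (z + z0) - a * v^`()%classic (z + z0)).
  by apply: cderB; [|apply: cderZ]; apply: cder_translate; exact: entire_cder.
have E : g = (fun z => z ^+ n * k z) by apply/funext.
have dk z := derive1_Xn_mul n z ek.
have W1 z : (n%:R * z ^+ n.-1 * k z + z ^+ n * k^`()%classic z) * v1 z =
    z ^+ n * k z * v^`()%classic (z + z0).
  have := dk z; rewrite -E => /(cder_unique (dg z)) <-.
  by rewrite -Hk /g /v1 !mulrBl W; ring.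
case: n Hk E dk W1 => [|n] Hk E dk W1.
  have := Hk 0; rewrite /g add0r expr0 mul1r /a divfK // subrr => /esym/eqP.
  by rewrite (negPf k0).
have ed := entire_derive ek.
have ev' := entire_translate z0 (entire_derive ev).
have : (fun z => (n.+1%:R * k z + z * k^`()%classic z) * v1 z) =1
    (fun z => z * k z * v^`()%classic (z + z0)).
  apply: (entire_mul_cancel (f := fun z => z ^+ n)).
  - by apply: entireX; exact: entire_id.
  - apply: entireM => //; apply: entireD; first exact: entireZ.
    by apply: entireM => //; exact: entire_id.
  - by apply: entireM => //; apply: entireM => //; exact: entire_id.
  - exact: entire_Xn_neq0.
  - move=> z; have := W1 z; rewrite /= exprS => W2.
    by transitivity ((n.+1%:R * z ^+ n * k z + z * z ^+ n * k^`()%classic z) * v1 z);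
      [ring|rewrite W2; ring].
move=> /(_ 0); rewrite !mul0r addr0 => /eqP; rewrite !mulf_eq0 pnatr_eq0 /=.
by rewrite (negPf k0) (negPf v10).
Qed.

Lemma derive_eq0_cst f : holo f -> (forall z, cder f z 0) -> forall z, f z = f 0.
Proof.
move=> ef df z.
have [||a Ha] := wronskian_eq0 ef (entire_cst 1).
- by exists 0; rewrite oner_eq0.
- by move=> w; rewrite (cder_val (df w)) (cder_val (cder_cst 1 w)) mul0r mulr0.
- by rewrite !Ha.
Qed.

(** The derivative at [z] is the first Taylor coefficient of the translate of
    [f] to [z], which is bounded on the circle of radius [d]. *)
Lemma cauchy_estimate f r (d M : R) : holo f -> 0 < d ->
  (forall z, N z <= r + d -> N (f z) <= M) ->
  forall z, N z <= r -> N (f^`()%classic z) <= 2 * M / d.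
Proof.
move=> ef d0 H z zr; rewrite ler_pdivlMr //.
have eg := entire_translate z ef.
have -> : f^`()%classic z = coef (fun w => f (w + z)) 1.
  have [q [eq Hq q0]] := entire_tail 2 eg.
  have F0 : cder (fun w => f (w + z)) 0 (f^`()%classic z).
    by apply: cder_translate; rewrite add0r; exact: entire_cder.
  set a := coef (fun w => f (w + z)) in Hq *.
  have E : (fun w => f (w + z)) = (fun w => a 0%N + a 1%N * w + w ^+ 2 * q w).
    by apply/funext => w; rewrite Hq /ps !big_ord_recr /= big_ord0 add0r expr0 mulr1 expr1.
  have D := cderD (cderD (cder_cst (a 0%N) 0) (cderZ (a 1%N) (cder_id 0)))
    (derive1_Xn_mul 2 0 eq).
  apply: (cder_unique F0); rewrite E; apply: (cder_eq D).
  by rewrite expr1 expr2 !mulr0 !mul0r !addr0 add0r mulr1.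
have := @coef_bound _ _ 1 d M eg d0; rewrite expr1; apply => w wd.
by apply: H; apply: (le_trans (ND _ _)); rewrite wd addrC lerD2r.
Qed.

Lemma psE (a : nat -> C) n z : ps a n z = (\poly_(j < n) a j).[z].
Proof. by rewrite horner_poly. Qed.

Lemma coef_eq0_poly f n : holo f -> (forall j, (n <= j)%N -> coef f j = 0) ->
  forall z, f z = ps (coef f) n z.
Proof.
move=> ef H z; apply/eqP; rewrite -subr_eq0; apply/eqP; apply: N_small_eq0 => e e0.
have [n1 H1] := entire_is_ps ef z e0.
have := H1 (n + n1)%N (leq_addl _ _); rewrite /ps big_split_ord /=.
rewrite [X in _ - (_ + X)]big1 ?addr0 // => j _.
by rewrite H ?mul0r // leq_addr.
Qed.

(** Cauchy's bound on the [j]-th coefficient decays like [r ^ (d - j)]; letting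
    [r] run through an unbounded set of radii is enough. *)
Lemma growth_coef_eq0 f (K : R) (d : nat) : holo f -> 0 <= K ->
  (forall A : R, exists r, [/\ A <= r, 0 < r &
    forall z, N z = r -> N (f z) <= K * r ^+ d]) ->
  forall j, (d < j)%N -> coef f j = 0.
Proof.
move=> ef K0 H j dj; apply: N_small_eq0 => e e0.
have [r [Ar r0 Hr]] := H (2 * K / e + 1).
have r1 : 1 <= r by apply: le_trans Ar; rewrite lerDr divr_ge0 ?(ltW e0) //; lra.
have := coef_bound j ef r0 Hr.
rewrite -ler_pdivlMr ?exprn_gt0 // => /le_trans; apply.
rewrite ler_pdivrMr ?exprn_gt0 // mulrA.
apply: (@le_trans _ _ (e * r * r ^+ d)).
  rewrite ler_wpM2r ?exprn_ge0 ?(ltW r0) //.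
  by rewrite [e * r]mulrC -ler_pdivrMr //; lra.
by rewrite -mulrA -exprS ler_wpM2l ?(ltW e0) // ler_weXn2l.
Qed.

(** * Exponentials that are quotients of entire functions *)

Local Notation conj := (@conjc R).

Lemma ReM_conj z w : complex.Re (z * w) + complex.Re (conj z * w) =
  2 * complex.Re z * complex.Re w.
Proof. by case: z => a b; case: w => c d /=; ring. Qed.

Lemma conjM z w : conj (z * w) = conj z * conj w.
Proof.
by case: z => a b; case: w => c d; apply/eqP; rewrite eq_complex /=;
  apply/andP; split; apply/eqP; ring.
Qed.

Lemma conjD z w : conj (z + w) = conj z + conj w.
Proof.
by case: z => a b; case: w => c d; apply/eqP; rewrite eq_complex /=;
  apply/andP; split; apply/eqP; ring.
Qed.

Lemma conjX z n : conj (z ^+ n) = conj z ^+ n.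
Proof.
elim: n => [|n IH]; last by rewrite !exprS conjM IH.
by rewrite !expr0; apply/eqP; rewrite eq_complex /= oppr0 !eqxx.
Qed.

Lemma conj_sum n (F : 'I_n -> C) : conj (\sum_(i < n) F i) = \sum_(i < n) conj (F i).
Proof.
elim: n F => [|n IH] F; last by rewrite !big_ord_recr /= conjD IH.
by rewrite !big_ord0; apply/eqP; rewrite eq_complex /= oppr0 !eqxx.
Qed.

Lemma conjR (x : R) : conj x%:C = x%:C.
Proof. by apply/eqP; rewrite eq_complex /= oppr0 !eqxx. Qed.

Lemma mul_conj z : z * conj z = (N z ^+ 2)%:C.
Proof.
case: z => a b; apply/eqP; rewrite eq_complex /=.
rewrite /N sqr_sqrtr ?addr_ge0 ?sqr_ge0 //; apply/andP; split; apply/eqP; ring.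
Qed.

Lemma conj_involutive z : conj (conj z) = z.
Proof. by case: z => a b; apply/eqP; rewrite eq_complex /= opprK !eqxx. Qed.

Lemma Re_conj z : complex.Re (conj z) = complex.Re z. Proof. by case: z. Qed.

Lemma center_bound f r (M : R) : holo f -> 0 < r ->
  (forall z, N z = r -> N (f z) <= M) -> N (f 0) <= 2 * M.
Proof.
move=> ef r0 H; have := coef_bound 0 ef r0 H.
by rewrite mulr1 -(ps_at0 (entire_is_ps ef)).
Qed.

(** For a direction [u] the function [q] below has, on the circle of radius
    [r], real part [(1 + Re zeta) / 2 * Re p] with [zeta] unimodular; the
    principal part of [p / zeta] is reflected in the circle. *)
Lemma reflected_multiplier p r n (u : C) : holo p -> 0 < r -> (0 < n)%N -> N u = 1 ->
  exists q, [/\ holo q,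
    q 0 = 2^-1 * p 0 + 4^-1 * (u * (r ^+ n)%:C * coef p n) &
    forall z, N z = r -> exists2 t : R, 0 <= t <= 1 &
      complex.Re (q z) = t * complex.Re (p z)].
Proof.
move=> ep r0 n0 u1.
have [pn [epn Hpn pn0]] := entire_tail n ep.
set rn := (r ^+ n)%:C; set rni := (r ^- n)%:C; set r2i := (r ^- 2)%:C.
have rn_i : rn * rni = 1.
  by rewrite -rmorphM /= divff // expf_neq0 // gt_eqF.
pose zeta z := conj u * rni * z ^+ n.
pose T z := \sum_(j < n) (conj u * rn * conj (coef p j)) * (r2i * z) ^+ (n - j).
pose q z := 2^-1 * p z + 4^-1 * (zeta z * p z + u * rn * pn z + T z).
have eT : holo T.
  apply: entire_sum => j; apply: entireZ; apply: entireX; apply: entireZ; exact: entire_id.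
have ez : holo zeta by apply: entireZ; apply: entireX; exact: entire_id.
exists q; split.
- apply: entireD; first exact: entireZ.
  apply: entireZ; apply: entireD => //; apply: entireD; first exact: entireM.
  exact: entireZ.
- rewrite /q /zeta expr0n eqn0Ngt n0 mulr0 mul0r add0r pn0.
  rewrite /T big1 ?addr0 // => j _.
  by rewrite mulr0 expr0n subn_eq0 leqNgt ltn_ord mulr0.
move=> z zr.
have z0 : z != 0 by rewrite -N_gt0 zr.
have cz0 : conj z != 0.
  by apply: contraNneq z0 => h; rewrite -[z]conj_involutive h -(rmorph0 (real_complex R)) conjR.
have zc : r2i * z = (conj z)^-1.
  apply: (mulIf cz0); rewrite -mulrA mul_conj zr mulVf // -rmorphM /= mulVf //.
  by rewrite expf_neq0 // gt_eqF.
have uu : u * conj u = 1 by rewrite mul_conj u1 expr1n.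
have zz : zeta z * conj (zeta z) = 1.
  rewrite mul_conj /zeta !NM !NX zr NR ger0_norm ?invr_ge0 ?exprn_ge0 ?(ltW r0) //.
  have -> : N (conj u) = 1.
    apply/eqP; rewrite -(@pexpr_eq1 _ _ 2) // ?N_ge0 //.
    have : (N (conj u) ^+ 2)%:C = (N u ^+ 2)%:C by rewrite -!mul_conj conj_involutive mulrC.
    by move=> [->]; rewrite u1 expr1n.
  by rewrite mul1r mulVf ?expf_neq0 ?gt_eqF // expr1n.
have invXB k : (k <= n)%N -> (conj z)^-1 ^+ (n - k) = (conj z)^-1 ^+ n * conj z ^+ k.
  by move=> kn; rewrite -[in RHS](subnK kn) exprD -mulrA -exprMn mulVf // expr1n mulr1.
pose X := u * rn * ((z ^+ n)^-1 * ps (coef p) n z).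
have TX : T z = conj X.
  rewrite /X conjM conjM conjR -/rn conjM /ps conj_sum.
  have -> : conj (z ^+ n)^-1 = (conj z)^-1 ^+ n.
    rewrite exprVn -conjX; apply: (mulIf (x := conj (z ^+ n))).
      by rewrite conjX expf_neq0.
    rewrite -conjM !mulVf ?expf_neq0 ?conjX ?expf_neq0 //.
    by rewrite -(rmorph1 (real_complex R)) conjR.
  rewrite !mulr_sumr; apply: eq_bigr => j _; rewrite zc conjM conjX -!mulrA.
  congr (_ * (_ * _)); rewrite mulrCA; congr (_ * _).
  exact: invXB (ltnW (ltn_ord j)).
have E : q z = 2^-1 * p z + 4^-1 * (zeta z * p z + conj (zeta z) * p z) +
   4^-1 * (conj X - X).
  rewrite /q TX.
  have -> : conj (zeta z) = u * rn * (z ^+ n)^-1.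
    have zn0 : zeta z != 0.
      by apply/eqP => h; move: zz; rewrite h mul0r => /esym/eqP; rewrite oner_eq0.
    apply: (mulfI zn0); rewrite zz /zeta.
    have -> : conj u * rni * z ^+ n * (u * rn * (z ^+ n)^-1) =
      (u * conj u) * (rn * rni) * (z ^+ n * (z ^+ n)^-1) by ring.
    by rewrite uu rn_i mulfV ?expf_neq0 // !mulr1.
  have -> : u * rn * pn z = u * rn * (z ^+ n)^-1 * p z - X.
    rewrite (Hpn z) /X mulrDr.
    have -> : u * rn * (z ^+ n)^-1 * (z ^+ n * pn z) =
      u * rn * (z ^+ n * (z ^+ n)^-1) * pn z by ring.
    by rewrite mulfV ?expf_neq0 // mulr1; ring.
  ring.
have t1 : `|complex.Re (zeta z)| <= 1.
  apply: (le_trans (Re_leN _)).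
  move: zz; rewrite mul_conj => -[/eqP]; rewrite pexpr_eq1 ?N_ge0 // => /eqP ->.
  by [].
exists (2^-1 * (1 + complex.Re (zeta z))).
  by move: t1; rewrite ler_norml; lra.
have ReZ (x : R) w : complex.Re (x%:C * w) = x * complex.Re w.
  by case: w => a b /=; ring.
have h2 : (2^-1 : C) = (2^-1 : R)%:C by rewrite fmorphV rmorph_nat.
have h4 : (4^-1 : C) = (4^-1 : R)%:C by rewrite fmorphV rmorph_nat.
rewrite E h2 h4 !ReD !ReZ !ReD ReM_conj.
have -> : complex.Re (- X) = - complex.Re X by case: (X).
by rewrite Re_conj; field.
Qed.

(** On the circle [Re q] lies between [0] and [Re p] for the multipliers [q]
    above, so [B * exp q] is bounded by [M] there.  Its value at the centre
    bounds [Re (q 0)], which contains the [n]-th coefficient of [p]; the zeros of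
    [B] never have to be located. *)
Theorem quotient_coef_bound B p r (M : R) n : holo B -> holo p -> 0 < r ->
  (0 < n)%N -> B 0 != 0 ->
  (forall z, N z = r -> N (B z) <= M) ->
  (forall z, N z = r -> N (B z * cexp (p z)) <= M) ->
  N (coef p n) * r ^+ n <= 4 * ln (2 * M / N (B 0)) + 2 * N (p 0).
Proof.
move=> eB ep r0 n0 B0 H1 H2.
have [u u1 Hu] : exists2 u, N u = 1 & u * coef p n = (N (coef p n))%:C.
  have [->|a0] := eqVneq (coef p n) 0.
    by exists 1; rewrite ?Normc.normc1 // mulr0 Normc.normc0.
  have na : (N (coef p n))%:C != 0 by rewrite -N_gt0 NR normr_gt0 gt_eqF // N_gt0.
  exists ((N (coef p n))%:C / coef p n); last by rewrite divfK.
  by rewrite NM NV NR ger0_norm ?N_ge0 // divff // gt_eqF // N_gt0.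
have [q [eq q0 Hq]] := reflected_multiplier ep r0 n0 u1.
have Bq z : N z = r -> N (B z * cexp (q z)) <= M.
  move=> zr; have [t /andP[t0 t1] Ht] := Hq z zr.
  have := H1 z zr; have := H2 z zr; rewrite !NM !N_cexp Ht => h2 h1.
  have [pz|pz] := leP (complex.Re (p z)) 0.
    apply: (le_trans _ h1); apply: ler_piMr; rewrite ?N_ge0 ?expR_le1 //.
    by rewrite mulr_ge0_le0.
  apply: (le_trans _ h2); rewrite ler_wpM2l ?N_ge0 // ler_expR.
  by apply: ler_piMl => //; exact: ltW.
have b0 : 0 < N (B 0) by rewrite N_gt0.
have := center_bound (entireM eB (entire_cexp eq)) r0 Bq.
rewrite NM N_cexp -ler_pdivlMl // mulrC => C1.
have L : complex.Re (q 0) <= ln (2 * M / N (B 0)).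
  rewrite -ler_expR lnK ?posrE // (lt_le_trans _ C1) ?expR_gt0 //.
have ReZ (x : R) w : complex.Re (x%:C * w) = x * complex.Re w.
  by case: w => a b /=; ring.
have h2 : (2^-1 : C) = (2^-1 : R)%:C by rewrite fmorphV rmorph_nat.
have h4 : (4^-1 : C) = (4^-1 : R)%:C by rewrite fmorphV rmorph_nat.
have := Re_leN (p 0); rewrite ler_norml => /andP[h5 _].
have E : u * (r ^+ n)%:C * coef p n = (N (coef p n) * r ^+ n)%:C.
  by rewrite mulrAC Hu -rmorphM.
have ReC (x : R) : complex.Re x%:C = x by [].
move: L; rewrite q0 E ReD h2 h4 !ReZ ReC; lra.
Qed.
End EntireFunctions.

Section SmallFunctions.
Variable R : realType.
Local Notation C := R[i].
Variables P Q : C -> C.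
Hypotheses (eP : holo P) (eQ : holo Q).
Implicit Types (s t : C -> C) (r : R) (z : C).

(** * Functions of moderate growth relative to two entire functions *)

Definition bounded2 r (T : R) := forall z, N z <= r -> N (P z) <= T /\ N (Q z) <= T.

(** The entire functions controlled polynomially by [P] and [Q] on slightly
    larger discs.  The margin [d] is there to be spent on Cauchy's estimate, so
    that this is a differential ring; it plays the part of the small functions
    of value distribution theory, without an exceptional set of radii. *)
Variant small s : Prop := Small of holo s & (exists (K : R) (k : nat), 1 <= K /\
  forall r (d T : R), 0 < d <= 1 -> 1 <= T -> bounded2 (r + d) T ->
    forall z, N z <= r -> N (s z) <= K * (T / d) ^+ k).

Lemma small_holo s : small s -> holo s. Proof. by case. Qed.

Lemma ratio_ge1 (d T : R) : 0 < d <= 1 -> 1 <= T -> 1 <= T / d.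
Proof. by move=> /andP[d0 d1] T1; rewrite ler_pdivlMr // mul1r (le_trans d1). Qed.

Lemma small_of_bound s : holo s -> (exists (K : R) (k : nat),
  forall r (d T : R), 0 < d <= 1 -> 1 <= T -> bounded2 (r + d) T ->
    forall z, N z <= r -> N (s z) <= K * (T / d) ^+ k) -> small s.
Proof.
move=> es [K [k H]]; split => //; exists (Num.max 1 K), k; split.
  by rewrite le_max lexx.
move=> r d T d01 T1 B z zr; apply: (le_trans (H r d T d01 T1 B z zr)).
rewrite ler_wpM2r ?le_max ?lexx ?orbT // exprn_ge0 //.
by apply: (le_trans ler01); exact: ratio_ge1.
Qed.

Lemma small_cst (a : C) : small (fun=> a).
Proof.
apply: small_of_bound; first exact: entire_cst.
by exists (N a), 0%N => r d T _ _ _ z _; rewrite expr0 mulr1.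
Qed.

Lemma bounded2_mono r r' T T' : r' <= r -> T <= T' -> bounded2 r T -> bounded2 r' T'.
Proof.
move=> rr TT B z zr; have [h1 h2] := B z (le_trans zr rr).
by split; apply: le_trans TT.
Qed.

Lemma small_P : small P.
Proof.
apply: small_of_bound => //; exists 1, 1%N => r d T /andP[d0 d1] T1 B z zr.
have [|H _] := B z; first by rewrite (le_trans zr) // lerDl ltW.
apply: (le_trans H); rewrite mul1r expr1 ler_pdivlMr //.
by apply: ler_piMr => //; exact: le_trans T1.
Qed.

Lemma small_Q : small Q.
Proof.
apply: small_of_bound => //; exists 1, 1%N => r d T /andP[d0 d1] T1 B z zr.
have [|_ H] := B z; first by rewrite (le_trans zr) // lerDl ltW.
apply: (le_trans H); rewrite mul1r expr1 ler_pdivlMr //.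
by apply: ler_piMr => //; exact: le_trans T1.
Qed.

Lemma small_add s t : small s -> small t -> small (fun z => s z + t z).
Proof.
move=> [es [K [k [K1 HK]]]] [et [L [l [L1 HL]]]].
apply: small_of_bound; first exact: entireD.
exists (K + L), (k + l)%N => r d T d01 T1 B z zr.
have h := ratio_ge1 d01 T1; apply: (le_trans (ND _ _)); rewrite mulrDl.
apply: lerD.
  apply: (le_trans (HK r d T d01 T1 B z zr)); rewrite ler_wpM2l ?(le_trans ler01) //.
  by rewrite ler_weXn2l // leq_addr.
apply: (le_trans (HL r d T d01 T1 B z zr)); rewrite ler_wpM2l ?(le_trans ler01) //.
by rewrite ler_weXn2l // leq_addl.
Qed.

Lemma small_mul s t : small s -> small t -> small (fun z => s z * t z).
Proof.
move=> [es [K [k [K1 HK]]]] [et [L [l [L1 HL]]]].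
apply: small_of_bound; first exact: entireM.
exists (K * L), (k + l)%N => r d T d01 T1 B z zr.
rewrite NM exprD mulrACA; apply: ler_pM; rewrite ?N_ge0 //.
  exact: HK d01 T1 B z zr.
exact: HL d01 T1 B z zr.
Qed.

Lemma small_opp s : small s -> small (fun z => - s z).
Proof.
move=> [es [K [k [K1 HK]]]]; apply: small_of_bound; first exact: entireN.
by exists K, k => r d T d01 T1 B z zr; rewrite NN; exact: HK d01 T1 B z zr.
Qed.

Lemma small_sub s t : small s -> small t -> small (fun z => s z - t z).
Proof. by move=> hs ht; apply: small_add => //; exact: small_opp. Qed.

Lemma small_derive s : small s -> small (s^`()%classic).
Proof.
move=> [es [K [k [K1 HK]]]]; apply: small_of_bound; first exact: entire_derive.
exists (4 * K * 2 ^+ k), k.+1 => r d T d01 T1 B z zr.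
have /andP[d0 d1] := d01.
have d20 : 0 < d / 2 by rewrite divr_gt0.
have d201 : 0 < d / 2 <= 1 by rewrite d20 /=; lra.
have T0 : 0 <= T by lra.
have K0 : 0 <= K by lra.
have td : 1 <= T / d by exact: ratio_ge1.
have H : forall w, N w <= r + d / 2 -> N (s w) <= K * (T / (d / 2)) ^+ k.
  by apply: HK => //; apply: bounded2_mono B => //; lra.
apply: (le_trans (cauchy_estimate es d20 H zr)).
have -> : 2 * (K * (T / (d / 2)) ^+ k) / (d / 2) = 4 * K * 2 ^+ k * ((T / d) ^+ k * d^-1).
  have -> : T / (d / 2) = 2 * (T / d) by field; rewrite gt_eqF.
  by rewrite exprMn; field; rewrite gt_eqF.
rewrite ler_wpM2l ?mulr_ge0 ?exprn_ge0 // exprSr ler_wpM2l ?exprn_ge0 //.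
  by apply: le_trans td.
by rewrite ler_peMl // invr_ge0 ltW.
Qed.

Definition expo (v : int * int) z : C := cexp (v.1%:~R * P z + v.2%:~R * Q z).

(** Two exponentials are comparable when the difference of their exponents has
    this property; the exponents having it form a group. *)
Definition rational_exponent (v : int * int) := exists s t, [/\ small s, small t,
  exists z, s z != 0, exists z, t z != 0 & forall z, s z * expo v z = t z].

Lemma expoD (v w : int * int) z :
  expo (v.1 + w.1, v.2 + w.2) z = expo v z * expo w z.
Proof. by rewrite /expo /= -cexpD !rmorphD /=; congr cexp; ring. Qed.

Lemma expo0 z : expo (0, 0) z = 1.
Proof. by rewrite /expo /= !mul0r addr0 cexp0. Qed.

Lemma expo_neq0 v z : expo v z != 0. Proof. exact: cexp_neq0. Qed.

Lemma holo_expo v : holo (expo v).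
Proof. by apply: entire_cexp; apply: entireD; apply: entireZ. Qed.

Lemma one_neq0_fun : exists z : C, (fun=> 1 : C) z != 0.
Proof. by exists 0; rewrite oner_eq0. Qed.

Lemma rational_exponent0 : rational_exponent (0, 0).
Proof.
exists (fun=> 1), (fun=> 1); split; try exact: small_cst; try exact: one_neq0_fun.
by move=> z; rewrite expo0 mulr1.
Qed.

Lemma rational_exponentD v w : rational_exponent v -> rational_exponent w ->
  rational_exponent (v.1 + w.1, v.2 + w.2).
Proof.
move=> [s [t [hs ht s0 t0 H]]] [s' [t' [hs' ht' s'0 t'0 H']]].
exists (fun z => s z * s' z), (fun z => t z * t' z); split.
- exact: small_mul.
- exact: small_mul.
- exact: (entire_mul_neq0 (small_holo hs) (small_holo hs')).
- exact: (entire_mul_neq0 (small_holo ht) (small_holo ht')).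
- by move=> z; rewrite expoD mulrACA H H'.
Qed.

Lemma rational_exponentN v : rational_exponent v -> rational_exponent (- v.1, - v.2).
Proof.
move=> [s [t [hs ht s0 t0 H]]]; exists t, s; split => // z.
rewrite -H -mulrA -expoD /= !subrr expo0 mulr1 //.
Qed.

Lemma rational_exponentMn v n : rational_exponent v ->
  rational_exponent (v.1 *+ n, v.2 *+ n).
Proof.
move=> H; elim: n => [|n IH]; first exact: rational_exponent0.
by rewrite !mulrS; exact: (rational_exponentD H IH).
Qed.

Lemma rational_exponentMz v (k : int) : rational_exponent v ->
  rational_exponent (k * v.1, k * v.2).
Proof.
move=> H; have E (x : int) n : x *+ n = Posz n * x by rewrite -mulr_natl natz.
case: k => n; first by rewrite -!E; exact: rational_exponentMn.
rewrite NegzE !mulNr -!E.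
exact: (rational_exponentN (rational_exponentMn n.+1 H)).
Qed.

(** Cramer's rule: two independent exponents put a nonzero one on each axis. *)
Lemma rational_exponent_det v w : rational_exponent v -> rational_exponent w ->
  rational_exponent (v.1 * w.2 - w.1 * v.2, 0) /\
  rational_exponent (0, v.1 * w.2 - w.1 * v.2).
Proof.
move=> Hv Hw; split.
  have := rational_exponentD (rational_exponentMz w.2 Hv) (rational_exponentMz (- v.2) Hw).
  by congr rational_exponent; congr (_, _) => /=; ring.
have := rational_exponentD (rational_exponentMz (- w.1) Hv) (rational_exponentMz v.1 Hw).
by congr rational_exponent; congr (_, _) => /=; ring.
Qed.

(** The coefficients [n > 0] are summed as a geometric series of ratio
    [r / (r + d)]. *)
Lemma ps_majorant (f : C -> C) (L r d : R) : holo f -> 0 <= L -> 0 < d -> 0 < r ->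
  (forall n, (0 < n)%N -> N (coef f n) * (r + d) ^+ n <= L) ->
  forall z, N z <= r -> N (f z) <= N (f 0) + L * ((r + d) / d).
Proof.
move=> ef L0 d0 r0 H z zr.
have rd : 0 < r + d by lra.
set x := r / (r + d).
have x0 : 0 <= x by rewrite divr_ge0 ?(ltW r0) ?(ltW rd).
have x1 : x < 1 by rewrite ltr_pdivrMr // mul1r ltrDl.
have fin n : N (ps (coef f) n.+1 z) <= N (f 0) + L * (1 - x ^+ n) * ((r + d) / d).
  elim: n => [|n IH].
    rewrite /ps big_ord1 expr0 mulr1 -(ps_at0 (entire_is_ps ef)) subrr mulr0 mul0r addr0.
    exact: lexx.
  rewrite psS; apply: (le_trans (ND _ _)).
  have : N (coef f n.+1 * z ^+ n.+1) <= L * x ^+ n.+1.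
    rewrite NM NX /x expr_div_n mulrA ler_pdivlMr ?exprn_gt0 // mulrAC.
    apply: ler_pM; rewrite ?mulr_ge0 ?exprn_ge0 ?N_ge0 ?(ltW rd) ?H //.
    by rewrite lerXn2r ?nnegrE ?N_ge0 // ltW.
  have -> : L * (1 - x ^+ n.+1) * ((r + d) / d) =
      L * (1 - x ^+ n) * ((r + d) / d) + L * x ^+ n.
    have -> : (r + d) / d = (1 - x)^-1.
      by rewrite /x; field; rewrite !gt_eqF //; lra.
    rewrite exprS; field; rewrite gt_eqF // subr_gt0 //.
  have : x ^+ n.+1 <= x ^+ n by rewrite exprS ler_piMl ?exprn_ge0 // ltW.
  move=> h1 h2; have : L * x ^+ n.+1 <= L * x ^+ n by rewrite ler_wpM2l.
  lra.
apply/ler_addgt0Pr => e e0; have [n Hn] := entire_is_ps ef z e0.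
have {}Hn := Hn n.+1 (leqnSn n).
rewrite -(subrK (ps (coef f) n.+1 z) (f z)); apply: (le_trans (ND _ _)).
rewrite addrC; apply: lerD => //; apply: (le_trans (fin n)); rewrite lerD2l.
rewrite ler_wpM2r ?divr_ge0 ?(ltW d0) ?(ltW rd) //; apply: ler_piMr => //.
by rewrite gerBl exprn_ge0.
Qed.

Lemma coef_multiple_bound (f : C -> C) (l : int) : holo f -> l != 0 ->
  forall n, N (coef f n) <= N (coef (fun z => l%:~R * f z) n).
Proof.
move=> ef l0 n.
have l1 : 1 <= N (l%:~R : C).
  have -> : (l%:~R : C) = (l%:~R : R)%:C by rewrite rmorph_int.
  by rewrite NR -intr_norm -[1]/(1%:~R) ler_int -gtz0_ge1 normr_gt0.
have -> : coef (fun z => l%:~R * f z) n = l%:~R * coef f n.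
  rewrite /coef /mean -avgZ; last by apply: cont_fXn.
  by congr avg; apply/funext => t; rewrite mulrA.
by rewrite (NM _ (coef f n)); apply: ler_peMl; rewrite ?N_ge0.
Qed.

(** If [exp (l f)] is a quotient of small functions, [quotient_coef_bound] turns
    a bound [T] for [P] and [Q] into a bound for [f] logarithmic in [T]: the
    denominator [s], divided by its power of [z], is the function [B] there. *)
Lemma growth_improve (f : C -> C) (l : int) s t : holo f -> l != 0 ->
  small s -> small t -> (exists z, s z != 0) ->
  (forall z, s z * cexp (l%:~R * f z) = t z) ->
  exists2 A : R, 1 <= A & forall r (d T : R), 1 <= r -> 0 < d <= 1 -> 1 <= T ->
    bounded2 (r + 2 * d) T -> forall z, N z <= r -> N (f z) <= A * (r / d) * (1 + ln (T / d)).
Proof.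
move=> ef l0 [es [K [k [K1 HK]]]] [et [K' [k' [K'1 HK']]]] s0 Hst.
have [j [B [eB B0 HB]]] := order_at0 es s0.
set p := fun z => l%:~R * f z.
have ep : holo p by exact: entireZ.
have b0 : 0 < N (B 0) by rewrite N_gt0.
set A0 := 4 * `|ln (2 * (K * K') / N (B 0))| + 2 * N (p 0).
have A00 : 0 <= A0 by rewrite /A0 addr_ge0 // mulr_ge0 // N_ge0.
set kk := (4 * (k + k')%N%:R : R).
have kk0 : 0 <= kk by rewrite mulr_ge0 // ler0n.
exists (1 + N (f 0) + 2 * (A0 + kk)).
  by have := N_ge0 (f 0); lra.
move=> r d T r1 d01 T1 Bd z zr; have /andP[d0 d1] := d01.
have td := ratio_ge1 d01 T1; have td0 : 0 < T / d by lra.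
have lt0 : 0 <= ln (T / d) by rewrite ln_ge0.
set M := K * K' * (T / d) ^+ (k + k').
have M0 : 0 < M by rewrite !mulr_gt0 ?exprn_gt0 //; lra.
have Bd' : bounded2 (r + d + d) T by apply: bounded2_mono Bd => //; lra.
have KM (K2 : R) k2 (s' : C -> C) : 1 <= K2 -> K2 <= K * K' -> (k2 <= k + k')%N ->
   (forall z, N z <= r + d -> N (s' z) <= K2 * (T / d) ^+ k2) ->
   forall w, N w = r + d -> N (s' w) <= M.
  move=> h1 h2 h3 h4 w wr; apply: (le_trans (h4 w ltac:(by rewrite wr))).
  apply: ler_pM; rewrite ?exprn_ge0 ?(ltW td0) //; first lra.
  by rewrite ler_weXn2l.
have sM : forall w, N w = r + d -> N (s w) <= M.
  by apply: (KM K k) => //; [apply: ler_peMr => //; lra|rewrite leq_addr|exact: HK].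
have tM : forall w, N w = r + d -> N (t w) <= M.
  by apply: (KM K' k') => //; [apply: ler_peMl => //; lra|rewrite leq_addl|exact: HK'].
have Bw w : N w = r + d -> N (B w) <= N (s w).
  move=> wr; rewrite HB NM NX wr; apply: ler_peMl; first exact: N_ge0.
  by rewrite exprn_ege1 //; lra.
have H1 w : N w = r + d -> N (B w) <= M.
  by move=> wr; apply: (le_trans (Bw w wr)); exact: sM.
have H2 w : N w = r + d -> N (B w * cexp (p w)) <= M.
  move=> wr; apply: le_trans (tM w wr); rewrite -Hst !NM ler_wpM2r ?N_ge0 //.
  exact: Bw.
set L := A0 + kk * ln (T / d).
have L0 : 0 <= L by rewrite addr_ge0 // mulr_ge0.
have rd0 : 0 < r + d by lra.
have HL n : (0 < n)%N -> N (coef p n) * (r + d) ^+ n <= L.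
  move=> n0; apply: (le_trans (quotient_coef_bound eB ep rd0 n0 B0 H1 H2)).
  have -> : 2 * M / N (B 0) = (2 * (K * K') / N (B 0)) * (T / d) ^+ (k + k').
    by rewrite /M; field; rewrite !gt_eqF.
  rewrite lnM ?posrE ?exprn_gt0 //; last first.
    by rewrite divr_gt0 // !mulr_gt0 //; lra.
  rewrite lnXn // /L /A0 /kk -mulr_natl.
  have := ler_norm (ln (2 * (K * K') / N (B 0))); lra.
have HL' n : (0 < n)%N -> N (coef f n) * (r + d) ^+ n <= L.
  move=> n0; apply: le_trans (HL n n0); rewrite ler_wpM2r ?exprn_ge0 ?(ltW rd0) //.
  exact: coef_multiple_bound.
have r00 : 0 < r by lra.
apply: (le_trans (ps_majorant ef L0 d0 r00 HL' zr)).
have rd : 1 <= r / d by apply: ratio_ge1.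
have -> : (r + d) / d = r / d + 1 by field; rewrite gt_eqF.
have f0 := N_ge0 (f 0).
rewrite /L {HL HL'}; clear L0 L.
have kY : 0 <= kk * ln (T / d) by rewrite mulr_ge0.
set X := r / d in rd *; set Y := ln (T / d) in lt0 kY *.
apply: (@le_trans _ _ (N (f 0) * X * (1 + Y) + (A0 + kk) * (1 + Y) * (2 * X))).
  apply: lerD.
    rewrite -mulrA; apply: ler_peMr => //.
    by rewrite -[1]mulr1 ler_pM //; lra.
  have AY : 0 <= A0 * Y by rewrite mulr_ge0.
  by apply: ler_pM; lra.
have : 0 <= X * (1 + Y) by rewrite mulr_ge0 //; lra.
lra.
Qed.

Lemma ln_le_sub1 (x : R) : 0 < x -> ln x <= x - 1.
Proof.
by move=> x0; rewrite -{1}(subrK 1 x) addrC; apply: le_ln1Dx; lra.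
Qed.

(** The improvement is applied inwards, from the radius [r (i + 1)] to [r i] with
    the margin [2 ^ - i].  All radii stay below [sg ^ 4 + 4], where [P] and [Q]
    have some bound, and [K i] exceeds it for large [i]; each step loses a
    factor of order [2 ^ i] but replaces the bound by its logarithm, so the
    bounds may decrease fourfold.  The exponents [4] and [6] only have to
    make [sg ^ 6] smaller than the square of the radius. *)
Lemma growth_iterate (A : R) : 1 <= A ->
  (forall r (d T : R), 1 <= r -> 0 < d <= 1 -> 1 <= T -> bounded2 (r + 2 * d) T ->
     bounded2 r (A * (r / d) * (1 + ln (T / d)))) ->
  forall sg : R, 70 * A <= sg -> bounded2 (sg ^+ 4) (sg ^+ 6).
Proof.
move=> A1 H sg Asg.
have sg1 : 1 <= sg by lra.
have sg0 : 0 < sg by lra.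
have s4 : 1 <= sg ^+ 4 by rewrite exprn_ege1.
have s6 : 1 <= sg ^+ 6 by rewrite exprn_ege1.
pose r i : R := sg ^+ 4 + 4 * (1 - 2 ^- i).
pose K (i : nat) : R := 4 ^+ i * sg ^+ 6.
have p2 i : 0 < (2 ^- i : R) <= 1.
  rewrite invr_gt0 exprn_gt0 //= invf_le1 ?exprn_gt0 //; apply: exprn_ege1; lra.
have step i : bounded2 (r i.+1) (K i.+1) -> bounded2 (r i) (K i).
  move=> B; have /andP[di0 di1] := p2 i.
  have ri1 : 1 <= r i by rewrite /r; lra.
  have K1 : 1 <= K i.+1 by rewrite /K -[1]mulr1 ler_pM // exprn_ege1 //; lra.
  have rE : r i.+1 = r i + 2 * 2 ^- i.
    by rewrite /r (exprS 2 i); field; rewrite expf_neq0.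
  rewrite rE in B.
  apply: (bounded2_mono (lexx _) _ (H (r i) (2 ^- i) (K i.+1) ri1 (p2 i) K1 B)).
  have KdE : K i.+1 / 2 ^- i = 4 * 8 ^+ i * sg ^+ 6.
    rewrite /K invrK (exprS 4 i) (_ : (8 : R) = 4 * 2) ?exprMn; last by ring.
    ring.
  have i0 : 0 <= i%:R :> R by rewrite ler0n.
  have lnle : ln (K i.+1 / 2 ^- i) <= 3 + 7 * i%:R + 6 * sg.
    rewrite KdE lnM ?posrE ?mulr_gt0 ?exprn_gt0 // [ln (4 * _)]lnM ?posrE ?exprn_gt0 //.
    rewrite !lnXn //.
    have l4 : ln (4 : R) <= 4 - 1 by apply: ln_le_sub1; lra.
    have l8 : ln (8 : R) <= 8 - 1 by apply: ln_le_sub1; lra.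
    have ls : ln sg <= sg - 1 by apply: ln_le_sub1; lra.
    rewrite -[ln 8 *+ i]mulr_natr -[ln sg *+ 6]mulr_natr.
    have : ln (8 : R) * i%:R <= 7 * i%:R by apply: ler_wpM2r => //; lra.
    lra.
  have i2 : 1 + i%:R <= 2 ^+ i :> R by rewrite addrC natr1 -natrX ler_nat ltn_expl.
  set D : R := 2 ^+ i in i2 *.
  have D1 : 1 <= D by rewrite exprn_ege1 //; lra.
  have -> : K i = D * D * sg ^+ 6.
    by rewrite /K (_ : (4 : R) = 2 * 2) ?exprMn //; ring.
  have rle : r i <= 5 * sg ^+ 4 by rewrite /r; lra.
  set l := ln _ in lnle *; rewrite invrK.
  have l1 : 1 + l <= 14 * sg * D.
    have : 0 <= (sg - 1) * i%:R by rewrite mulr_ge0 //; lra.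
    have : sg * (1 + i%:R) <= sg * D by rewrite ler_wpM2l // ltW.
    lra.
  have l0 : 0 <= l.
    rewrite ln_ge0 // invrK; apply: (le_trans K1); apply: ler_peMr => //; lra.
  apply: (@le_trans _ _ (A * (5 * sg ^+ 4 * D) * (14 * sg * D))).
    have a1 : 0 <= A * (r i * D) by rewrite !mulr_ge0 //; lra.
    have a2 : A * (r i * D) <= A * (5 * sg ^+ 4 * D).
      by rewrite ler_wpM2l ?ler_wpM2r //; lra.
    by apply: ler_pM => //; lra.
  have -> : A * (5 * sg ^+ 4 * D) * (14 * sg * D) = (70 * A) * (D * D * sg ^+ 5) by ring.
  have -> : D * D * sg ^+ 6 = sg * (D * D * sg ^+ 5) by ring.
  by rewrite ler_wpM2r // !mulr_ge0 ?exprn_ge0 //; lra.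
have [MP HP] := continuous_bounded (sg ^+ 4 + 4) (entire_cont eP).
have [MQ HQ] := continuous_bounded (sg ^+ 4 + 4) (entire_cont eQ).
set M := Num.max 0 (Num.max MP MQ).
have M0 : 0 <= M by rewrite le_max lexx.
have [J HJ] := half_pow_small M0 (ltr01 : 0 < 1 :> R).
have BJ : bounded2 (r J) (K J).
  have MK : M <= K J.
    move: HJ; rewrite ltr_pdivrMr ?exprn_gt0 // mul1r => /ltW /le_trans; apply.
    rewrite /K -[X in X <= _]mulr1 ler_pM ?exprn_ge0 //.
    by rewrite lerXn2r ?nnegrE //; lra.
  have rJ : r J <= sg ^+ 4 + 4 by rewrite /r; have := p2 J; lra.
  move=> z zr; split; apply: le_trans MK; rewrite /M !le_max.
    by rewrite HP ?orbT // (le_trans zr).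
  by rewrite HQ ?orbT // (le_trans zr).
have B0 : bounded2 (r 0%N) (K 0%N).
  elim: J BJ {HJ} => [//|J IH] /step; exact: IH.
by move: B0; rewrite /r /K expr0 invr1 subrr mulr0 addr0 expr0 mul1r.
Qed.

(** By [growth_iterate], [N (P z)] is at most [N z ^ (3 / 2)] along a sequence of
    radii, which leaves only the first two Taylor coefficients. *)
Theorem rational_axes_affine (k l : int) : k != 0 -> l != 0 ->
  rational_exponent (k, 0) -> rational_exponent (0, l) ->
  exists a b : C, forall z, P z = a * z + b.
Proof.
move=> k0 l0 [s [t [hs ht s0 t0 H]]] [s' [t' [hs' ht' s'0 t'0 H']]].
have [|A A1 HA] := growth_improve eP k0 hs ht s0.
  by move=> z; rewrite -H /expo /= mul0r addr0.
have [|A' A'1 HA'] := growth_improve eQ l0 hs' ht' s'0.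
  by move=> z; rewrite -H' /expo /= mul0r add0r.
have G : forall r (d T : R), 1 <= r -> 0 < d <= 1 -> 1 <= T -> bounded2 (r + 2 * d) T ->
     bounded2 r ((A + A') * (r / d) * (1 + ln (T / d))).
  move=> r d T r1 d01 T1 B z zr.
  have h1 := HA r d T r1 d01 T1 B z zr; have h2 := HA' r d T r1 d01 T1 B z zr.
  have rd := ratio_ge1 d01 r1; have l00 : 0 <= ln (T / d) by rewrite ln_ge0 // ratio_ge1.
  have X0 : 0 <= r / d * (1 + ln (T / d)) by rewrite mulr_ge0 //; lra.
  have XA : 0 <= A * (r / d * (1 + ln (T / d))) by rewrite mulr_ge0 //; lra.
  have XA' : 0 <= A' * (r / d * (1 + ln (T / d))) by rewrite mulr_ge0 //; lra.
  by rewrite -mulrA mulrDl; rewrite -mulrA in h1; rewrite -mulrA in h2; split; lra.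
have {}G := growth_iterate (ltac:(lra) : 1 <= A + A') G.
exists (coef P 1), (coef P 0) => z.
rewrite (@coef_eq0_poly _ P 2) //.
  by rewrite /ps !big_ord_recr /= big_ord0 add0r expr0 mulr1 expr1 addrC.
move=> j j2; apply: N_small_eq0 => e e0.
set sg := Num.max (70 * (A + A')) (2 / e).
have sgA : 70 * (A + A') <= sg by rewrite le_max lexx.
have sg1 : 1 <= sg by lra.
have sg0 : 0 < sg by lra.
have sge : 2 <= e * sg.
  by rewrite [e * sg]mulrC -ler_pdivrMr // le_max lexx orbT.
have r0 : 0 < sg ^+ 4 by rewrite exprn_gt0.
have CB : N (coef P j) * (sg ^+ 4) ^+ j <= 2 * sg ^+ 6.
  apply: coef_bound => // w wr.
  by have [] := G sg sgA w ltac:(by rewrite wr).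
have h : N (coef P j) * sg * sg ^+ 6 <= 2 * sg ^+ 6.
  apply: le_trans CB; rewrite -mulrA -exprS ler_wpM2l ?N_ge0 // -exprM ler_weXn2l //.
  by apply: (@leq_trans (4 * 2)); rewrite ?leq_mul2l.
move: h; rewrite ler_pM2r ?exprn_gt0 // => h.
rewrite -(ler_pM2r sg0); exact: le_trans h sge.
Qed.
End SmallFunctions.

(** * Relations between exponentials with small coefficients *)

Section Borel.
Variable R : realType.
Local Notation C := R[i].
Variables P Q : C -> C.
Hypotheses (eP : holo P) (eQ : holo Q).
Implicit Types (s t : C -> C) (v w : int * int) (z : C).

Local Notation small := (small P Q).
Local Notation expo := (expo P Q).
Local Notation rational_exponent := (rational_exponent P Q).

Definition subv v w : int * int := (v.1 - w.1, v.2 - w.2).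

Definition logder v z : C := v.1%:~R * P^`()%classic z + v.2%:~R * Q^`()%classic z.

Lemma small_logder v : small (logder v).
Proof.
apply: small_add; apply: small_mul; try exact: small_cst.
  by apply: small_derive; exact: small_P.
by apply: small_derive; exact: small_Q.
Qed.

Lemma cder_expo v z : cder (expo v) z (expo v z * logder v z).
Proof.
have D := cderD (cderZ v.1%:~R (entire_cder z eP)) (cderZ v.2%:~R (entire_cder z eQ)).
exact: (cder_comp (cder_cexp _) D).
Qed.

Lemma cder_term s v z : holo s ->
  cder (fun z => s z * expo v z) z
    ((s^`()%classic z + s z * logder v z) * expo v z).
Proof.
move=> es; apply: (cder_eq (cderM (entire_cder z es) (cder_expo v z))); ring.
Qed.

Lemma cder_sum (I : Type) (L : seq I) (F G : I -> C -> C) z :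
  (forall i, cder (F i) z (G i z)) ->
  cder (fun z => \sum_(i <- L) F i z) z (\sum_(i <- L) G i z).
Proof.
move=> H; elim: L => [|i L IH].
  rewrite big_nil; under [X in cder X]funext do rewrite big_nil.
  exact: cder_cst.
have -> : (fun z => \sum_(j <- i :: L) F j z) = (fun z => F i z + \sum_(j <- L) F j z).
  by apply/funext => w; rewrite big_cons.
by rewrite big_cons; apply: cderD.
Qed.

Lemma derive_zero s : (forall z, s z = 0) -> forall z, s^`()%classic z = 0.
Proof.
move=> s0 z; have -> : s = (fun=> 0) by apply/funext.
exact: cder_val (cder_cst 0 z).
Qed.

Lemma expo_subv v w z : expo (subv v w) z * expo w z = expo v z.
Proof. by rewrite -expoD /subv /= !subrK; case: v. Qed.

(** Borel's lemma in differential form.  One term is eliminated by combining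
    the relation with its derivative; the leading coefficient obtained is the
    Wronskian of the two terms, whose vanishing would make their quotient
    constant. *)
Theorem borel (I : Type) (L : seq I) (s : I -> C -> C) (v : I -> int * int) s0 v0 :
  small s0 -> (forall i, small (s i)) ->
  (forall i, (forall z, s i z = 0) \/ ~ rational_exponent (subv (v i) v0)) ->
  (forall z, s0 z * expo v0 z + \sum_(i <- L) s i z * expo (v i) z = 0) ->
  forall z, s0 z = 0.
Proof.
elim: L s s0 => [|i L IH] s s0 hs0 hs rat rel.
  move=> z; have := rel z; rewrite big_nil addr0 => /eqP.
  by rewrite mulf_eq0 (negPf (expo_neq0 _ _ _ _)) orbF => /eqP.
have [si0|/not_zero_ex sin0] := pselect (forall z, s i z = 0).
  apply: (IH s s0 hs0 hs rat) => z.
  by have := rel z; rewrite big_cons si0 mul0r add0r.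
have hsi := small_holo (hs i).
pose D t w z := t^`()%classic z + t z * logder w z.
pose W t w z := s i z * D t w z - D (s i) (v i) z * t z.
have smallD t w : small t -> small (D t w).
  move=> ht; apply: small_add; first exact: small_derive.
  by apply: small_mul => //; exact: small_logder.
have smallW t w : small t -> small (W t w).
  move=> ht; apply: small_sub; apply: small_mul => //; exact: smallD.
have rel' z : D s0 v0 z * expo v0 z +
    (D (s i) (v i) z * expo (v i) z + \sum_(j <- L) D (s j) (v j) z * expo (v j) z) = 0.
  have /= K := @cder_sum _ (i :: L) (fun j z => s j z * expo (v j) z)
     (fun j z => D (s j) (v j) z * expo (v j) z) z
     (fun j => cder_term (v j) z (small_holo (hs j))).
  have K2 := cderD (cder_term v0 z (small_holo hs0)) K.
  have K3 := cder_near ltr01 (fun (u : C) _ => rel u) K2.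
  by have := cder_unique K3 (cder_cst 0 z); rewrite big_cons.
have W0 : forall z, W s0 v0 z = 0.
  apply: (IH (fun j => W (s j) (v j))).
  - exact: smallW.
  - by move=> j; exact: smallW.
  - move=> j; case: (rat j) => [sj0|]; [left|by right].
    by move=> z; rewrite /W /D sj0 derive_zero // !(mulr0, mul0r, addr0, subr0).
  - move=> z; have := rel z; rewrite big_cons => r1; have r2 := rel' z.
    transitivity (s i z * (D s0 v0 z * expo v0 z + (D (s i) (v i) z * expo (v i) z
      + \sum_(j <- L) D (s j) (v j) z * expo (v j) z)) - D (s i) (v i) z *
      (s0 z * expo v0 z + (s i z * expo (v i) z + \sum_(j <- L) s j z * expo (v j) z)));
      last by rewrite r1 r2 !mulr0 subrr.
    have -> : \sum_(j <- L) W (s j) (v j) z * expo (v j) z =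
       s i z * (\sum_(j <- L) D (s j) (v j) z * expo (v j) z)
       - D (s i) (v i) z * (\sum_(j <- L) s j z * expo (v j) z).
      rewrite !mulr_sumr -sumrB; apply: eq_bigr => j _; rewrite /W; ring.
    by rewrite /W; ring.
have eE w : holo (expo w) by exact: holo_expo.
have [||||a Ha] := @wronskian_eq0 _ (fun z => s0 z * expo v0 z) (fun z => s i z * expo (v i) z).
- exact: (entireM (small_holo hs0) (eE v0)).
- exact: (entireM hsi (eE (v i))).
- by have [z sz] := sin0; exists z; rewrite mulf_neq0 // expo_neq0.
- move=> z; rewrite (cder_val (cder_term v0 z (small_holo hs0))).
  rewrite (cder_val (cder_term (v i) z hsi)).
  have E : s i z * (s0^`()%classic z + s0 z * logder v0 z) =
      ((s i)^`()%classic z + s i z * logder (v i) z) * s0 z.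
    by apply/eqP; rewrite -subr_eq0; apply/eqP; exact: (W0 z).
  transitivity ((s i z * (s0^`()%classic z + s0 z * logder v0 z)) *
    (expo v0 z * expo (v i) z)); first by ring.
  by rewrite E; ring.
apply: contrapT => /not_zero_ex s0n0.
have a0 : a != 0.
  have [z sz] := s0n0; apply/eqP => a0; have /eqP := Ha z.
  by rewrite a0 mul0r mulf_eq0 (negPf sz) (negPf (expo_neq0 _ _ _ _)).
have [si0|] := rat i; first by have [z] := sin0; rewrite si0 eqxx.
apply; exists (fun z => a * s i z), s0; split => //.
- by apply: small_mul => //; exact: small_cst.
- by have [z sz] := sin0; exists z; rewrite mulf_neq0.
- move=> z; apply: (mulIf (expo_neq0 P Q v0 z)).
  by rewrite /= -[_ * expo v0 z]mulrA expo_subv -mulrA -Ha.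
Qed.

Section FiniteSums.
Variables (I : finType) (s : I -> C -> C) (v : I -> int * int).
Hypothesis hs : forall i, small (s i).
Hypothesis rel : forall z, \sum_i s i z * expo (v i) z = 0.

Lemma borel_single k :
  (forall i, i != k -> ~ rational_exponent (subv (v i) (v k))) ->
  forall z, s k z = 0.
Proof.
move=> H; pose s' i z := if i == k then 0 else s i z.
apply: (@borel _ (index_enum I) s' v (s k) (v k)) => //.
- move=> i; rewrite /s'; case: eqP => _; [exact: small_cst|exact: hs].
- move=> i; rewrite /s'; case: eqP => [_|/eqP ik]; [by left|right; exact: H].
- move=> z; transitivity (\sum_i s i z * expo (v i) z); last exact: rel.
  rewrite [RHS](bigD1 k) //=; congr (_ + _).
  rewrite [RHS]big_mkcond; apply: eq_bigr => i _.
  by rewrite /s'; case: eqP => //= _; rewrite mul0r.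
Qed.

(** The two comparable terms merge into one with a small coefficient, to which
    [borel] applies. *)
Lemma borel_pair k l : k != l -> (exists z, s k z != 0) ->
  (forall i, i != k -> i != l -> ~ rational_exponent (subv (v i) (v k))) ->
  forall z, s k z * expo (v k) z + s l z * expo (v l) z = 0.
Proof.
move=> kl [z0 sk0] H.
have [[a [b [ha hb a0 b0 Hab]]]|nr] := pselect (rational_exponent (subv (v l) (v k))); last first.
  suff : s k z0 = 0 by move/eqP; rewrite (negPf sk0).
  apply: borel_single => i ik; have [->//|il] := eqVneq i l.
  exact: H.
pose s' i z := if (i == k) || (i == l) then 0 else a z * s i z.
have S0 : forall z, a z * s k z + b z * s l z = 0.
  apply: (@borel _ (index_enum I) s' v (fun z => a z * s k z + b z * s l z) (v k)).
  - by apply: small_add; exact: small_mul.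
  - by move=> i; rewrite /s'; case: (boolP (_ || _)) => _; [exact: small_cst|exact: small_mul].
  - move=> i; rewrite /s'; case: (boolP (_ || _)) => [_|]; first by left.
    by rewrite negb_or => /andP[ik il]; right; exact: H.
  - move=> z; transitivity (a z * \sum_i s i z * expo (v i) z); last by rewrite rel mulr0.
    rewrite [in RHS](bigD1 k) //= [in RHS](bigD1 l) /=; last by rewrite eq_sym.
    rewrite mulrDr mulrDr addrA; congr (_ + _).
      rewrite mulrDl !mulrA; congr (_ + _).
      by rewrite -Hab -(expo_subv (v l) (v k)); ring.
    rewrite mulr_sumr [RHS]big_mkcond; apply: eq_bigr => i _.
    rewrite /s'; case: eqP => //= _; first by rewrite mul0r.
    by case: eqP => //= _; rewrite ?mul0r // mulrA.
apply: (entire_mul_eq0 (small_holo ha)) => //.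
  by apply: entireD; apply: entireM; first [exact: small_holo|exact: holo_expo].
move=> z; rewrite mulrDr !mulrA -[expo (v l) z](expo_subv (v l) (v k)).
transitivity ((a z * s k z + (a z * expo (subv (v l) (v k)) z) * s l z) * expo (v k) z).
  by ring.
by rewrite Hab S0 mul0r.
Qed.
End FiniteSums.
End Borel.

(** * The periodicity of an exponential satisfying the functional equation *)

Section PeriodicExponential.
Variable R : realType.
Local Notation C := R[i].
Implicit Types (P Q h H : C -> C) (z c : C).

Lemma cexp_eq1_const P : holo P -> (forall z, cexp (P z) = 1) ->
  forall z, P z = P 0.
Proof.
move=> eP H; apply: derive_eq0_cst => // z.
have D := entire_cder z eP; apply: (cder_eq D).
have := cder_comp (cder_cexp (P z)) D; rewrite H mul1r.
rewrite (_ : @cexp R \o P = (fun=> 1)); last by apply/funext => w; exact: H.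
by move/cder_unique; apply; exact: cder_cst.
Qed.

Lemma cexp_affine_periodic (a b : C) : exists c, c != 0 /\
  forall z, cexp (a * (z + c) + b) = cexp (a * z + b).
Proof.
have [->|a0] := eqVneq a 0.
  by exists 1; split; [rewrite oner_eq0|move=> z; rewrite !mul0r].
have p0 : (0 +i* (2 * pi) : C) != 0.
  by rewrite eq_complex /= eqxx /= gt_eqF // mulr_gt0 ?pi_gt0.
exists ((0 +i* (2 * pi)) / a); split; first by rewrite mulf_neq0 // invr_neq0.
move=> z; rewrite mulrDr [a * (_ / a)]mulrCA divff // mulr1 addrAC cexpD.
by rewrite cexp_2pi_i mulr1.
Qed.

Lemma period_of_shift P c (k : C) (l : nat) : (forall z, P (z + c) = P z + k) ->
  cexp (l%:R * k) = 1 -> forall z, cexp (P (z + l%:R * c)) = cexp (P z).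
Proof.
move=> H lk z; suff -> : P (z + l%:R * c) = P z + l%:R * k by rewrite cexpD lk mulr1.
elim: l {lk} => [|l IH]; first by rewrite !mul0r !addr0.
by rewrite -natr1 !mulrDl !mul1r addrA H IH addrA.
Qed.

(** Dividing the two relations eliminates [h] and [H] and leaves
    [exp (l (Q - P)) = 1] for [l = N - d], so [Q - P] is constant. *)
Lemma period_of_matched_terms P c h H (N d : nat) : holo P -> c != 0 ->
  holo h -> holo H -> (exists z, h z != 0) -> (exists z, H z != 0) -> (d < N)%N ->
  (forall z, h z * (cexp (P z) * cexp (P (z + c)) ^+ N) =
             H z * (cexp (P (z + c)) * cexp (P z) ^+ N)) ->
  (forall z, h z * (cexp (P z) * cexp (P (z + c)) ^+ d) =
             H z * (cexp (P (z + c)) * cexp (P z) ^+ d)) ->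
  exists c', c' != 0 /\ forall z, cexp (P (z + c')) = cexp (P z).
Proof.
move=> eP c0 eh eH h0 H0 dN HN Hd.
pose Q z := P (z + c); have eQ : holo Q by exact: entire_translate.
set l := (N - d)%N; have Nl : N = (d + l)%N by rewrite /l subnKC // ltnW.
have l0 : (l%:R : C) != 0 by rewrite pnatr_eq0 -lt0n subn_gt0.
have pw z : cexp (Q z) ^+ l = cexp (P z) ^+ l.
  apply/eqP; rewrite -subr_eq0; apply/eqP; move: z.
  apply: (@entire_mul_eq0 _ (fun z => h z * H z)).
  - exact: entireM.
  - by apply: entireB; apply: entireX; exact: entire_cexp.
  - move=> z; have := HN z; have := Hd z; rewrite -/(Q z) Nl !exprD.
    have := cexp_neq0 (P z); have := cexp_neq0 (Q z).
    set x := cexp (P z); set y := cexp (Q z) => y0 x0 E1 E2.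
    have u0 : x * y * x ^+ d * y ^+ d != 0 by rewrite !mulf_neq0 ?expf_neq0.
    apply: (mulfI u0); rewrite mulr0.
    transitivity ((h z * (x * (y ^+ d * y ^+ l))) * (H z * (y * x ^+ d)) -
      (H z * (y * (x ^+ d * x ^+ l))) * (h z * (x * y ^+ d))); first by ring.
    by rewrite E2 -E1; ring.
  - exact: entire_mul_neq0.
have e1 z : cexp (l%:R * (Q z - P z)) = 1.
  rewrite mulrBr cexpD cexpN -!cexpX pw mulfV // expf_neq0 //.
  exact: cexp_neq0.
have ed : holo (fun z => l%:R * (Q z - P z)) by apply: entireZ; exact: entireB.
have cst := cexp_eq1_const ed e1.
exists (l%:R * c); split; first by rewrite mulf_neq0.
apply: (@period_of_shift P c (Q 0 - P 0)); last exact: e1.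
by move=> z; have /(mulfI l0) <- := cst z; rewrite [RHS]addrC subrK.
Qed.

Lemma det_same_side (N i j : nat) : (1 < N)%N ->
  (1 - 1) * (1 - N%:Z) - (N%:Z - 1) * (i%:Z - j%:Z) = 0 -> i = j.
Proof.
move=> N1 /eqP; rewrite subrr mul0r sub0r oppr_eq0 mulf_eq0 !subr_eq0.
by case/orP => /eqP; lia.
Qed.

Lemma det_opposite_side (N i j : nat) : (1 < N)%N ->
  (i%:Z - 1) * (1 - N%:Z) - (N%:Z - 1) * (1 - j%:Z) = 0 -> i = j.
Proof.
move=> N1; have -> : (i%:Z - 1) * (1 - N%:Z) - (N%:Z - 1) * (1 - j%:Z) =
  (N%:Z - 1) * (j%:Z - i%:Z) by ring.
by move/eqP; rewrite mulf_eq0 !subr_eq0 => /orP[] /eqP; lia.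
Qed.

(** The product of the two relations makes [exp (2 (P + Q))] constant, where
    [Q z = P (z + c)]; so [P + Q] is constant and a second shift restores [P]. *)
Lemma period_of_inverse P c h H (a : C) : holo P -> c != 0 ->
  holo h -> holo H -> (exists z, h z != 0) -> (exists z, H z != 0) ->
  (forall z, h z * (cexp (P z) * cexp (P (z + c))) = a * H z) ->
  (forall z, H z * (cexp (P z) * cexp (P (z + c))) = a * h z) ->
  exists c', c' != 0 /\ forall z, cexp (P (z + c')) = cexp (P z).
Proof.
move=> eP c0 eh eH h0 H0 E1 E2.
pose S z := P z + P (z + c).
have eS : holo S by apply: entireD => //; exact: entire_translate.
have sq z : cexp (2%:R * S z) = a ^+ 2.
  rewrite -cexpX; apply/eqP; rewrite -subr_eq0; apply/eqP; move: z.
  apply: (@entire_mul_eq0 _ (fun z => h z * H z)).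
  - exact: entireM.
  - by apply: entireB; [apply: entireX; exact: entire_cexp|exact: entire_cst].
  - move=> z; rewrite /S cexpD.
    transitivity ((h z * (cexp (P z) * cexp (P (z + c)))) *
      (H z * (cexp (P z) * cexp (P (z + c)))) - a ^+ 2 * h z * H z); first by ring.
    by rewrite E1 E2; ring.
  - exact: entire_mul_neq0.
have e1 z : cexp (2%:R * S z - 2%:R * S 0) = 1.
  rewrite cexpD cexpN !sq mulfV // -(sq 0); exact: cexp_neq0.
have ed : holo (fun z => 2%:R * S z - 2%:R * S 0).
  by apply: entireB; [exact: entireZ|exact: entire_cst].
have t0 : (2%:R : C) != 0 by rewrite pnatr_eq0.
have Sc z : S z = S 0.
  by have := cexp_eq1_const ed e1 z; rewrite subrr => /eqP; rewrite subr_eq0 => /eqP /(mulfI t0).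
exists (c + c); split; first by rewrite -mulr2n -mulr_natl mulf_neq0.
move=> z; congr cexp; apply: (addrI (P (z + c))); rewrite addrA.
by rewrite -[LHS]/(S (z + c)) Sc -(Sc z) addrC.
Qed.

(** With [x = exp P] and [y = exp Q], the relation is a vanishing sum of the
    monomials [x y^j] and [y x^j] with small coefficients.  Unless [P] is affine,
    any two rational exponents are linearly dependent.  By Borel's lemma the top
    monomials [x y^N] and [y x^N] have partners, and dependence of the two
    exponents leaves two possibilities: [(y / x)^(N - 1)] is a quotient of small
    functions, or [N = 2] and [x y] is one. *)
Theorem exponential_period P c h H (G : {poly C}) N d : holo P -> c != 0 ->
  let Q z := P (z + c) in
  small P Q h -> small P Q H -> (exists z, h z != 0) -> (exists z, H z != 0) ->
  size G = N.+1 -> (1 < N)%N -> (d < N)%N -> G`_d != 0 ->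
  (forall z, h z * cexp (P z) * G.[cexp (Q z)] = H z * cexp (Q z) * G.[cexp (P z)]) ->
  exists c', c' != 0 /\ forall z, cexp (P (z + c')) = cexp (P z).
Proof.
move=> eP c0 Q hh hH h0 H0 sG N1 dN Gd rel.
have eQ : holo Q by exact: entire_translate.
have eh := small_holo hh; have eH := small_holo hH.
have [[a [b Hab]]|naff] := pselect (exists a b, forall z, P z = a * z + b).
  have [c' [c'0 Hc']] := cexp_affine_periodic a b.
  by exists c'; split => // z; rewrite !Hab.
have det v w : rational_exponent P Q v -> rational_exponent P Q w ->
    v.1 * w.2 - w.1 * v.2 = 0.
  move=> hv hw; have [h1 h2] := rational_exponent_det hv hw.
  by apply/eqP/negPn/negP => D0; apply: naff; exact: (rational_axes_affine eP eQ D0 D0 h1 h2).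
pose x z := cexp (P z); pose y z := cexp (Q z).
have GN : G`_N != 0.
  have : lead_coef G != 0 by rewrite lead_coef_eq0 -size_poly_eq0 sG.
  by rewrite lead_coefE sG.
pose I := (bool * 'I_N.+1)%type.
pose s (i : I) z := if i.1 then G`_i.2 * h z else - G`_i.2 * H z.
pose v (i : I) : int * int := if i.1 then (1, Posz i.2) else (Posz i.2, 1).
have hs i : small P Q (s i).
  by rewrite /s; case: i.1; apply: small_mul => //; exact: small_cst.
have expoT j z : expo P Q (1, Posz j) z = x z * y z ^+ j.
  by rewrite /expo /x /y cexpX -cexpD /= mul1r.
have expoF j z : expo P Q (Posz j, 1) z = y z * x z ^+ j.
  by rewrite /expo /x /y cexpX -cexpD /= mul1r addrC.
have rel' z : \sum_i s i z * expo P Q (v i) z = 0.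
  transitivity (\sum_(b : bool) \sum_(j < N.+1) s (b, j) z * expo P Q (v (b, j)) z).
    by rewrite pair_bigA; apply: eq_bigr => -[b j] _.
  rewrite big_bool /s /v /=.
  have /eqP := rel z; rewrite -subr_eq0 !horner_coef sG !mulr_sumr => /eqP R0.
  apply: etrans R0.
  rewrite -sumrN; congr (_ + _); apply: eq_bigr => j _.
    by rewrite expoT -/(x z) -/(y z); ring.
  by rewrite expoF -/(x z) -/(y z); ring.
pose T j : I := (true, j); pose F j : I := (false, j).
have sT (j : 'I_N.+1) : G`_j != 0 -> exists z, s (T j) z != 0.
  by move=> gj; have [z hz] := h0; exists z; rewrite /s /= mulf_neq0.
have sF (j : 'I_N.+1) : G`_j != 0 -> exists z, s (F j) z != 0.
  by move=> gj; have [z hz] := H0; exists z; rewrite /s /= mulf_neq0 // oppr_eq0.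
have partner k : (exists z, s k z != 0) ->
    exists2 i, i != k & rational_exponent P Q (subv (v i) (v k)).
  move=> [z sz]; apply: contrapT => K; move/eqP : sz; apply.
  by apply: (borel_single eP eQ hs rel') => i ik ri; apply: K; exists i.
have GN' : G`_(@ord_max N) != 0 by [].
have [[[] j] jN rj] := partner _ (sT ord_max GN');
have [[[] j'] jN' rj'] := partner _ (sF ord_max GN');
have jle := ltn_ord j; have jle' := ltn_ord j';
have := det _ _ rj rj'; rewrite /subv /=.
- have {}jN : (j < N)%N.
    rewrite ltn_neqAle -ltnS jle andbT; apply: contraNneq jN => jE.
    by apply/eqP; congr pair; apply: val_inj.
  by move=> D; exfalso; nia.
- have {}jN : (j < N)%N.
    rewrite ltn_neqAle -ltnS jle andbT; apply: contraNneq jN => jE.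
    by apply/eqP; congr pair; apply: val_inj.
  have {}jN' : (j' < N)%N.
    rewrite ltn_neqAle -ltnS jle' andbT; apply: contraNneq jN' => jE.
    by apply/eqP; congr pair; apply: val_inj.
  by move=> D; exfalso; nia.
- move=> D; have [E|[jE NE]] : (j = N :> nat) \/ (j = 0%N :> nat /\ N = 2%N).
    have [j0|j0] := posnP j; last by left; nia.
    by right; split => //; nia.
  + (* [x / y] is, up to a power, a quotient of small functions: the terms pair
       off by total degree. *)
    have match_ (j0 : 'I_N.+1) : G`_j0 != 0 ->
        forall z, h z * (x z * y z ^+ j0) = H z * (y z * x z ^+ j0).
      move=> g0 z.
      have := borel_pair eP eQ hs rel' (k := T j0) (l := F j0) isT (sT _ g0) _ z.
      rewrite /s /v /= expoT expoF => K.
      apply: (mulfI g0); apply/eqP; rewrite -subr_eq0; apply/eqP.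
      apply: etrans (K _); first by ring.
      move=> [[] i0] iT iF ri; have := det _ _ ri rj; rewrite /subv /= E => D'.
        by apply: (negP iT); apply/eqP; congr pair; apply: val_inj; apply: (det_same_side N1 D').
      by apply: (negP iF); apply/eqP; congr pair; apply: val_inj; apply: (det_opposite_side N1 D').
    apply: (period_of_matched_terms eP c0 eh eH h0 H0 dN).
      exact: (match_ ord_max GN').
    by have dN' : (d < N.+1)%N by [exact: ltnW]; exact: (match_ (Ordinal dN') Gd).
  + subst N.
    have ne z : x z * y z != 0 by rewrite mulf_neq0 // cexp_neq0.
    have K1 z : G`_2 * h z * (x z * y z ^+ 2) + - G`_0 * H z * (y z * x z ^+ 0) = 0.
      have := borel_pair eP eQ hs rel' (k := T ord_max) (l := F ord0) isT (sT _ GN') _ z.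
      rewrite /s /v /= expoT expoF; apply => -[[] i0] iT iF ri;
        have := det _ _ ri rj; rewrite /subv /= jE => D'.
        apply: (negP iT); apply/eqP; congr pair; apply: val_inj => /=; lia.
      have := ltn_ord i0 => i3; apply: (negP iF); apply/eqP; congr pair.
      apply: val_inj => /=; lia.
    have K2 z : - G`_2 * H z * (y z * x z ^+ 2) + G`_0 * h z * (x z * y z ^+ 0) = 0.
      have := borel_pair eP eQ hs rel' (k := F ord_max) (l := T ord0) isT (sF _ GN') _ z.
      rewrite /s /v /= expoT expoF; apply => -[[] i0] iT iF ri;
        have := det _ _ ri rj; rewrite /subv /= jE => D'.
        apply: (negP iF); apply/eqP; congr pair; apply: val_inj => /=; lia.
      apply: (negP iT); apply/eqP; congr pair; apply: val_inj => /=; lia.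
    apply: (period_of_inverse (a := G`_0 / G`_2) eP c0 eh eH h0 H0) => z.
      apply: (mulfI GN); apply: (mulfI (cexp_neq0 (Q z))); apply/eqP.
      rewrite -subr_eq0; apply/eqP; apply: etrans (K1 z).
      have G2 : G`_2 != 0 by [].
      rewrite -/(x z) -/(y z) expr0; by field.
    apply: (mulfI GN); apply: (mulfI (cexp_neq0 (P z))); apply/eqP.
    rewrite -subr_eq0 -oppr_eq0; apply/eqP; apply: etrans (K2 z).
    have G2 : G`_2 != 0 by [].
    rewrite -/(x z) -/(y z) expr0; by field.
- have {}jN' : (j' < N)%N.
    rewrite ltn_neqAle -ltnS jle' andbT; apply: contraNneq jN' => jE.
    by apply/eqP; congr pair; apply: val_inj.
  by move=> D; exfalso; nia.
Qed.
End PeriodicExponential.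

Section PolynomialRelations.
Variable R : realType.
Local Notation C := R[i].
Implicit Types (f u v : C -> C) (z w c : C) (q : {poly C}) (F : {poly {poly C}}).

(** * Entire functions that are not polynomials *)

Lemma cder_horner q z : cder (fun w => q.[w]) z q^`().[z].
Proof.
elim/poly_ind: q => [|q a IH].
  rewrite deriv0 horner0; have -> : (fun w => (0 : {poly C}).[w]) = (fun=> 0).
    by apply/funext => w; rewrite horner0.
  exact: cder_cst.
have -> : (fun w => (q * 'X + a%:P).[w]) = (fun w => q.[w] * w + a).
  by apply/funext => w; rewrite hornerMXaddC.
apply: (cder_eq (cderD (cderM IH (cder_id z)) (cder_cst a z))).
by rewrite derivMXaddC addr0 hornerD hornerMX mulr1 addrC.
Qed.

Lemma poly_antiderivative q : exists q1 : {poly C}, q1^`() = q.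
Proof.
exists (\poly_(i < (size q).+1) (if i is j.+1 then q`_j / j.+1%:R else 0)).
apply/polyP => i; rewrite coef_deriv coef_poly ltnS.
case: ltnP => qi; last by rewrite mul0rn nth_default.
by rewrite -[_ *+ _]mulr_natr divfK // pnatr_eq0.
Qed.

Lemma holo_derive1n f n : holo f -> holo (f^`(n)%classic).
Proof. by move=> ef; elim: n => [//|n IH]; rewrite derive1nS; exact: entire_derive. Qed.

Lemma derive1n_eq0_poly f n : holo f -> (forall z, f^`(n)%classic z = 0) ->
  exists q, forall z, f z = q.[z].
Proof.
elim: n f => [|n IH] f ef H; first by exists 0 => z; rewrite horner0 -(H z).
have [|q Hq] := IH _ (entire_derive ef).
  by move=> z; rewrite -(H z) derive1Sn.
have [q1 Hq1] := poly_antiderivative q.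
have D z : cder (fun w => f w - q1.[w]) z 0.
  by apply: (cder_eq (cderB (entire_cder z ef) (cder_horner q1 z))); rewrite Hq Hq1 subrr.
have eD : holo (fun w => f w - q1.[w]) by apply: cder_entire => z; exists 0.
exists (q1 + (f 0 - q1.[0])%:P) => z.
by rewrite hornerD hornerC -(derive_eq0_cst eD D z) addrC subrK.
Qed.

Lemma poly_lower_bound q : q != 0 -> exists r0 k : R, [/\ 0 < k, 1 <= r0 &
  forall z, r0 <= N z -> k <= N q.[z]].
Proof.
elim/poly_ind: q => [|q a IH]; first by rewrite eqxx.
have [->|q0] := eqVneq q 0.
  rewrite mul0r add0r polyC_eq0 => a0; exists 1, (N a); split; rewrite ?N_gt0 //.
  by move=> z _; rewrite hornerC.
move=> _; have [r0 [k [k0 r1 H]]] := IH q0.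
exists (Num.max r0 (1 + N a / k)), k; split => //; first by rewrite le_max r1.
move=> z; rewrite ge_max => /andP[zr za]; rewrite hornerMXaddC.
have z1 : 0 <= N z := N_ge0 z.
have h : k * N z <= N (q.[z] * z) by rewrite NM ler_wpM2r // H.
have h2 : k + N a <= k * N z.
  move: za; rewrite -(ler_pM2l k0) mulrDr mulr1 mulrCA divff ?mulr1 //.
  by rewrite gt_eqF.
by have := N_sub_ge (q.[z] * z) (- a); rewrite opprK NN; lra.
Qed.

Lemma poly_upper_bound q : exists (K : R) (e : nat), 0 <= K /\
  forall z, 1 <= N z -> N q.[z] <= K * N z ^+ e.
Proof.
elim/poly_ind: q => [|q a [K [e [K0 H]]]].
  by exists 0, 0%N; split => // z _; rewrite horner0 Normc.normc0 mul0r.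
exists (K + N a), e.+1; split; first by rewrite addr_ge0 ?N_ge0.
move=> z z1; rewrite hornerMXaddC mulrDl; apply: (le_trans (ND _ _)).
apply: lerD; last by apply: ler_peMr; rewrite ?N_ge0 // exprn_ege1.
by rewrite NM exprSr mulrA ler_wpM2r ?N_ge0 // H.
Qed.

Lemma bipoly_upper_bound F s : (size F <= s.+1)%N -> exists (K : R) (e : nat), 0 <= K /\
  forall z w, 1 <= N z -> 1 <= N w -> N F.[w%:P].[z] <= K * N z ^+ e * N w ^+ s.
Proof.
elim/poly_ind: F s => [|F q IH] s.
  move=> _; exists 0, 0%N; split => // z w _ _.
  by rewrite !horner0 Normc.normc0 !mul0r.
rewrite size_MXaddC => sF.
have [K' [e' [K'0 H']]] := poly_upper_bound q.
have [F0|F0] := eqVneq F 0.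
  exists K', e'; split => // z w z1 w1; rewrite F0 mul0r add0r hornerC.
  apply: (le_trans (H' z z1)); apply: ler_peMr; rewrite ?exprn_ege1 //.
  by rewrite mulr_ge0 // exprn_ge0 // N_ge0.
rewrite (negPf F0) ltnS in sF; case: s sF => [|s] sF.
  by move: sF; rewrite leqn0 size_poly_eq0 (negPf F0).
have [K [e [K0 H]]] := IH s sF.
exists (K + K'), (e + e')%N; split; first exact: addr_ge0.
move=> z w z1 w1; rewrite hornerMXaddC hornerD hornerM hornerC !mulrDl.
apply: (le_trans (ND _ _)); apply: lerD.
  rewrite NM exprSr mulrA ler_wpM2r ?N_ge0 //; apply: (le_trans (H z w z1 w1)).
  rewrite ler_wpM2r ?exprn_ge0 ?N_ge0 // ler_wpM2l // ler_weXn2l // leq_addr //.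
apply: (le_trans (H' z z1)); apply: (@le_trans _ _ (K' * N z ^+ (e + e'))).
  by rewrite ler_wpM2l // ler_weXn2l // leq_addl.
apply: ler_peMr; first by rewrite mulr_ge0 // exprn_ge0 // N_ge0.
exact: exprn_ege1.
Qed.

(** The leading coefficient of the relation is bounded below near infinity, so
    the relation bounds [f] by a power of [N z] there. *)
Theorem algebraic_entire_poly f F : holo f -> F != 0 ->
  (forall z, F.[(f z)%:P].[z] = 0) -> exists q, forall z, f z = q.[z].
Proof.
move=> ef F0 H.
have [s sF] : exists s, size F = s.+1.
  by exists (size F).-1; rewrite prednK // lt0n size_poly_eq0.
have q0 : F`_s != 0.
  by have := F0; rewrite -lead_coef_eq0 lead_coefE sF.
have [r0 [k [k0 r1 Hk]]] := poly_lower_bound q0.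
case: s sF q0 Hk => [|s] sF q0 Hk.
  have E : F = (F`_0)%:P by apply: size1_polyC; rewrite sF.
  have := Hk r0%:C; rewrite NR ger0_norm; last by lra.
  move=> /(_ (lexx _)); have := H r0%:C; rewrite {1}E hornerC => ->.
  by rewrite Normc.normc0; lra.
have [K [e [K0 HK]]] := @bipoly_upper_bound (\poly_(i < s.+1) F`_i) s (size_poly _ _).
have bound z : r0 <= N z -> N (f z) <= (1 + K / k) * N z ^+ e.
  move=> zr; have z1 : 1 <= N z by lra.
  have ze : 1 <= N z ^+ e by exact: exprn_ege1.
  have Kk : 0 <= K / k * N z ^+ e by rewrite mulr_ge0 ?divr_ge0 ?(ltW k0) //; lra.
  have [f1|f1] := leP (N (f z)) 1; first by rewrite mulrDl mul1r; lra.
  have E : F.[(f z)%:P] = F`_s.+1 * (f z)%:P ^+ s.+1 + (\poly_(i < s.+1) F`_i).[(f z)%:P].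
    by rewrite horner_poly horner_coef sF big_ord_recr /= addrC.
  have := H z; rewrite E hornerD hornerM horner_exp hornerC => /eqP.
  rewrite addr_eq0 => /eqP E2.
  have h1 : k * N (f z) ^+ s.+1 <= K * N z ^+ e * N (f z) ^+ s.
    apply: le_trans (HK z (f z) z1 (ltW f1)).
    rewrite -[X in _ <= X]NN -E2 NM NX ler_wpM2r ?exprn_ge0 ?N_ge0 //.
    exact: Hk.
  have f0 : 0 < N (f z) by lra.
  move: h1; rewrite exprS mulrA ler_pM2r ?exprn_gt0 // => h1.
  have h2 : N (f z) <= K / k * N z ^+ e.
    by rewrite mulrAC ler_pdivlMr // mulrC.
  by rewrite mulrDl mul1r; lra.
have C0 : forall j, (e < j)%N -> coef f j = 0.
  apply: (@growth_coef_eq0 _ f (1 + K / k)) => //.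
    by rewrite addr_ge0 // divr_ge0 // ltW.
  move=> A; exists (Num.max A r0); split.
  - by rewrite le_max lexx.
  - by rewrite lt_max (lt_le_trans ltr01 r1) orbT.
  - by move=> z zr; rewrite -zr; apply: bound; rewrite zr le_max lexx orbT.
exists (\poly_(j < e.+1) coef f j) => z; rewrite -psE.
by apply: coef_eq0_poly.
Qed.

Lemma coef_affine_exp (K : comNzRingType) (p b : K) n j :
  ((p%:P + b%:P * 'X) ^+ n)`_j = p ^+ (n - j) * b ^+ j *+ 'C(n, j).
Proof.
rewrite exprDn coef_sum.
under eq_bigr => i _ do rewrite exprMn -!rmorphXn /= mulrA -rmorphM /= coefMn coefCM coefXn.
have [jn|jn] := leqP j n; last first.
  rewrite bin_small // mulr0n big1 // => i _.
  by rewrite gtn_eqF ?mulr0 ?mul0rn // (leq_trans (ltn_ord i)).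
rewrite (bigD1 (Ordinal (jn : j < n.+1)%N)) //= eqxx mulr1 big1 ?addr0 // => i ij.
rewrite [j == i]eq_sym -[i == j :> nat]/(i == Ordinal (jn : (j < n.+1)%N)) (negPf ij).
by rewrite mulr0 mul0rn.
Qed.

(** Compare the coefficients of degree [n + m], [n + m - 1], [n] and [0].  For
    [m = 1] the last of them leaves the possibility [p = 1], which would give
    [b = - n] and [b ^ n = 1]. *)
Lemma affine_symmetry (b : C) (p : {poly C}) n m : (0 < n)%N -> (0 < m)%N -> b != 0 ->
  (p%:P + b%:P%:P * 'X) ^+ n * ((p%:P + b%:P%:P * 'X) ^+ m - 1) =
    b%:P%:P * ('X ^+ n * ('X ^+ m - 1)) :> {poly {poly C}} ->
  p = 0 /\ b ^+ m = 1.
Proof.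
move=> n0 m0 b0 H.
have co j : p ^+ (n + m - j) * b%:P ^+ j *+ 'C(n + m, j) - p ^+ (n - j) * b%:P ^+ j *+ 'C(n, j)
   = b%:P * ((j == n + m)%N%:R - (j == n)%:R).
  have := congr1 (fun F : {poly {poly C}} => F`_j) H.
  rewrite !mulrBr !mulr1 -!exprD coefB !coef_affine_exp coefB !coefCM !coefXn => ->.
  by [].
have nm : (n + m == n)%N = false by rewrite -{2}[n]addn0 eqn_add2l gtn_eqF.
have bP0 : (b%:P : {poly C}) != 0 by rewrite polyC_eq0.
have top : b ^+ (n + m) = b.
  have := co (n + m)%N; rewrite subnn expr0 mul1r binn mulr1n eqxx nm.
  rewrite bin_small ?mulr0n ?subr0 ?mulr1; last by rewrite -{1}[n]addn0 ltn_add2l.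
  by rewrite -rmorphXn => /polyC_inj.
have bot : p ^+ (n + m) = p ^+ n.
  have := co 0%N; rewrite !subn0 !bin0 !mulr1n !expr0 !mulr1.
  have -> : (0 == n + m)%N = false by rewrite ltn_eqF // addn_gt0 n0.
  have -> : (0 == n)%N = false by rewrite ltn_eqF.
  by rewrite subrr mulr0 => /eqP; rewrite subr_eq0 => /eqP.
suff p0 : p = 0.
  split => //; have := co n; rewrite p0 subnn expr0 mul1r binn mulr1n eqxx [(n == _)%N]eq_sym nm.
  rewrite addKn expr0n (gtn_eqF m0) /= mul0r mul0rn !sub0r mulrN1.
  move=> /oppr_inj; rewrite -rmorphXn => /polyC_inj bn.
  by apply: (mulfI b0); rewrite mulr1 -{1}bn -exprD.
have sub1 : (n + m - (n + m).-1 = 1)%N by lia.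
have := co (n + m).-1; rewrite sub1 expr1.
have -> : ((n + m).-1 == n + m)%N = false by lia.
have -> : 'C(n + m, (n + m).-1) = (n + m)%N.
  by rewrite -bin_sub ?leq_pred // sub1 bin1.
have [m1|m1] := eqVneq m 1%N; last first.
  have -> : ((n + m).-1 == n)%N = false by lia.
  rewrite bin_small ?mulr0n ?subr0 ?mulr0; last by lia.
  move=> /eqP; rewrite -mulr_natr !mulf_eq0 expf_eq0 (negPf bP0) andbF orbF.
  by rewrite -polyC_natr polyC_eq0 pnatr_eq0 addn_eq0 (gtn_eqF n0) /= orbF => /eqP.
rewrite m1 addn1 /= subnn expr0 mul1r binn mulr1n eqxx sub0r mulrN1.
have bn : b ^+ n = 1.
  by apply: (mulfI b0); rewrite mulr1 -exprS; move: top; rewrite m1 addn1.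
rewrite -rmorphXn /= bn mulr1 => E.
have [//|pn0] := eqVneq p 0.
have p1 : p = 1.
  rewrite m1 addn1 exprSr -{2}[p ^+ n]mulr1 in bot.
  by apply: (mulfI _ bot); rewrite expf_neq0.
have bE : b = - n%:R.
  move: E; rewrite p1 -polyC1 -polyCMn -polyCB -polyCN => /polyC_inj E.
  by apply: oppr_inj; rewrite -E opprK -addn1 natrD addrK.
have : N b ^+ n = 1 by rewrite -NX bn Normc.normc1.
move/eqP; rewrite pexpr_eq1 ?N_ge0 // bE NN N_natr pnatr_eq1 => /eqP n1.
by move: bn; rewrite bE n1 expr1 => /eqP; rewrite ?mulr1n eq_sym -subr_eq0 opprK -mulr2n pnatr_eq0.
Qed.
End PolynomialRelations.

Section Periodicity.
Variable R : realType.
Local Notation C := R[i].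
Implicit Types (f u v P W : C -> C) (z w c : C).

(** * From the periodic quotient to the function *)

(** The values at the zeros of the denominators are arbitrary, hence the factor
    [v z * v (z + c)], which is cancelled by the identity theorem. *)
Lemma meromorphic_period_cross u v c : holo u -> holo v -> (exists z, v z != 0) ->
  meromorphic_has_period (fun z => u z / v z) c ->
  forall z, u (z + c) * v z = u z * v (z + c).
Proof.
move=> eu ev v0 [c0 H] z.
have euc := entire_translate c eu; have evc := entire_translate c ev.
have vc0 : exists z, v (z + c) != 0 by have [z1 h] := v0; exists (z1 - c); rewrite subrK.
have eE : holo (fun z => u (z + c) * v z - u z * v (z + c)).
  by apply: entireB; exact: entireM.
have eV : holo (fun z => v z * v (z + c)) by exact: entireM.
apply/eqP; rewrite -subr_eq0; apply/eqP; move: z.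
apply: (entire_mul_eq0 eV eE); last exact: entire_mul_neq0.
have /near_punctC[d d0 Hd] := H 0.
apply: (entire_near_eq0 (entireM eV eE) d0) => w w0 wd.
have [vw|vw] := eqVneq (v w) 0; first by rewrite vw !mul0r.
have [vwc|vwc] := eqVneq (v (w + c)) 0; first by rewrite vwc mulr0 mul0r.
have /= E := Hd w w0 wd.
have -> : u (w + c) * v w - u w * v (w + c) =
  (u (w + c) / v (w + c) - u w / v w) * (v w * v (w + c)).
  by field; rewrite vw vwc.
by rewrite E subrr mul0r mulr0.
Qed.

Lemma derive1n_cst_add (a : C) u n : holo u -> (0 < n)%N ->
  (fun z => a + u z)^`(n)%classic = u^`(n)%classic.
Proof.
move=> eu; have E : (fun z => a + u z)^`()%classic = u^`()%classic.
  apply/funext => z; rewrite (cder_val (cderD (cder_cst a z) (entire_cder z eu))).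
  by rewrite add0r.
by case: n => [//|n _]; rewrite !derive1Sn E.
Qed.

Lemma derive1n_translate u c n z : holo u ->
  (fun z => u (z + c))^`(n)%classic z = u^`(n)%classic (z + c).
Proof.
move=> eu; elim: n z => [//|n IH] z; rewrite !derive1nS.
have -> : (fun z => u (z + c))^`(n)%classic = (fun z => u^`(n)%classic (z + c)).
  by apply/funext.
by apply: cder_val; apply: cder_translate; apply: entire_cder; exact: holo_derive1n.
Qed.

Lemma derive1n_lin u v (b : C) n z : holo u -> holo v ->
  (fun z => u z - b * v z)^`(n)%classic z = u^`(n)%classic z - b * v^`(n)%classic z.
Proof.
move=> eu ev; elim: n z => [//|n IH] z; rewrite !derive1nS.
have -> : (fun z => u z - b * v z)^`(n)%classic =
   (fun z => u^`(n)%classic z - b * v^`(n)%classic z) by apply/funext.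
apply: cder_val; apply: cderB; first by apply: entire_cder; exact: holo_derive1n.
by apply: cderZ; apply: entire_cder; exact: holo_derive1n.
Qed.

(** The quotient of the [n]-th derivative of [exp W] by [exp W], which is a
    differential polynomial in [W]. *)
Fixpoint exp_factor W n : C -> C :=
  if n is n'.+1 then
    fun z => (exp_factor W n')^`()%classic z + exp_factor W n' z * W^`()%classic z
  else fun=> 1.

Lemma cder_mul_cexp u W z : holo u -> holo W ->
  cder (fun w => u w * cexp (W w)) z
    ((u^`()%classic z + u z * W^`()%classic z) * cexp (W z)).
Proof.
move=> eu eW.
have alg (a b e w : C) : a * e + b * (e * w) = (a + b * w) * e by ring.
have K : cder (fun w => cexp (W w)) z (cexp (W z) * W^`()%classic z).
  exact: (cder_comp (cder_cexp (W z)) (entire_cder z eW)).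
apply: (cder_eq (cderM (entire_cder z eu) K)).
exact: alg.
Qed.

Lemma small_exp_factor P Q W n : small P Q W -> small P Q (exp_factor W n).
Proof.
move=> hW; elim: n => [|n IH]; first exact: small_cst.
apply: small_add; first exact: small_derive.
by apply: small_mul => //; exact: small_derive.
Qed.

Lemma derive1n_cexp P Q W n z : small P Q W ->
  (fun z => cexp (W z))^`(n)%classic z = exp_factor W n z * cexp (W z).
Proof.
move=> hW; elim: n z => [|n IH] z; first by rewrite mul1r.
rewrite derive1nS; have -> : (fun z => cexp (W z))^`(n)%classic =
  (fun z => exp_factor W n z * cexp (W z)) by apply/funext.
have eW := small_holo hW.
exact: cder_val (cder_mul_cexp z (small_holo (small_exp_factor n hW)) eW).
Qed.

Section Quotient.
Variables (f : C -> C) (n m k : nat) (c : C).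
Hypotheses (hf : transcendental_entire f) (n0 : (0 < n)%N) (m0 : (0 < m)%N) (k0 : (0 < k)%N).

Let ef : holo f. Proof. by case: hf => ef _; split. Qed.

Let not_poly : ~ exists q : {poly C}, forall z, f z = q.[z].
Proof. by case: hf. Qed.

Let den z := f z ^+ n * (f z ^+ m - 1).

Let eden : holo den.
Proof.
by apply: entireM; [exact: entireX|apply: entireB; [exact: entireX|exact: entire_cst]].
Qed.

Lemma derive1n_neq0 j : exists z, f^`(j)%classic z != 0.
Proof. by apply: not_zero_ex => H; apply: not_poly; exact: derive1n_eq0_poly ef H. Qed.

(** A vanishing denominator would be an algebraic relation for [f]. *)
Lemma den_neq0 : exists z, den z != 0.
Proof.
apply: not_zero_ex => H; apply: not_poly.
apply: (@algebraic_entire_poly _ f ('X ^+ n * ('X ^+ m - 1))) => //.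
  rewrite mulf_neq0 ?expf_neq0 ?polyX_eq0 // -size_poly_eq0.
  by rewrite size_polyDl ?size_polyXn // size_polyN size_poly1.
by move=> z; apply: etrans (H z); rewrite /den !hornerE.
Qed.

Let cross j : meromorphic_has_period (fun z => f^`(j)%classic z / den z) c ->
  forall z, f^`(j)%classic (z + c) * den z = f^`(j)%classic z * den (z + c).
Proof. exact: (meromorphic_period_cross (holo_derive1n j ef) eden den_neq0). Qed.

Theorem periodic_of_exponential (a : C) P : holo P ->
  (forall z, f z = a + cexp (P z)) ->
  meromorphic_has_period (fun z => f^`(k)%classic z / den z) c -> is_periodic f.
Proof.
move=> eP fE hper; have c0 : c != 0 by case: hper.
pose Q z := P (z + c); have eQ : holo Q by exact: entire_translate.
have sP : small P Q P by exact: small_P.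
have sQ : small P Q Q by exact: small_Q.
have ex W : holo W -> holo (fun z => cexp (W z)) by exact: entire_cexp.
have fkE : f^`(k)%classic = (fun z => cexp (P z))^`(k)%classic.
  rewrite -(derive1n_cst_add a (ex P eP) k0); congr (derive1n k _).
  exact/funext.
have fk z : f^`(k)%classic z = exp_factor P k z * cexp (P z).
  by rewrite fkE (derive1n_cexp _ _ sP).
have fkc z : f^`(k)%classic (z + c) = exp_factor Q k z * cexp (Q z).
  rewrite fkE -(derive1n_translate c k z (ex P eP)).
  exact: (derive1n_cexp k z sQ).
pose G : {poly C} := ('X + a%:P) ^+ n * (('X + a%:P) ^+ m - 1).
have GE w : G.[w] = (a + w) ^+ n * ((a + w) ^+ m - 1).
  by rewrite /G !hornerE [w + a]addrC.
have sX j : size (('X + a%:P) ^+ j) = j.+1.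
  by rewrite -[a]opprK polyCN size_exp_XsubC.
have sX1 : size (('X + a%:P) ^+ m - 1) = m.+1.
  by rewrite size_polyDl ?sX // size_polyN size_poly1.
have sG : size G = (n + m).+1.
  rewrite /G size_mul ?sX ?sX1 -?size_poly_eq0 ?sX ?sX1 //.
  by rewrite addSn addnS.
(* Were [G] a monomial, [-a] and [1 - a] would both be [0]. *)
have [d dN Gd] : exists2 d, (d < n + m)%N & G`_d != 0.
  apply: contrapT => K.
  have G0 w : G.[w] = G`_(n + m) * w ^+ (n + m).
    rewrite horner_coef sG big_ord_recr /= big1 ?add0r // => j _.
    have [->|gj] := eqVneq G`_j 0; first by rewrite mul0r.
    by exfalso; apply: K; exists j.
  have GN : G`_(n + m) != 0.
    have : lead_coef G != 0 by rewrite lead_coef_eq0 -size_poly_eq0 sG.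
    by rewrite lead_coefE sG.
  have nm : (n + m != 0)%N by rewrite addn_eq0 (gtn_eqF n0).
  have := G0 (- a); rewrite GE subrr expr0n (gtn_eqF n0) mul0r => /esym/eqP.
  rewrite mulf_eq0 (negPf GN) expf_eq0 oppr_eq0 lt0n nm /= => /eqP a0.
  have := G0 1; rewrite GE a0 add0r !expr1n subrr mulr0 mulr1 => /esym/eqP.
  by rewrite (negPf GN).
have h0 : exists z, exp_factor P k z != 0.
  have [z hz] := derive1n_neq0 k; exists z.
  by move: hz; rewrite fk mulf_eq0 negb_or => /andP[].
have H0 : exists z, exp_factor Q k z != 0.
  have [z hz] := derive1n_neq0 k; exists (z - c).
  by move: hz; rewrite -{1}(subrK c z) fkc mulf_eq0 negb_or => /andP[].
have nm1 : (1 < n + m)%N by lia.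
have [|c' [c'0 Hc']] := exponential_period eP c0 (small_exp_factor k sP)
    (small_exp_factor k sQ) h0 H0 sG nm1 dN Gd.
  move=> z; have := cross hper z; rewrite fkc fk /den !fE -!GE -/(Q z).
  by move=> ->.
by exists c'; split => // z; rewrite !fE Hc'.
Qed.

(** A value omitted by [f] makes [f'/(f - a)] entire, and its primitive is a
    logarithm of [f - a] up to a constant. *)
Lemma omitted_value_exponential (a : C) : picard_exceptional f a ->
  exists2 P, holo P & forall z, f z = a + cexp (P z).
Proof.
move=> H; have fa z : f z - a != 0 by rewrite subr_eq0.
have Dfa z : cder (fun w => f w - a) z (f^`()%classic z - 0).
  exact: (cderB (entire_cder z ef) (cder_cst a z)).
have eq : holo (fun z => f^`()%classic z * (f z - a)^-1).
  apply: entireM; first exact: entire_derive.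
  by apply: cder_entire => z; eexists; exact: (cder_inv (f := fun w => f w - a) (fa z) (Dfa z)).
have [L eL HL] := entire_primitive eq.
have D z : cder (fun w => (f w - a) * cexp (- L w)) z 0.
  have alg (p e v : C) : v != 0 -> (p - 0) * e + v * (e * - (p / v)) = 0.
    by move=> v0; field.
  have K := @cder_comp _ (@cexp R) (fun w => - L w) z _ _ (cder_cexp (- L z)) (cderN (HL z)).
  by apply: (cder_eq (cderM (Dfa z) K)); exact: alg.
have eD : holo (fun w => (f w - a) * cexp (- L w)) by apply: cder_entire => z; exists 0.
have [k1 Hk1] : exists k1, cexp k1 = (f 0 - a) * cexp (- L 0).
  by apply: cexp_surj; rewrite mulf_neq0 // cexp_neq0.
exists (fun z => k1 + L z); first by apply: entireD => //; exact: entire_cst.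
move=> z; rewrite cexpD Hk1 -(derive_eq0_cst eD D z) -mulrA -cexpD.
by rewrite addNr cexp0 mulr1 addrC subrK.
Qed.

(** Dividing the two relations shows that [f^(k)] and its translate have the same
    logarithmic derivative; so [f (z + c) = b f z + p z] with [p] a polynomial,
    and the transcendence of [f] leaves a polynomial identity. *)
Theorem periodic_of_two_quotients :
  meromorphic_has_period (fun z => f^`(k)%classic z / den z) c ->
  meromorphic_has_period (fun z => f^`(k.+1)%classic z / den z) c ->
  is_periodic f.
Proof.
move=> h1 h2; have c0 : c != 0 by case: h1.
have r1 := cross h1; have r2 := cross h2.
have efc := entire_translate c ef; have edc := entire_translate c eden.
have dc0 : exists z, den (z + c) != 0.
  by have [z hz] := den_neq0; exists (z - c); rewrite subrK.
have ek := holo_derive1n k ef; have ekc := entire_translate c ek.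
have ek1 := holo_derive1n k.+1 ef; have ek1c := entire_translate c ek1.
have [b Hb] : exists b : C, forall z, f^`(k)%classic (z + c) = b * f^`(k)%classic z.
  apply: (wronskian_eq0 ekc ek); first exact: derive1n_neq0.
  move=> z; rewrite (cder_val (cder_translate (entire_cder (z + c) ek))) -derive1nS.
  move: z; apply: (@entire_mul_cancel _ (fun z => den z * den (z + c))).
  - exact: entireM.
  - exact: entireM.
  - exact: entireM.
  - exact: (entire_mul_neq0 eden edc den_neq0 dc0).
  move=> z.
  transitivity ((f^`(k.+1)%classic (z + c) * den z) * (f^`(k)%classic z * den (z + c))).
    by ring.
  by rewrite r2 -r1; ring.
have b0 : b != 0.
  have [z hz] := derive1n_neq0 k; apply/eqP => b0; move/eqP : hz; apply.
  by rewrite -(subrK c z) Hb b0 mul0r.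
have Hden z : den (z + c) = b * den z.
  move: z; apply: (entire_mul_cancel ek edc (entireZ b eden) (derive1n_neq0 k)) => z.
  by rewrite -r1 Hb; ring.
have [p Hp] : exists p : {poly C}, forall z, f (z + c) - b * f z = p.[z].
  apply: (@derive1n_eq0_poly _ (fun z => f (z + c) - b * f z) k).
    by apply: entireB => //; exact: entireZ.
  by move=> z; rewrite derive1n_lin // derive1n_translate // Hb subrr.
pose U : {poly {poly C}} := p%:P + b%:P%:P * 'X.
have [p0 bm] : p = 0 /\ b ^+ m = 1.
  apply: (@affine_symmetry _ b p n m) => //; apply/eqP; rewrite -subr_eq0.
  apply: contraPT not_poly => F0; apply; apply: (algebraic_entire_poly ef F0) => z.
  rewrite !hornerE /=.
  have := Hden z; rewrite /den.
  have -> : f (z + c) = p.[z] + b * f z by rewrite -Hp subrK.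
  by move=> /eqP; rewrite -subr_eq0 => /eqP; apply: etrans; rewrite !hornerE.
have step z : f (z + c) = b * f z.
  by apply/eqP; rewrite -subr_eq0 Hp p0 horner0.
exists (m%:R * c); split; first by rewrite mulf_neq0 // pnatr_eq0 -lt0n.
suff iter j z : f (z + j%:R * c) = b ^+ j * f z by move=> z; rewrite iter bm mul1r.
elim: j z => [|j IH] z.
  by rewrite mul0r addr0 mul1r.
by rewrite -natr1 mulrDl mul1r addrA step IH exprS mulrA.
Qed.
End Quotient.
End Periodicity.

Theorem theorem3p1 (R : realType) (f : R[i] -> R[i]) (n m k : nat) (c : R[i])
  (hf : transcendental_entire f)
  (hn : (0 < n)%N) (hm : (0 < m)%N) (hk : (0 < k)%N)
  (hper : meromorphic_has_period
            (fun z => f^`(k)%classic z / (f z ^+ n * (f z ^+ m - 1))) c)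
  (hcond :
     (exists P : R[i] -> R[i],
        entire P /\ nonconstant P /\ forall z, f z = cexp (P z))
     \/ ((exists a : R[i], a != 0 /\ picard_exceptional f a)
         /\ (hyper_order f < +oo)%E)
     \/ meromorphic_has_period
          (fun z => f^`(k.+1)%classic z / (f z ^+ n * (f z ^+ m - 1))) c) :
  is_periodic f.
Proof.
case: hcond => [[P [eP [_ fE]]]|[[[a [_ Ha]] _]|hper']].
- apply: (periodic_of_exponential hf hn hm hk (a := 0) (Holo eP) _ hper) => z.
  by rewrite add0r.
- have [P eP fE] := omitted_value_exponential hf Ha.
  exact: (periodic_of_exponential hf hn hm hk eP fE hper).
- exact: (periodic_of_two_quotients hf hn hm hper hper').
Qed.
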